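(* Let $X=(x_1,\dots,x_N)$ and $Y=(y_1,\dots,y_N)$ be in $\mathcal{X}_N(L)$ and $t\ge 0$. The transition probability of the ASEP on the ring is $$\mathbb{P}_Y(X;t)=u_Y(X;t),\qquad u_Y(X;t)=\sum_{\mathbb{L}\in\mathbb{Z}^N(0)}u_Y^{\mathbb{L}}(X;t),\qquad u_Y^{\mathbb{L}}(X;t)=\sum_{\sigma\in S_N}\Lambda_Y^{\mathbb{L}}(X;t;\sigma),$$ where the series over $\mathbb{L}\in\mathbb{Z}^N(0)$ is absolutely convergent.
   Context: Process. Fix integers $N,L\ge1$ and $p,q\in(0,1)$ with $p+q=1$. Let $$\mathcal{X}_N(L)=\{(x_1,\dots,x_N)\in\mathbb{Z}^N: x_1<x_2<\dots<x_N<x_1+L\}.$$ For $X=(x_1,\dots,x_N)$ put $X_i^{\pm}=(x_1,\dots,x_{i-1},x_i\pm1,x_{i+1},\dots,x_N)$. The ASEP with $N$ particles on a ring of length $L$ (lifted to $\mathbb{Z}$ by tracking winding numbers) is the continuous-time Markov chain on $\mathcal{X}_N(L)$ in which each particle $i$ has an independent exponential clock of rate $1$; when it rings, the state $X$ is replaced by $X_i^+$ with probability $p$ or by $X_i^-$ with probability $q$, provided the new vector lies in $\mathcal{X}_N(L)$ (i.e. the target site is not occupied by another particle of the ring); otherwise nothing changes. $\mathbb{P}_Y(X;t)$ is the probability of being in state $X$ at time $t$ when started from $Y$ at time $0$. Formula. $\mathbb{Z}^N(k)$ is the set of $\mathbb{L}=(\ell_1,\dots,\ell_N)\in\mathbb{Z}^N$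 with $\ell_1+\dots+\ell_N=k$. For $\sigma\in S_N$, $$A_\sigma(\xi_1,\dots,\xi_N)=\operatorname{sgn}(\sigma)\prod_{1\le i<j\le N}\frac{p+q\xi_{\sigma(i)}\xi_{\sigma(j)}-\xi_{\sigma(i)}}{p+q\xi_i\xi_j-\xi_i},$$ $$D_{\mathbb{L}}(\xi_1,\dots,\xi_N)=\prod_{j=1}^N\Big(\xi_j^L\prod_{k=1}^N\frac{p+q\xi_k\xi_j-\xi_k}{p+q\xi_k\xi_j-\xi_j}\Big)^{\ell_j},\qquad \epsilon(\xi)=p\xi^{-1}+q\xi-1,$$ $$\Lambda_Y^{\mathbb{L}}(X;t;\sigma)=\frac1{(2\pi i)^N}\oint_C d\xi_1\cdots\oint_C d\xi_N\,A_\sigma(\xi_1,\dots,\xi_N)\prod_{j=1}^N\Big[\xi_{\sigma(j)}^{x_j-y_{\sigma(j)}-1}e^{\epsilon(\xi_j)t}\Big]D_{\mathbb{L}}(\xi_1,\dots,\xi_N),$$ where $C=\{|z|=r\}$ is a counterclockwise circle with $r>0$ small enough that the integrand is analytic for $0<|\xi_i|\le r$, $i=1,\dots,N$ (i.e. $p+q\xi\xi'-\xi\neq0$ whenever $|\xi|,|\xi'|\le r$). *)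

(* Defs.v *)
From HB Require Import structures.
From mathcomp Require Import all_boot all_order all_algebra all_fingroup.
From mathcomp Require Import all_classical all_reals all_analysis.
From mathcomp Require Import complex.

Set Implicit Arguments.
Unset Strict Implicit.
Unset Printing Implicit Defensive.

Import Order.TTheory GRing.Theory Num.Theory.
Import numFieldNormedType.Exports.

Local Open Scope classical_set_scope.
Local Open Scope ring_scope.
Local Open Scope complex_scope.

Section Configurations.
Context {N : nat}.
Implicit Types (x : {ffun 'I_N -> int}) (i : 'I_N).

Definition is_config (L : nat) x : bool :=
  [forall i : 'I_N, forall j : 'I_N, (i < j)%N ==> (x i < x j)] &&
  [forall i : 'I_N, forall j : 'I_N, (i == 0%N :> nat) && (j.+1 == N) ==> (x j < x i + L%:Z)].

Definition shift_particle x i (e : int) : {ffun 'I_N -> int} :=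
  [ffun j => if j == i then x j + e else x j].

(* The effect of a ring of the clock of particle i, the attempted jump being to
   the right iff b = true. *)
Definition attempt_jump (L : nat) x i (b : bool) : {ffun 'I_N -> int} :=
  let x' := shift_particle x i (if b then 1 else -1) in
  if is_config L x' then x' else x.

Definition intvec_sum (k : int) : set {ffun 'I_N -> int} :=
  [set l | \sum_i l i = k].

End Configurations.

Section Process.
Context {R : realType} {T : Type} {N : nat}.
(* E i k is the waiting time of the clock of particle i between its rings k-1
   and k (before ring 0 when k = 0); B i k is the direction drawn at ring k. *)
Variables (E : 'I_N -> nat -> T -> R) (B : 'I_N -> nat -> T -> bool).

Definition ring_time (i : 'I_N) (k : nat) (w : T) : R :=
  \sum_(m < k.+1) E i m w.

(* The particle whose clock rings next, c i being the number of past rings of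
   the clock of particle i. *)
Definition next_clock (c : {ffun 'I_N -> nat}) (w : T) : option 'I_N :=
  [pick i | [forall j, ring_time i (c i) w <= ring_time j (c j) w]].

Definition asep_step (L : nat) (w : T)
    (s : {ffun 'I_N -> int} * {ffun 'I_N -> nat}) :=
  if next_clock s.2 w is Some i then
    (attempt_jump L s.1 i (B i (s.2 i) w),
     [ffun j => if j == i then (s.2 j).+1 else s.2 j])
  else s.

(* Configuration and numbers of rings after the first n rings, all clocks taken
   together, from the initial configuration Y. *)
Definition asep_run (L : nat) (Y : {ffun 'I_N -> int}) (n : nat) (w : T) :=
  iter n (asep_step L w) (Y, [ffun=> 0%N]).

(* The event that the process started at Y is in configuration X at time t: for
   some n, the rings in [0, t] are exactly the first n ones, and these lead
   from Y to X. Simultaneous rings and infinitely many rings in [0, t] have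
   probability 0. *)
Definition asep_at (L : nat) (Y : {ffun 'I_N -> int}) (t : R)
    (X : {ffun 'I_N -> int}) : set T :=
  [set w | exists n, let s := asep_run L Y n w in
     (forall i k, (ring_time i k w <= t) = (k < s.2 i)%N) /\ s.1 = X].

End Process.

Definition mutually_independent {d} {T : measurableType d} {R : realType}
    (P : probability T R) (I : eqType) (F : I -> set (set T)) : Prop :=
  forall (s : seq I) (A : I -> set T), uniq s ->
    (forall j, j \in s -> F j (A j)) ->
    P (\big[setI/setT]_(j <- s) A j) = (\prod_(j <- s) P (A j))%E.

Definition asep_clocks {d} {T : measurableType d} {R : realType}
    (P : probability T R) (N : nat) (p : R)
    (E : 'I_N -> nat -> {RV P >-> R})
    (B : 'I_N -> nat -> {RV P >-> bool}) : Prop :=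
  [/\ forall i k (A : set R), measurable A ->
        distribution P (E i k) A = exponential_prob 1 A,
      forall i k (A : set bool), measurable A ->
        distribution P (B i k) A = bernoulli_prob p A
    & mutually_independent P
        (fun a : ('I_N * nat) + ('I_N * nat) =>
           match a with
           | inl (i, k) => preimage_set_system setT (E i k) measurable
           | inr (i, k) => preimage_set_system setT (B i k) measurable
           end)].

Section ComplexAnalysis.
Context {R : realType}.

Definition cexp (z : R[i]) : R[i] :=
  (expR (complex.Re z))%:C *
  (cos (complex.Im z) +i* sin (complex.Im z)).

Definition cintegral (D : set R) (f : R -> R[i]) : R[i] :=
  (\int[lebesgue_measure]_(x in D) complex.Re (f x)) +i*
  (\int[lebesgue_measure]_(x in D) complex.Im (f x)).

(* Integral along the circle |z| = r, counterclockwise: z = r exp(i theta) and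
   dz = i z dtheta. *)
Definition circle_integral (r : R) (f : R[i] -> R[i]) : R[i] :=
  cintegral `[0, 2 * pi] (fun theta =>
    let z := r%:C * cexp ('i * theta%:C) in f z * ('i * z)).

(* Iterated integral over |xi_i| = r, the outermost variable being xi ord0. *)
Fixpoint multi_circle_integral (r : R) (n : nat) :
    (('I_n -> R[i]) -> R[i]) -> R[i] :=
  match n with
  | 0%N => fun f => f (fun=> 0)
  | m.+1 => fun f => circle_integral r (fun z =>
      multi_circle_integral r (fun xi : 'I_m -> R[i] =>
        f (fun i => if unlift ord0 i is Some j then xi j else z)))
  end.

Definition rsum {I : choiceType} (D : set I) (f : I -> R) : R :=
  fine (\esum_(x in D) (EFin \o f)^\+ x - \esum_(x in D) (EFin \o f)^\- x)%E.

(* Meaningful for absolutely summable families. *)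
Definition csum {I : choiceType} (D : set I) (f : I -> R[i]) : R[i] :=
  rsum D (fun x => complex.Re (f x)) +i* rsum D (fun x => complex.Im (f x)).

(* `|f x| is an element of R[i], with zero imaginary part. *)
Definition csummable {I : choiceType} (D : set I) (f : I -> R[i]) : Prop :=
  summable D (fun x => (complex.Re `|f x|)%:E).

End ComplexAnalysis.

Section Formula.
Context {R : realType} {N : nat}.
Variables (L : nat) (p q : R).
Implicit Types (xi : 'I_N -> R[i]) (X Y l : {ffun 'I_N -> int}).

Definition bethe (a b : R[i]) : R[i] := p%:C + q%:C * a * b - a.

Definition admissible_radius (r : R) : Prop :=
  0 < r /\
  forall a b : R[i], `|a| <= r%:C -> `|b| <= r%:C -> bethe a b != 0.

Definition A_coef (s : 'S_N) xi : R[i] :=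
  (-1) ^+ s *
  \prod_(i < N) \prod_(j < N | (i < j)%N)
    (bethe (xi (s i)) (xi (s j)) / bethe (xi i) (xi j)).

Definition D_coef l xi : R[i] :=
  \prod_(j < N)
    (xi j ^+ L * \prod_(k < N)
      (bethe (xi k) (xi j) / bethe (xi j) (xi k))) ^ (l j).

Definition energy (a : R[i]) : R[i] := p%:C * a^-1 + q%:C * a - 1.

Definition Lambda (r : R) Y l X (t : R) (s : 'S_N) : R[i] :=
  ((2 * pi%:C * 'i) ^+ N)^-1 *
  multi_circle_integral r (fun xi =>
    A_coef s xi *
    (\prod_(j < N) (xi (s j) ^ (X j - Y (s j) - 1) *
                    cexp (energy (xi j) * t%:C))) *
    D_coef l xi).

Definition u_term (r : R) Y X (t : R) l : R[i] :=
  \sum_(s : 'S_N) Lambda r Y l X t s.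

Definition u_sum (r : R) Y X (t : R) : R[i] :=
  csum (intvec_sum 0) (u_term r Y X t).

End Formula.

(* Main.v *)
Require Import Defs.
From HB Require Import structures.
From mathcomp Require Import all_boot all_order all_algebra all_fingroup.
From mathcomp Require Import all_classical all_reals all_analysis.
From mathcomp Require Import measurable_realfun complex.
From mathcomp Require Import ring lra zify.

Set Implicit Arguments.
Unset Strict Implicit.
Unset Printing Implicit Defensive.

Import Order.TTheory GRing.Theory Num.Theory.
Import numFieldNormedType.Exports.

Local Open Scope classical_set_scope.
Local Open Scope ring_scope.
Local Open Scope complex_scope.

(** Write W for the pairs w = (s, l) of a permutation and an integer vector of
    sum zero: they index the terms of the formula and form an affine symmetric
    group, acting on vectors of exponents by permutations and by translations by
    L l. The configurations of the ring are the lattice points of the open alcove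
    [cone full], whose walls [gap i = 0] say that two neighbouring particles sit
    on the same site of the ring.

    The product of A_sigma and D_l is a cocycle of W. So each term of the formula
    is the action of an element of W (the operator [star]) on a monomial, followed
    by the extraction of a Laurent coefficient. Since 1 / (p + q a b - a) is a
    geometric series on the torus, everything is a uniform limit of Laurent
    polynomials with controlled exponents, and no complex analysis is needed
    beyond the integral of a power over a circle.

    Time zero. The sum over W of the coefficients of [star w (mono X)] at the
    exponent Y is the indicator of X = Y on configurations ([lam_delta]). Three
    facts about the matrix [ker] of [star] enter: it is triangular with leading
    coefficient (-1)^s, it is multiplicative, and the sum over the stabiliser of
    any face of the alcove is the identity on the corresponding cone ([ker_cone]).
    The last one is a finite cancellation, in which an antisymmetric sum clears
    the denominators. From there an Euler characteristic argument applies: for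
    each proper set J of walls the stabiliser of the face reproduces the whole sum
    over W, the alternating sum over J leaves the contribution of the alcove, and
    the constant that comes out is computed at X = Y. Triangularity then inverts
    the relation.

    Positive time. Expanding exp (t (sum_i (p / xi_i + q xi_i) - N)) turns the
    formula into exp (- N t) sum_n t^n / n! lambda_n (X). The numbers lambda_n
    satisfy the free recursion of N independent walkers, and on a wall the
    boundary relation p u(x, x) + q u(x+1, x+1) = u(x, x+1), because w and w times
    the reflection in the wall cancel ([lamn_wall]). By induction lambda_n is then
    the n-th iterate of the jump chain ([lamn_jump]). In lambda_n only vectors l
    of size O(n) contribute, which gives the absolute convergence and the
    rearrangement of the series ([u_sum_expansion]).

    Probability. A word lists the clocks that ring and the directions drawn. By
    successive integration of the last waiting time, the event that exactly the
    rings of a word occur, in this order, during [0, t] has probability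
    exp (- N t) t^n / n! times the product of the p and q of the word
    ([prob_survivor]). The same value is found with strict and with weak order of
    the ring times, and the event of the process lies between the disjoint union
    of the strict events and the union of the weak ones ([asep_at_limit]). *)

(** * Moduli and integrals over a circle *)

(** The norm of R[i] has values in R[i]; this is its real part. *)
Notation nm z := (complex.Re `|z|).

Section Modulus.
Context {R : realType}.
Implicit Types z w : R[i].

Lemma nmE z : `|z| = (nm z)%:C.
Proof. by rewrite normc_def. Qed.

Lemma nm_ge0 z : 0 <= nm z.
Proof. by rewrite -ler0c -nmE. Qed.

Lemma nmM z w : nm (z * w) = nm z * nm w.
Proof. by apply: complexI; rewrite -nmE normrM rmorphM /= -!nmE. Qed.

Lemma nmD z w : nm (z + w) <= nm z + nm w.
Proof. by rewrite -lecR rmorphD /= -!nmE ler_normD. Qed.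

Lemma nmN z : nm (- z) = nm z. Proof. by rewrite normrN. Qed.

Lemma nmB z w : nm (z - w) <= nm z + nm w.
Proof. by apply: le_trans (nmD _ _) _; rewrite nmN. Qed.

Lemma nm0 : nm (0 : R[i]) = 0. Proof. by rewrite normr0. Qed.
Lemma nm1 : nm (1 : R[i]) = 1. Proof. by rewrite normr1. Qed.

Lemma nm_eq0 z : (nm z == 0) = (z == 0).
Proof. by rewrite -(inj_eq (@complexI R)) -nmE normr_eq0. Qed.

Lemma nmX z n : nm (z ^+ n) = nm z ^+ n.
Proof. by apply: complexI; rewrite -nmE normrX rmorphXn /= -nmE. Qed.

Lemma nmV z : nm z^-1 = (nm z)^-1.
Proof. by apply: complexI; rewrite -nmE normfV fmorphV /= -nmE. Qed.

Lemma nmXz z (n : int) : nm (z ^ n) = nm z ^ n.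
Proof. by case: n => n; rewrite /exprz ?nmV nmX. Qed.

Lemma nm_real (x : R) : nm (x%:C) = `|x|.
Proof. by rewrite normc_def /= expr0n /= addr0 sqrtr_sqr. Qed.

Lemma nm_sum (I : Type) (s : seq I) (P : pred I) (F : I -> R[i]) :
  nm (\sum_(i <- s | P i) F i) <= \sum_(i <- s | P i) nm (F i).
Proof.
elim/big_rec2: _ => [|i y1 y2 _ h]; first by rewrite nm0.
by apply: le_trans (nmD _ _) _; rewrite lerD2l.
Qed.

Lemma nm_prod (I : Type) (s : seq I) (P : pred I) (F : I -> R[i]) :
  nm (\prod_(i <- s | P i) F i) = \prod_(i <- s | P i) nm (F i).
Proof.
by elim/big_rec2: _ => [|i y1 y2 _ h]; rewrite ?nm1 // nmM h.
Qed.

Lemma nm_Re z : `|complex.Re z| <= nm z.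
Proof.
case: z => a b; rewrite normc_def /= -sqrtr_sqr.
by apply: ler_wsqrtr; rewrite lerDl sqr_ge0.
Qed.

Lemma nm_Im z : `|complex.Im z| <= nm z.
Proof.
case: z => a b; rewrite normc_def /= -(sqrtr_sqr b).
by apply: ler_wsqrtr; rewrite lerDr sqr_ge0.
Qed.

Lemma nm_leD z : nm z <= `|complex.Re z| + `|complex.Im z|.
Proof.
rewrite [z in X in X <= _]complexE; apply: le_trans (nmD _ _) _.
rewrite nmM !nm_real lerD2l.
by rewrite [`|'i%C|]normc_def /= expr0n expr1n /= add0r sqrtr1 mul1r.
Qed.

(** Identities between integrals are obtained from it: the difference of the two
    sides is compared with approximants of arbitrary precision. *)
Lemma nm_eps z (K : R) : (forall e, 0 < e -> nm z <= K * e) -> z = 0.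
Proof.
move=> h; apply/eqP; rewrite -nm_eq0 eq_le nm_ge0 andbT.
apply/ler_addgt0Pr => e e0; rewrite add0r.
have K0 : 0 < `|K| + 1 by rewrite ltr_wpDl.
apply: le_trans (h (e / (`|K| + 1)) _) _; first by rewrite divr_gt0.
rewrite mulrA ler_pdivrMr // mulrC; apply: ler_wpM2l; first exact: ltW.
by apply: le_trans (ler_norm _) _; rewrite lerDl.
Qed.

Lemma nmi : nm ('i : R[i]) = 1.
Proof. by rewrite normc_def /= expr0n expr1n /= add0r sqrtr1. Qed.

Lemma cisE (x : R) : cexp ('i * x%:C) = (cos x +i* sin x).
Proof.
have -> : 'i * x%:C = 0 +i* x by simpc.
by rewrite /cexp /= expR0 mul1r.
Qed.

Lemma nm_cis (x : R) : nm (cexp ('i * x%:C)) = 1.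
Proof.
by rewrite cisE normc_def /= cos2Dsin2 sqrtr1.
Qed.

End Modulus.

Section Circle.
Context {R : realType}.
Implicit Types z w : R[i].

Definition circ (r x : R) : R[i] := r%:C * cexp ('i * x%:C).

Lemma nm_circ (r x : R) : 0 < r -> nm (circ r x) = r.
Proof. by move=> r0; rewrite nmM nm_cis nm_real mulr1 gtr0_norm. Qed.

Lemma cisX (x : R) (n : nat) :
  (cos x +i* sin x) ^+ n = (cos (n%:R * x) +i* sin (n%:R * x)).
Proof.
elim: n => [|n IH]; first by rewrite expr0 mul0r cos0 sin0.
rewrite exprS IH -natr1 mulrDl mul1r cosD sinD; simpc.
by apply/eqP; rewrite eq_complex /=; apply/andP; split; apply/eqP; ring.
Qed.

Lemma cisV (x : R) : (cos x +i* sin x)^-1 = (cos x -i* sin x).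
Proof.
have h : (cos x +i* sin x) * (cos x -i* sin x) = 1.
  simpc; apply/eqP; rewrite eq_complex /=; apply/andP; split; apply/eqP.
    by rewrite -!expr2 cos2Dsin2.
  by ring.
have h0 : (cos x +i* sin x) != 0.
  by apply/eqP => h0; move/eqP: h; rewrite h0 mul0r eq_sym oner_eq0.
by apply: (mulfI h0); rewrite h mulfV.
Qed.

Lemma cisXz (x : R) (n : int) :
  (cos x +i* sin x) ^ n = (cos (n%:~R * x) +i* sin (n%:~R * x)).
Proof.
case: n => n; first exact: cisX.
rewrite NegzE -exprnN cisX cisV mulrNz mulNr cosN sinN //.
Qed.

Lemma circXz (r x : R) (n : int) : 0 < r ->
  circ r x ^ n = (r ^ n * cos (n%:~R * x)) +i* (r ^ n * sin (n%:~R * x)).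
Proof.
move=> r0; rewrite /circ cisE exprzMl ?unitfE; last 2 first.
- by apply/eqP => -[] /eqP; rewrite gt_eqF.
- apply/eqP => h; have := @cisX x 0; have := nm_cis x.
  by rewrite cisE h nm0 => /eqP; rewrite eq_sym oner_eq0.
rewrite cisXz.
have -> : r%:C ^ n = (r ^ n)%:C.
  by case: n => n; rewrite /exprz ?fmorphV rmorphXn.
by simpc.
Qed.

Lemma continuous_unif (f : R -> R) :
  (forall e, 0 < e -> exists2 h : R -> R, continuous h &
     forall x, `|f x - h x| <= e) -> continuous f.
Proof.
move=> H x; apply/cvgrPdist_le => e e0.
have e3 : 0 < e / 3%:R by rewrite divr_gt0.
have [h ch fh] := H _ e3.
have /cvgrPdist_le/(_ _ e3) := ch x.
apply: filterS => y hy.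
have -> : f x - f y = (f x - h x) + (h x - h y) + - (f y - h y) by ring.
apply: le_trans (ler_normD _ _) _; rewrite normrN.
have -> : e = e / 3%:R + e / 3%:R + e / 3%:R by field.
by rewrite lerD // (le_trans (ler_normD _ _)) // lerD.
Qed.

Let I2 : set R := `[0, 2 * pi].
Let mu := @lebesgue_measure R.

Lemma I2_measurable : measurable I2. Proof. exact: measurable_itv. Qed.

Lemma cont_int (f : R -> R) : continuous f -> mu.-integrable I2 (EFin \o f).
Proof.
move=> cf; apply: continuous_compact_integrable; first exact: segment_compact.
exact: continuous_subspaceT.
Qed.

Lemma mu_I2 : fine (mu I2) = 2 * pi.
Proof.
rewrite /mu /I2 lebesgue_measure_itv /= lte_fin.
by rewrite mulr_gt0 ?pi_gt0 //= subr0.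
Qed.

Lemma Rint_close (f h : R -> R) (e : R) : continuous f -> continuous h ->
  (forall x, `|f x - h x| <= e) ->
  `|\int[mu]_(x in I2) f x - \int[mu]_(x in I2) h x| <= 2 * pi * e.
Proof.
move=> cf ch fh.
have cfh : continuous (fun x => f x - h x).
  by move=> x; apply: cvgB; [exact: cf|exact: ch].
have ifh := cont_int cfh.
rewrite -RintegralB ?I2_measurable //; try exact: cont_int.
apply: le_trans (le_normr_Rintegral _ _) _; [exact: I2_measurable|exact: ifh|].
have -> : 2 * pi * e = \int[mu]_(x in I2) (cst e) x.
  rewrite Rintegral_cst; try exact: I2_measurable.
  by rewrite -mu_I2 mulrC.
apply: le_Rintegral; first exact: I2_measurable.
- by apply: cont_int => x; apply: cvg_norm; exact: cfh.
- by apply: cont_int => x; exact: cvg_cst.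
- by move=> x _; exact: fh.
exact: I2_measurable.
Qed.

Lemma Rint_FTC (f F : R -> R) : (forall x, is_derive x (1 : R) F (f x)) ->
  continuous f -> \int[mu]_(x in I2) f x = F (2 * pi) - F 0.
Proof.
move=> dF cf; rewrite /Rintegral (@continuous_FTC2 _ _ F) //.
- by rewrite mulr_gt0 // pi_gt0.
- exact: continuous_subspaceT.
- have dc : continuous F.
    move=> x; apply/differentiable_continuous/derivable1_diffP.
    by have := dF x => -[].
  split.
  + by move=> x _; have := dF x => -[].
  + by apply: cvg_at_right_filter; exact: dc.
  + by apply: cvg_at_left_filter; exact: dc.
- by move=> x _; rewrite derive1E; have := dF x => -[].
Qed.

Lemma cis2pi (n : int) : cos (n%:~R * (2 * pi)) = 1 :> R /\
  sin (n%:~R * (2 * pi)) = 0 :> R.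
Proof.
have := @cisXz (2 * pi) n.
have -> : cos (2 * pi) +i* sin (2 * pi) = 1 :> R[i].
  by rewrite mulr_natl cos2pi sin2pi.
by rewrite exp1rz => -[].
Qed.

Lemma cont_cosM (k : R) : continuous (fun x : R => cos (k * x)).
Proof.
move=> x; apply: (@continuous_comp _ _ _ (fun x => k * x) cos).
  by apply: cvgM; [exact: cvg_cst|exact: cvg_id].
exact: continuous_cos.
Qed.

Lemma cont_sinM (k : R) : continuous (fun x : R => sin (k * x)).
Proof.
move=> x; apply: (@continuous_comp _ _ _ (fun x => k * x) sin).
  by apply: cvgM; [exact: cvg_cst|exact: cvg_id].
exact: continuous_sin.
Qed.

Lemma derM (k x : R) : is_derive x (1 : R) (fun x : R => k * x) k.
Proof.
have := @is_deriveZ _ _ _ id k x (1 : R) 1 (is_derive_id _ _).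
by rewrite /GRing.scale /= mulr1.
Qed.

Lemma Rint_cos (n : int) : n != 0 ->
  \int[mu]_(x in I2) cos (n%:~R * x) = 0.
Proof.
move=> n0; have nR : n%:~R != 0 :> R by rewrite intr_eq0.
have dF x : is_derive x (1 : R) (fun x => n%:~R^-1 * sin (n%:~R * x)) (cos (n%:~R * x)).
  have h1 := @is_derive1_comp _ sin ( *%R n%:~R) x _ _ (is_derive_sin _) (derM _ _).
  have := @is_deriveZ _ _ _ _ n%:~R^-1 x (1 : R) _ h1.
  by rewrite /GRing.scale /= mulrCA mulVf // mulr1.
rewrite (Rint_FTC dF (@cont_cosM _)) mulr0 sin0 (proj2 (cis2pi n)).
by rewrite subrr.
Qed.

Lemma Rint_sin (n : int) : \int[mu]_(x in I2) sin (n%:~R * x) = 0.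
Proof.
have [->|n0] := eqVneq n 0.
  rewrite (@eq_Rintegral _ _ _ _ _ (cst 0)).
    by rewrite Rintegral_cst ?mul0r //; exact: I2_measurable.
  by move=> x _; rewrite mul0r sin0.
have nR : n%:~R != 0 :> R by rewrite intr_eq0.
have dF x : is_derive x (1 : R) (fun x => - n%:~R^-1 * cos (n%:~R * x)) (sin (n%:~R * x)).
  have h1 := @is_derive1_comp _ cos ( *%R n%:~R) x _ _ (is_derive_cos _) (derM _ _).
  have := @is_deriveZ _ _ _ _ (- n%:~R^-1) x (1 : R) _ h1.
  move=> h; apply: is_derive_eq h _; rewrite /GRing.scale /=.
  by field.
rewrite (Rint_FTC dF (@cont_sinM _)) mulr0 cos0 (proj1 (cis2pi n)).
by rewrite subrr.
Qed.

(** Additivity of the integral needs integrability; continuity is what the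
    uniform limits below preserve. *)
Definition ccont (h : R -> R[i]) :=
  continuous (fun x => complex.Re (h x)) /\ continuous (fun x => complex.Im (h x)).

Lemma ccontD (f h : R -> R[i]) : ccont f -> ccont h -> ccont (fun x => f x + h x).
Proof.
move=> [f1 f2] [h1 h2]; split=> x.
- rewrite (_ : (fun x => complex.Re (f x + h x)) =
    (fun x => complex.Re (f x) + complex.Re (h x))); last first.
    by apply/funext => y; case: (f y) (h y) => ? ? [].
  by apply: cvgD; [exact: f1|exact: h1].
- rewrite (_ : (fun x => complex.Im (f x + h x)) =
    (fun x => complex.Im (f x) + complex.Im (h x))); last first.
    by apply/funext => y; case: (f y) (h y) => ? ? [].
  by apply: cvgD; [exact: f2|exact: h2].
Qed.

Lemma cintegralD (f h : R -> R[i]) : ccont f -> ccont h ->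
  cintegral I2 (fun x => f x + h x) = cintegral I2 f + cintegral I2 h.
Proof.
move=> [f1 f2] [h1 h2]; rewrite /cintegral; simpc; congr (_ +i* _).
- rewrite -RintegralD; [|exact: I2_measurable|exact: cont_int|exact: cont_int].
  by apply: eq_Rintegral => y _; case: (f y) (h y) => ? ? [].
- rewrite -RintegralD; [|exact: I2_measurable|exact: cont_int|exact: cont_int].
  by apply: eq_Rintegral => y _; case: (f y) (h y) => ? ? [].
Qed.

Lemma cont_lin (u v a b : R) : continuous (fun x : R => u * cos (a * x) + v * sin (b * x)).
Proof.
move=> x; apply: cvgD; apply: cvgM; try exact: cvg_cst.
- exact: cont_cosM.
- exact: cont_sinM.
Qed.

Lemma Rint_lin (u v : R) (n : int) :
  \int[mu]_(x in I2) (u * cos (n%:~R * x) + v * sin (n%:~R * x)) =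
  if n == 0 then u * (2 * pi) else 0.
Proof.
have i1 := cont_int (@cont_cosM n%:~R); have i2 := cont_int (@cont_sinM n%:~R).
have c1 : continuous (fun x : R => u * cos (n%:~R * x)).
  by move=> x; apply: cvgM; [exact: cvg_cst|exact: cont_cosM].
have c2 : continuous (fun x : R => v * sin (n%:~R * x)).
  by move=> x; apply: cvgM; [exact: cvg_cst|exact: cont_sinM].
rewrite RintegralD; [|exact: I2_measurable|exact: cont_int|exact: cont_int].
rewrite RintegralZl; [|exact: I2_measurable|exact: i1].
rewrite RintegralZl; [|exact: I2_measurable|exact: i2].
rewrite Rint_sin mulr0 addr0.
case: eqP => [->|/eqP n0]; last by rewrite Rint_cos // mulr0.
rewrite (@eq_Rintegral _ _ _ _ _ (cst 1)).
  by rewrite Rintegral_cst ?mul1r -?mu_I2 //; exact: I2_measurable.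
by move=> x _; rewrite mul0r cos0.
Qed.

Lemma mono1 (r : R) (c : R[i]) (n : int) : 0 < r ->
  ccont (fun x => c * circ r x ^ n) /\
  cintegral I2 (fun x => c * circ r x ^ n) =
    if n == 0 then c * (2 * pi)%:C else 0.
Proof.
move=> r0; case: c => a b.
have E1 x : complex.Re ((a +i* b) * circ r x ^ n) =
    (a * r ^ n) * cos (n%:~R * x) + (- (b * r ^ n)) * sin (n%:~R * x).
  by rewrite circXz //=; ring.
have E2 x : complex.Im ((a +i* b) * circ r x ^ n) =
    (b * r ^ n) * cos (n%:~R * x) + (a * r ^ n) * sin (n%:~R * x).
  by rewrite circXz //=; ring.
split.
  split; [rewrite (funext E1)|rewrite (funext E2)]; exact: cont_lin.
rewrite /cintegral.
have -> : \int[lebesgue_measure]_(x in I2) complex.Re ((a +i* b) * circ r x ^ n)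
   = if n == 0 then a * r ^ n * (2 * pi) else 0.
  by rewrite -(Rint_lin _ (- (b * r ^ n))); apply: eq_Rintegral => x _; exact: E1.
have -> : \int[lebesgue_measure]_(x in I2) complex.Im ((a +i* b) * circ r x ^ n)
   = if n == 0 then b * r ^ n * (2 * pi) else 0.
  by rewrite -(Rint_lin _ (a * r ^ n)); apply: eq_Rintegral => x _; exact: E2.
by case: eqP => [->|//]; rewrite expr0z !mulr1; simpc.
Qed.

Definition ev1 (Q : seq (R[i] * int)) z := \sum_(t <- Q) t.1 * z ^ t.2.
(** Only the power -1 has a nonzero integral over the circle. *)
Definition residue1 (Q : seq (R[i] * int)) := \sum_(t <- Q | t.2 == -1) t.1.

Lemma circ_neq0 (r x : R) : 0 < r -> circ r x != 0.
Proof. by move=> r0; rewrite -nm_eq0 nm_circ // gt_eqF. Qed.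

Lemma ev1_int (r : R) Q : 0 < r ->
  ccont (fun x => ev1 Q (circ r x) * ('i * circ r x)) /\
  cintegral I2 (fun x => ev1 Q (circ r x) * ('i * circ r x)) =
    2 * pi%:C * 'i * residue1 Q.
Proof.
move=> r0; elim: Q => [|[c n] Q [IH1 IH2]].
  rewrite (_ : (fun x => _) = fun x => 0 * circ r x ^ 0); last first.
    by apply/funext => x; rewrite /ev1 big_nil !mul0r.
  have [h1 h2] := mono1 0 0 r0; split => //; rewrite h2 /residue1 big_nil eqxx.
  by rewrite mul0r mulr0.
have E : (fun x => ev1 ((c, n) :: Q) (circ r x) * ('i * circ r x)) =
   fun x => (c * 'i) * circ r x ^ (n + 1) + ev1 Q (circ r x) * ('i * circ r x).
  apply/funext => x; rewrite /ev1 big_cons /= mulrDl; congr (_ + _).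
  by rewrite exprzDr ?unitfE ?circ_neq0 // expr1z; ring.
rewrite E; have [h1 h2] := mono1 (c * 'i) (n + 1) r0.
split; first exact: ccontD.
rewrite cintegralD // h2 IH2 /residue1 big_cons /=.
have -> : (n + 1 == 0) = (n == -1) by rewrite addr_eq0.
case: eqP => _; last by rewrite add0r.
have -> : (2 * pi)%:C = 2 * pi%:C :> R[i] by rewrite rmorphM /= rmorph_nat.
by ring.
Qed.

(** On the circle g is a uniform limit of Laurent polynomials, hence continuous
    and integrable; its integral then differs little from that of Q, which is given
    by the residue. *)
Lemma circle_close (r : R) (g : R[i] -> R[i]) Q (e : R) : 0 < r ->
  (forall e, 0 < e -> exists Q', forall z, nm z = r -> nm (g z - ev1 Q' z) <= e) ->
  (forall z, nm z = r -> nm (g z - ev1 Q z) <= e) ->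
  nm (circle_integral r g - 2 * pi%:C * 'i * residue1 Q) <= 4 * pi * r * e.
Proof.
move=> r0 gapp gQ; have [qc qi] := ev1_int Q r0; rewrite -qi {qi}.
set q := fun x => ev1 Q (circ r x) * ('i * circ r x) in qc *.
pose h := fun x => g (circ r x) * ('i * circ r x).
have bnd Q' e' : (forall z, nm z = r -> nm (g z - ev1 Q' z) <= e') ->
    forall x, nm (h x - ev1 Q' (circ r x) * ('i * circ r x)) <= r * e'.
  move=> H x; rewrite /h -mulrBl nmM nmM nm_circ // mulrC.
  rewrite nmi mul1r.
  by apply: ler_wpM2l; [exact: ltW|apply: H; exact: nm_circ].
have hc : ccont h.
  split; apply: continuous_unif => e' e'0; have e'r : 0 < e' / r by rewrite divr_gt0.
  - have [Q' hQ'] := gapp _ e'r; have [c1 _] := (ev1_int Q' r0).1.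
    exists (fun x => complex.Re (ev1 Q' (circ r x) * ('i * circ r x))) => // x.
    rewrite -raddfB; apply: le_trans (nm_Re _) _.
    by apply: le_trans (bnd _ _ hQ' x) _; rewrite mulrC divfK // gt_eqF.
  - have [Q' hQ'] := gapp _ e'r; have [_ c1] := (ev1_int Q' r0).1.
    exists (fun x => complex.Im (ev1 Q' (circ r x) * ('i * circ r x))) => // x.
    rewrite -raddfB; apply: le_trans (nm_Im _) _.
    by apply: le_trans (bnd _ _ hQ' x) _; rewrite mulrC divfK // gt_eqF.
have -> : circle_integral r g = cintegral I2 h by [].
apply: le_trans (nm_leD _) _.
have -> : 4 * pi * r * e = 2 * pi * (r * e) + 2 * pi * (r * e) by ring.
apply: lerD; rewrite /cintegral /=.
- apply: Rint_close; [exact: hc.1|exact: qc.1|].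
  by move=> x; rewrite -raddfB; apply: le_trans (nm_Re _) _; exact: bnd.
- apply: Rint_close; [exact: hc.2|exact: qc.2|].
  by move=> x; rewrite -raddfB; apply: le_trans (nm_Im _) _; exact: bnd.
Qed.

End Circle.

(** * Laurent coefficients on a torus *)

Section Torus.
Context {R : realType}.
Implicit Types (N : nat).

Definition mono N (m : {ffun 'I_N -> int}) (xi : 'I_N -> R[i]) : R[i] :=
  \prod_i xi i ^ m i.

Definition ev N (P : seq (R[i] * {ffun 'I_N -> int})) (xi : 'I_N -> R[i]) : R[i] :=
  \sum_(t <- P) t.1 * mono t.2 xi.

Definition coefP N (Z : {ffun 'I_N -> int}) (P : seq (R[i] * {ffun 'I_N -> int})) : R[i] :=
  \sum_(t <- P | t.2 == Z) t.1.

Definition onT N (r : R) (xi : 'I_N -> R[i]) := forall i, nm (xi i) = r.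

(** Uniform limits on the torus of Laurent polynomials with exponents in Q. This
    replaces analyticity near the torus, and Q records the support of the Laurent
    expansion. *)
Definition appr N (r : R) (Q : {ffun 'I_N -> int} -> Prop) (g : ('I_N -> R[i]) -> R[i]) :=
  forall e : R, 0 < e -> exists P : seq (R[i] * {ffun 'I_N -> int}),
    (forall t, t \in P -> Q t.2) /\
    forall xi, onT r xi -> nm (g xi - ev P xi) <= e.

Definition anyexp N (m : {ffun 'I_N -> int}) := True.

Definition tpi : R[i] := 2 * pi%:C * 'i.

Definition consv N (z : R[i]) (xi : 'I_N -> R[i]) : 'I_N.+1 -> R[i] :=
  fun i => if unlift ord0 i is Some j then xi j else z.

Definition tailm N (m : {ffun 'I_N.+1 -> int}) : {ffun 'I_N -> int} :=
  [ffun j => m (lift ord0 j)].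

Definition peel N (z : R[i]) (t : R[i] * {ffun 'I_N.+1 -> int}) :
  R[i] * {ffun 'I_N -> int} := (t.1 * z ^ t.2 ord0, tailm t.2).

Lemma mono_cons N (m : {ffun 'I_N.+1 -> int}) z xi :
  mono m (consv z xi) = z ^ m ord0 * mono (tailm m) xi.
Proof.
rewrite /mono big_ord_recl /consv unlift_none; congr (_ * _).
by apply: eq_bigr => i _; rewrite liftK ffunE.
Qed.

Lemma ev_cons N (P : seq (R[i] * {ffun 'I_N.+1 -> int})) z xi :
  ev P (consv z xi) =
  ev (map (peel z) P) xi.
Proof.
rewrite /ev big_map; apply: eq_bigr => t _ /=.
by rewrite mono_cons mulrA.
Qed.

Lemma onT_cons N r z (xi : 'I_N -> R[i]) :
  nm z = r -> onT r xi -> onT r (consv z xi).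
Proof. by move=> hz hxi i; rewrite /consv; case: unliftP => [j|] _. Qed.

Lemma expoP N (m m' : {ffun 'I_N.+1 -> int}) :
  (m == m') = (m ord0 == m' ord0) && (tailm m == tailm m').
Proof.
apply/eqP/andP => [->//|[/eqP h0 /eqP ht]].
apply/ffunP => i; case: (unliftP ord0 i) => [j|] ->//.
by move/ffunP: ht => /(_ j); rewrite !ffunE.
Qed.

Definition mone N : {ffun 'I_N -> int} := [ffun=> -1].

Lemma nm_tpi : nm tpi = 2 * pi.
Proof.
rewrite /tpi !nmM nmi mulr1 nm_real (gtr0_norm (pi_gt0 R)); congr (_ * _).
by rewrite normr_nat -(rmorph_nat (real_complex R)).
Qed.

Lemma tpi_neq0 : tpi != 0.
Proof. by rewrite -nm_eq0 nm_tpi gt_eqF // mulr_gt0 // pi_gt0. Qed.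

(** By induction on the number of variables. Freezing the outermost variable in
    an approximant of g leaves an approximant in the others, whose coefficient is
    again a Laurent polynomial in the frozen variable. *)
Lemma mci_close N (r : R) (r0 : 0 < r) (g : ('I_N -> R[i]) -> R[i]) P (e : R) :
  appr r (@anyexp N) g ->
  (forall xi, onT r xi -> nm (g xi - ev P xi) <= e) ->
  nm (multi_circle_integral r g - tpi ^+ N * coefP (mone N) P) <= (4 * pi * r) ^+ N * e.
Proof.
elim: N g P e => [|N IH] g P e ga gP.
  rewrite /= expr0 mul1r expr0 mul1r.
  have -> : coefP (mone 0) P = ev P (fun=> 0).
    rewrite /coefP /ev; apply: eq_big => [t|t _]; last by rewrite /mono big_ord0 mulr1.
    by apply/eqP/ffunP => -[].
  by apply: gP => -[].
pose Q (P : seq (R[i] * {ffun 'I_N.+1 -> int})) : seq (R[i] * int) :=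
  [seq (tpi ^+ N * t.1, (t.2 : {ffun 'I_N.+1 -> int}) ord0) | t <- P & tailm t.2 == mone N].
have QE P' z : tpi ^+ N * coefP (mone N) (map (peel z) P') =
    ev1 (Q P') z.
  rewrite /coefP /ev1 /Q big_map big_map /= big_filter big_distrr /=.
  by apply: eq_bigr => t _; rewrite mulrA.
have Qres : residue1 (Q P) = tpi ^+ N * coefP (mone N.+1) P.
  rewrite /residue1 /coefP /Q big_map /= big_filter_cond big_distrr /=.
  apply: eq_bigl => t; rewrite expoP andbC !ffunE; congr (_ && (_ == _)).
  by apply/ffunP => i; rewrite !ffunE.
have step P' e' : (forall xi, onT r xi -> nm (g xi - ev P' xi) <= e') ->
    forall z, nm z = r ->
    nm (multi_circle_integral r (fun xi => g (consv z xi)) - ev1 (Q P') z)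
      <= (4 * pi * r) ^+ N * e'.
  move=> H z hz; rewrite -QE; apply: IH.
    move=> e'' e''0; have [P'' [_ hP'']] := ga _ e''0.
    exists (map (peel z) P''); split=> // xi hxi.
    by rewrite -ev_cons; apply: hP''; exact: onT_cons.
  by move=> xi hxi; rewrite -ev_cons; apply: H; exact: onT_cons.
have -> : multi_circle_integral r g =
  circle_integral r (fun z => multi_circle_integral r (fun xi => g (consv z xi))) by [].
rewrite exprS -mulrA -Qres exprS -mulrA.
have k0 : 0 < (4 * pi * r) ^+ N :> R by rewrite exprn_gt0 // !mulr_gt0 // pi_gt0.
apply: circle_close => //.
  move=> e' e'0; have [P' [_ hP']] := ga (e' / (4 * pi * r) ^+ N) (divr_gt0 e'0 k0).
  exists (Q P') => z hz; apply: le_trans (step _ _ hP' z hz) _.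
  by rewrite mulrC divfK // gt_eqF.
exact: step.
Qed.

Variables (r : R) (r0 : 0 < r).

Definition negm N (Z : {ffun 'I_N -> int}) : {ffun 'I_N -> int} := [ffun i => - Z i - 1].

(** The factor xi^(- Z - 1) moves the Laurent coefficient of exponent Z to the
    residue. *)
Definition coef N (Z : {ffun 'I_N -> int}) (g : ('I_N -> R[i]) -> R[i]) : R[i] :=
  (tpi ^+ N)^-1 * multi_circle_integral r (fun xi => g xi * mono (negm Z) xi).

Lemma onT_neq0 N (xi : 'I_N -> R[i]) i : onT r xi -> xi i != 0.
Proof. by move=> h; rewrite -nm_eq0 h gt_eqF. Qed.

Lemma monoD N (a b : {ffun 'I_N -> int}) (xi : 'I_N -> R[i]) : onT r xi ->
  mono (a + b) xi = mono a xi * mono b xi.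
Proof.
move=> h; rewrite /mono -big_split /=; apply: eq_bigr => i _.
by rewrite ffunE exprzDr // unitfE (onT_neq0 _ h).
Qed.

Lemma mono0 N (xi : 'I_N -> R[i]) : mono 0 xi = 1.
Proof. by rewrite /mono big1 // => i _; rewrite ffunE expr0z. Qed.

Definition msize N (a : {ffun 'I_N -> int}) : R := r ^ (\sum_i a i).

Lemma nm_mono N (a : {ffun 'I_N -> int}) (xi : 'I_N -> R[i]) : onT r xi ->
  nm (mono a xi) = msize a.
Proof.
move=> h; rewrite /mono nm_prod /msize.
under eq_bigr do rewrite nmXz h.
elim: (index_enum _) => [|i s IH]; first by rewrite !big_nil expr0z.
by rewrite !big_cons IH exprzDr // unitfE gt_eqF.
Qed.

Lemma msize_gt0 N (a : {ffun 'I_N -> int}) : 0 < msize a.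
Proof. exact: exprz_gt0. Qed.

Definition shiftP N (a : {ffun 'I_N -> int}) (P : seq (R[i] * {ffun 'I_N -> int})) :=
  [seq (t.1, t.2 + a) | t <- P].

Lemma ev_shift N (a : {ffun 'I_N -> int}) P (xi : 'I_N -> R[i]) : onT r xi ->
  ev (shiftP a P) xi = ev P xi * mono a xi.
Proof.
move=> h; rewrite /ev /shiftP big_map big_distrl /=.
by apply: eq_bigr => t _; rewrite monoD // mulrA.
Qed.

Lemma coefP_shift N (a Z : {ffun 'I_N -> int}) P :
  coefP Z (shiftP a P) = coefP (Z - a) P.
Proof.
rewrite /coefP /shiftP big_map /=; apply: eq_bigl => t.
by rewrite eq_sym -subr_eq eq_sym.
Qed.

Definition kcoef N (Z : {ffun 'I_N -> int}) : R :=
  (2 * pi) ^- N * ((4 * pi * r) ^+ N * msize (negm Z)).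

Lemma kcoef_ge0 N (Z : {ffun 'I_N -> int}) : 0 <= kcoef Z.
Proof.
have p0 := pi_gt0 R.
by rewrite /kcoef !mulr_ge0 ?invr_ge0 ?exprn_ge0 ?mulr_ge0 // ltW // msize_gt0.
Qed.

Lemma appr_any N (Q : {ffun 'I_N -> int} -> Prop) g : appr r Q g -> appr r (@anyexp N) g.
Proof. by move=> h e /h [P [_ hP]]; exists P. Qed.

Lemma coef_close N (Z : {ffun 'I_N -> int}) Q g P (e : R) : appr r Q g ->
  (forall xi, onT r xi -> nm (g xi - ev P xi) <= e) ->
  nm (coef Z g - coefP Z P) <= kcoef Z * e.
Proof.
move=> /appr_any ga gP; rewrite /coef.
have -> : coefP Z P = (tpi ^+ N)^-1 * (tpi ^+ N * coefP (mone N) (shiftP (negm Z) P)).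
  rewrite mulKf ?expf_neq0 ?tpi_neq0 // coefP_shift; congr coefP.
  by apply/ffunP => i; rewrite !ffunE /=; ring.
rewrite -mulrBr nmM nmV nmX nm_tpi /kcoef -(mulrA ((2 * pi) ^- N)) -(mulrA ((4 * pi * r) ^+ N)).
apply: ler_wpM2l.
  by rewrite invr_ge0 exprn_ge0 // mulr_ge0 // ltW // pi_gt0.
have k0 := msize_gt0 (negm Z).
apply: mci_close => //.
  move=> e' e'0; have [P' [_ hP']] := ga _ (divr_gt0 e'0 k0).
  exists (shiftP (negm Z) P'); split => // xi hxi.
  rewrite ev_shift // -mulrBl nmM nm_mono // -ler_pdivlMr //; exact: hP'.
move=> xi hxi; rewrite ev_shift // -mulrBl nmM nm_mono // mulrC.
by apply: ler_wpM2l; [exact: ltW|exact: gP].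
Qed.

(** Approximants with exponents in Q have a zero coefficient at Z. *)
Lemma coef_eq0 N (Z : {ffun 'I_N -> int}) Q g : appr r Q g -> ~ Q Z -> coef Z g = 0.
Proof.
move=> ga nQ; apply: (@nm_eps _ _ (kcoef Z)) => e e0.
have [P [hQ hP]] := ga _ e0.
have := coef_close Z ga hP; rewrite /coefP big_seq_cond big1 ?subr0 //.
by move=> t /andP[/hQ + /eqP E]; rewrite E.
Qed.

Lemma coef_bnd N (Z : {ffun 'I_N -> int}) Q g (e : R) : appr r Q g ->
  (forall xi, onT r xi -> nm (g xi) <= e) -> nm (coef Z g) <= kcoef Z * e.
Proof.
move=> ga h; have := @coef_close N Z Q g [::] e ga.
rewrite /coefP big_nil subr0; apply => xi /h.
by rewrite /ev big_nil subr0.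
Qed.

(** Characterises the coefficient through the approximants, which is how its
    algebraic properties are transferred from Laurent polynomials. *)
Lemma coef_uniq N (Z : {ffun 'I_N -> int}) Q g (c : R[i]) (K : R) : appr r Q g ->
  (forall e P, 0 < e -> (forall t, t \in P -> Q t.2) ->
     (forall xi, onT r xi -> nm (g xi - ev P xi) <= e) ->
     nm (c - coefP Z P) <= K * e) -> c = coef Z g.
Proof.
move=> ga H; apply/eqP; rewrite -subr_eq0; apply/eqP.
apply: (@nm_eps _ _ (K + kcoef Z)) => e e0.
have [P [hQ hP]] := ga _ e0.
have -> : c - coef Z g = (c - coefP Z P) - (coef Z g - coefP Z P) by ring.
apply: le_trans (nmB _ _) _; rewrite mulrDl lerD //; first exact: H.
exact: coef_close ga hP.
Qed.

Lemma appr_ext N Q (g h : ('I_N -> R[i]) -> R[i]) :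
  (forall xi, onT r xi -> g xi = h xi) -> appr r Q g -> appr r Q h.
Proof.
move=> E ga e e0; have [P [hQ hP]] := ga _ e0; exists P; split => // xi hxi.
by rewrite -E //; exact: hP.
Qed.

Lemma coef_ext N (Z : {ffun 'I_N -> int}) Q (g h : ('I_N -> R[i]) -> R[i]) :
  appr r Q g -> (forall xi, onT r xi -> g xi = h xi) -> coef Z g = coef Z h.
Proof.
move=> ga E; have ha := appr_ext E ga.
apply: (@coef_uniq _ _ Q _ _ (kcoef Z)) => // e P e0 _ hP.
by apply: coef_close ga _ => xi hxi; rewrite E //; exact: hP.
Qed.

Lemma appr_weak N (Q Q' : {ffun 'I_N -> int} -> Prop) g :
  (forall m, Q m -> Q' m) -> appr r Q g -> appr r Q' g.
Proof.
move=> h ga e e0; have [P [hQ hP]] := ga _ e0; exists P; split => // t /hQ; exact: h.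
Qed.

Lemma appr_ev N (Q : {ffun 'I_N -> int} -> Prop) P :
  (forall t, t \in P -> Q t.2) -> appr r Q (ev P).
Proof.
by move=> hQ e e0; exists P; split => // xi _; rewrite subrr nm0 ltW.
Qed.

Lemma appr_mono N (Q : {ffun 'I_N -> int} -> Prop) m : Q m -> appr r Q (mono m).
Proof.
move=> hQ; apply: (@appr_ext _ _ (ev [:: (1, m)])).
  by move=> xi _; rewrite /ev big_seq1 mul1r.
by apply: appr_ev => t; rewrite inE => /eqP ->.
Qed.

Lemma ev_cat N P P' (xi : 'I_N -> R[i]) : ev (P ++ P') xi = ev P xi + ev P' xi.
Proof. by rewrite /ev big_cat. Qed.

Lemma apprD N (Q : {ffun 'I_N -> int} -> Prop) g h : appr r Q g -> appr r Q h ->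
  appr r Q (fun xi => g xi + h xi).
Proof.
move=> ga ha e e0; have e2 : 0 < e / 2 by rewrite divr_gt0.
have [P [hQ hP]] := ga _ e2; have [P' [hQ' hP']] := ha _ e2.
exists (P ++ P'); split.
  by move=> t; rewrite mem_cat => /orP[/hQ|/hQ'].
move=> xi hxi; rewrite ev_cat.
have -> : g xi + h xi - (ev P xi + ev P' xi) = (g xi - ev P xi) + (h xi - ev P' xi) by ring.
apply: le_trans (nmD _ _) _.
by rewrite [e]splitr lerD ?hP ?hP'.
Qed.

Lemma coefPcat N (Z : {ffun 'I_N -> int}) P P' : coefP Z (P ++ P') = coefP Z P + coefP Z P'.
Proof. by rewrite /coefP big_cat. Qed.

Lemma nm_bound N (P : seq (R[i] * {ffun 'I_N -> int})) :
  exists2 M : R, 0 < M & forall xi, onT r xi -> nm (ev P xi) <= M.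
Proof.
exists (1 + \sum_(t <- P) nm t.1 * msize t.2).
  rewrite ltr_pwDl // sumr_ge0 // => t _.
  by rewrite mulr_ge0 ?nm_ge0 // ltW // msize_gt0.
move=> xi hxi; apply: le_trans (nm_sum _ _ _) _.
rewrite -[X in X <= _]add0r lerD //.
by apply: ler_sum => t _; rewrite nmM nm_mono.
Qed.

Lemma appr_bnd N Q (g : ('I_N -> R[i]) -> R[i]) : appr r Q g ->
  exists2 M : R, 0 < M & forall xi, onT r xi -> nm (g xi) <= M.
Proof.
move=> ga; have [P [_ hP]] := ga 1 ltr01; have [M M0 hM] := nm_bound P.
exists (1 + M); first by rewrite addr_gt0.
move=> xi hxi; have -> : g xi = (g xi - ev P xi) + ev P xi by ring.
by apply: le_trans (nmD _ _) _; rewrite lerD ?hP ?hM.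
Qed.

Definition mulP N (P P' : seq (R[i] * {ffun 'I_N -> int})) :=
  [seq (t.1 * t'.1, t.2 + t'.2) | t <- P, t' <- P'].

Lemma ev_mul N P P' (xi : 'I_N -> R[i]) : onT r xi ->
  ev (mulP P P') xi = ev P xi * ev P' xi.
Proof.
move=> h; rewrite /ev /mulP big_allpairs_dep /= big_distrl /=.
apply: eq_bigr => t _; rewrite big_distrr /=; apply: eq_bigr => t' _.
by rewrite monoD //; ring.
Qed.

(** Each factor is approximated up to a precision that depends on a bound for the
    other one. *)
Lemma apprM N (Q1 Q2 Q : {ffun 'I_N -> int} -> Prop) g h :
  (forall a b, Q1 a -> Q2 b -> Q (a + b)) ->
  appr r Q1 g -> appr r Q2 h -> appr r Q (fun xi => g xi * h xi).
Proof.
move=> HQ ga ha e e0.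
have [M M0 hM] := appr_bnd ga.
have eM : 0 < e / 2 / M by rewrite !divr_gt0.
have [P' [hQ' hP']] := ha _ eM; have [M' M'0 hM'] := nm_bound P'.
have eM' : 0 < e / 2 / M' by rewrite !divr_gt0.
have [P [hQ hP]] := ga _ eM'.
exists (mulP P P'); split.
  by move=> _ /allpairsP[[t t'] /= [/hQ h1 /hQ' h2 ->]] /=; exact: HQ.
move=> xi hxi; rewrite ev_mul //.
have -> : g xi * h xi - ev P xi * ev P' xi =
  g xi * (h xi - ev P' xi) + (g xi - ev P xi) * ev P' xi by ring.
apply: le_trans (nmD _ _) _; rewrite [e]splitr !nmM; apply: lerD.
- have -> : e / 2 = M * (e / 2 / M) by field; rewrite gt_eqF.
  by apply: ler_pM; rewrite ?nm_ge0 ?hM ?hP'.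
- have -> : e / 2 = (e / 2 / M') * M' by field; rewrite gt_eqF.
  by apply: ler_pM; rewrite ?nm_ge0 ?hM' ?hP.
Qed.

Lemma appr_cst N (Q : {ffun 'I_N -> int} -> Prop) c : Q 0 -> appr r Q (fun=> c).
Proof.
move=> h; apply: (@appr_ext _ _ (ev [:: (c, 0)])).
  by move=> xi _; rewrite /ev big_seq1 mono0 mulr1.
by apply: appr_ev => t; rewrite inE => /eqP ->.
Qed.

Lemma apprZ N (Q : {ffun 'I_N -> int} -> Prop) c g : appr r Q g ->
  appr r Q (fun xi => c * g xi).
Proof.
move=> ga; apply: (@apprM _ (fun m => m = 0) Q) => //.
  by move=> a b -> ?; rewrite add0r.
exact: appr_cst.
Qed.

Lemma appr_sum N (Q : {ffun 'I_N -> int} -> Prop) (I : Type) (s : seq I) (p : pred I)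
    (g : I -> ('I_N -> R[i]) -> R[i]) :
  (forall i, p i -> appr r Q (g i)) ->
  appr r Q (fun xi => \sum_(i <- s | p i) g i xi).
Proof.
move=> h; elim: s => [|i s IH].
  apply: (@appr_ext _ _ (ev [::])); last by apply: appr_ev.
  by move=> xi _; rewrite /ev !big_nil.
case pi : (p i); last first.
  by apply: appr_ext IH => xi _; rewrite big_cons pi.
apply: (@appr_ext _ _ (fun xi => g i xi + \sum_(i <- s | p i) g i xi)).
  by move=> xi _; rewrite big_cons pi.
by apply: apprD; first exact: h.
Qed.

Definition addclosed N (Q : {ffun 'I_N -> int} -> Prop) :=
  Q 0 /\ forall a b, Q a -> Q b -> Q (a + b).

Lemma appr_prod N (Q : {ffun 'I_N -> int} -> Prop) (I : Type) (s : seq I) (p : pred I)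
    (g : I -> ('I_N -> R[i]) -> R[i]) : addclosed Q ->
  (forall i, p i -> appr r Q (g i)) ->
  appr r Q (fun xi => \prod_(i <- s | p i) g i xi).
Proof.
move=> [Q0 QD] h; elim: s => [|i s IH].
  by apply: (@appr_ext _ _ (fun=> 1)); [move=> xi _; rewrite big_nil|exact: appr_cst].
case pi : (p i); last first.
  by apply: appr_ext IH => xi _; rewrite big_cons pi.
apply: (@appr_ext _ _ (fun xi => g i xi * \prod_(i <- s | p i) g i xi)).
  by move=> xi _; rewrite big_cons pi.
by apply: (apprM QD) => //; exact: h.
Qed.

Lemma apprX N (Q : {ffun 'I_N -> int} -> Prop) g n : addclosed Q -> appr r Q g ->
  appr r Q (fun xi => g xi ^+ n).
Proof.
move=> [Q0 QD] ga; elim: n => [|n IH].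
  by apply: (@appr_ext _ _ (fun=> 1)); [move=> xi _; rewrite expr0|exact: appr_cst].
apply: (@appr_ext _ _ (fun xi => g xi * g xi ^+ n)).
  by move=> xi _; rewrite exprS.
exact: (apprM QD).
Qed.

Lemma appr_lim N (Q : {ffun 'I_N -> int} -> Prop) g :
  (forall e, 0 < e -> exists2 h, appr r Q h &
     forall xi, onT r xi -> nm (g xi - h xi) <= e) -> appr r Q g.
Proof.
move=> H e e0; have e2 : 0 < e / 2 by rewrite divr_gt0.
have [h ha hh] := H _ e2; have [P [hQ hP]] := ha _ e2.
exists P; split => // xi hxi.
have -> : g xi - ev P xi = (g xi - h xi) + (h xi - ev P xi) by ring.
by apply: le_trans (nmD _ _) _; rewrite [e]splitr lerD ?hh ?hP.
Qed.

(** The partial sums of the geometric series converge uniformly. *)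
Lemma appr_geom N (Q : {ffun 'I_N -> int} -> Prop) u (rho : R) : addclosed Q ->
  appr r Q u -> 0 <= rho < 1 -> (forall xi, onT r xi -> nm (u xi) <= rho) ->
  appr r Q (fun xi => (1 - u xi)^-1).
Proof.
move=> Qa ua /andP[rho0 rho1] hu; apply: appr_lim => e e0.
have d0 : 0 < (1 - rho) * e by rewrite mulr_gt0 // subr_gt0.
have : \forall n \near \oo, `|rho ^+ n| < (1 - rho) * e.
  have /cvgrPdist_lt/(_ _ d0) : (fun n => rho ^+ n) @ \oo --> (0 : R).
    by apply: cvg_expr; rewrite ger0_norm.
  by apply: filterS => n; rewrite sub0r normrN.
move=> [n _ /(_ n (leqnn n))]; rewrite ger0_norm ?exprn_ge0 // => hn.
exists (fun xi => \sum_(k < n) u xi ^+ k).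
  apply: appr_sum => k _; exact: apprX.
move=> xi hxi; have hux := hu _ hxi.
have lb : 1 - rho <= nm (1 - u xi).
  have : nm (1 : R[i]) <= nm (1 - u xi) + nm (u xi).
    by rewrite [X in nm X <= _](_ : 1 = (1 - u xi) + u xi); [exact: nmD|ring].
  by rewrite nm1 => h; lra.
have ne : 1 - u xi != 0.
  by rewrite -nm_eq0 gt_eqF // (lt_le_trans _ lb) // subr_gt0.
have -> : (1 - u xi)^-1 - \sum_(k < n) u xi ^+ k = u xi ^+ n / (1 - u xi).
  have := subrX1 (u xi) n => E.
  have {}E : (1 - u xi) * (\sum_(k < n) u xi ^+ k) = 1 - u xi ^+ n.
    by rewrite -[X in _ = X]opprB E; ring.
  apply: (mulfI ne); rewrite mulrBr mulfV // E.
  by field.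
rewrite nmM nmX nmV ler_pdivrMr; last by rewrite (lt_le_trans _ lb) // subr_gt0.
apply: le_trans (_ : rho ^+ n <= _).
  by rewrite lerXn2r ?nnegrE ?nm_ge0.
apply: le_trans (ltW hn) _; rewrite mulrC.
by apply: ler_wpM2l; first exact: ltW.
Qed.

Lemma coefD N (Z : {ffun 'I_N -> int}) Q g h : appr r Q g -> appr r Q h ->
  coef Z (fun xi => g xi + h xi) = coef Z g + coef Z h.
Proof.
move=> ga ha; apply/eqP; rewrite -subr_eq0; apply/eqP.
apply: (@nm_eps _ _ (4 * kcoef Z)) => e e0.
have [P [_ hP]] := ga _ e0; have [P' [_ hP']] := ha _ e0.
have c1 := coef_close Z ga hP; have c2 := coef_close Z ha hP'.
have c3 : nm (coef Z (fun xi => g xi + h xi) - coefP Z (P ++ P')) <= kcoef Z * (e + e).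
  apply: coef_close (apprD ga ha) _ => xi hxi; rewrite ev_cat.
  have -> : g xi + h xi - (ev P xi + ev P' xi) = (g xi - ev P xi) + (h xi - ev P' xi) by ring.
  by apply: le_trans (nmD _ _) _; rewrite lerD ?hP ?hP'.
rewrite coefPcat in c3.
have -> : coef Z (fun xi => g xi + h xi) - (coef Z g + coef Z h) =
  (coef Z (fun xi => g xi + h xi) - (coefP Z P + coefP Z P')) -
  ((coef Z g - coefP Z P) + (coef Z h - coefP Z P')) by ring.
apply: le_trans (nmB _ _) _; have := nmD (coef Z g - coefP Z P) (coef Z h - coefP Z P').
set k := kcoef Z in c1 c2 c3 *; nra.
Qed.

Lemma coefZ N (Z : {ffun 'I_N -> int}) Q c g : appr r Q g ->
  coef Z (fun xi => c * g xi) = c * coef Z g.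
Proof.
move=> ga; apply/eqP; rewrite -subr_eq0; apply/eqP.
apply: (@nm_eps _ _ (2 * (nm c * kcoef Z))) => e e0.
have [P [_ hP]] := ga _ e0.
have c1 := coef_close Z ga hP.
pose P' : seq (R[i] * {ffun 'I_N -> int}) := [seq (c * t.1, t.2) | t <- P].
have eP xi : ev P' xi = c * ev P xi.
  rewrite /ev big_map big_distrr /=; apply: eq_bigr => t _; by rewrite mulrA.
have cP : coefP Z P' = c * coefP Z P.
  by rewrite /coefP big_map big_distrr /=.
have c3 : nm (coef Z (fun xi => c * g xi) - coefP Z P') <= kcoef Z * (nm c * e).
  apply: coef_close (apprZ c ga) _ => xi hxi; rewrite eP -mulrBr nmM.
  by apply: ler_wpM2l; [exact: nm_ge0|exact: hP].
rewrite cP in c3.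
have -> : coef Z (fun xi => c * g xi) - c * coef Z g =
  (coef Z (fun xi => c * g xi) - c * coefP Z P) - c * (coef Z g - coefP Z P) by ring.
apply: le_trans (nmB _ _) _; rewrite nmM.
have -> : 2 * (nm c * kcoef Z) * e = kcoef Z * (nm c * e) + nm c * (kcoef Z * e) by ring.
by apply: lerD => //; apply: ler_wpM2l; first exact: nm_ge0.
Qed.

Lemma coef0 N (Z : {ffun 'I_N -> int}) : coef Z (fun=> 0) = 0.
Proof.
have -> : (fun=> 0) = (fun xi : 'I_N -> R[i] => 0 * mono 0 xi).
  by apply/funext => xi; rewrite mul0r.
by rewrite (@coefZ _ _ (@anyexp N)) ?mul0r //; exact: appr_mono.
Qed.

Lemma coef_sum N (Z : {ffun 'I_N -> int}) (Q : {ffun 'I_N -> int} -> Prop)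
    (I : Type) (s : seq I) (p : pred I) (g : I -> ('I_N -> R[i]) -> R[i]) :
  (forall i, p i -> appr r Q (g i)) ->
  coef Z (fun xi => \sum_(i <- s | p i) g i xi) = \sum_(i <- s | p i) coef Z (g i).
Proof.
move=> h; elim: s => [|i s IH].
  by rewrite big_nil -[RHS](coef0 Z); congr coef; apply/funext => xi; rewrite big_nil.
rewrite big_cons; case pi : (p i).
  rewrite -IH -(@coefD _ _ Q); [|exact: h|exact: appr_sum].
  by congr coef; apply/funext => xi; rewrite big_cons pi.
by rewrite -IH; congr coef; apply/funext => xi; rewrite big_cons pi.
Qed.

Lemma coef_shift N (Z a : {ffun 'I_N -> int}) Q g : appr r Q g ->
  coef Z (fun xi => g xi * mono a xi) = coef (Z - a) g.
Proof.
move=> ga; have ga' := appr_any ga.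
have ha : appr r (@anyexp N) (fun xi => g xi * mono a xi).
  apply: (@apprM _ _ _ _ _ _ _ ga' (@appr_mono _ (@anyexp N) a _)) => //.
apply/esym; apply: (@coef_uniq _ _ (@anyexp N) _ _ (kcoef (Z - a) / msize a)) => //.
move=> e P e0 _ hP.
pose P' : seq (R[i] * {ffun 'I_N -> int}) := shiftP (- a) P.
have -> : coefP Z P = coefP (Z - a) P' by rewrite coefP_shift opprK subrK.
rewrite -mulrA; apply: coef_close ga' _ => xi hxi; rewrite ev_shift //.
have Ea : mono a xi * mono (- a) xi = 1 by rewrite -monoD // subrr mono0.
have m0 : nm (mono a xi) * nm (mono (- a) xi) = 1 by rewrite -nmM Ea nm1.
have -> : g xi - ev P xi * mono (- a) xi = (g xi * mono a xi - ev P xi) * mono (- a) xi.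
  by rewrite mulrBl -mulrA Ea mulr1.
rewrite nmM mulrC; rewrite nm_mono // in m0.
have -> : nm (mono (- a) xi) = (msize a)^-1.
  by apply: (mulfI (lt0r_neq0 (msize_gt0 a))); rewrite m0 mulfV // gt_eqF // msize_gt0.
by apply: ler_wpM2l; [rewrite invr_ge0 ltW // msize_gt0|exact: hP].
Qed.

Lemma coef_ev N (Z : {ffun 'I_N -> int}) P : coef Z (ev P) = coefP Z P.
Proof.
apply/eqP; rewrite -subr_eq0; apply/eqP.
apply: (@nm_eps _ _ (kcoef Z)) => e e0.
apply: (@coef_close _ _ (@anyexp N)); first exact: appr_ev.
by move=> xi _; rewrite subrr nm0 ltW.
Qed.

Lemma coef_mono N (Z m : {ffun 'I_N -> int}) : coef Z (mono m) = (m == Z)%:R.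
Proof.
have -> : mono m = ev [:: (1, m)] :> (('I_N -> R[i]) -> R[i]).
  by apply/funext => xi; rewrite /ev big_seq1 mul1r.
by rewrite coef_ev /coefP big_mkcond big_seq1 /=; case: eqP.
Qed.

Definition rexp N (s : 'S_N) (m : {ffun 'I_N -> int}) : {ffun 'I_N -> int} :=
  [ffun j => m (s j)].

Lemma mono_perm N (s : 'S_N) m (xi : 'I_N -> R[i]) :
  mono m (fun i => xi (s i)) = mono (rexp s^-1 m) xi.
Proof.
rewrite /mono (reindex_inj (@perm_inj _ s^-1)); apply: eq_bigr => i _.
by rewrite permKV ffunE.
Qed.

Lemma onT_perm N (s : 'S_N) (xi : 'I_N -> R[i]) : onT r xi -> onT r (fun i => xi (s i)).
Proof. by move=> h i; exact: h. Qed.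

Definition perm_poly N (s : 'S_N) (P : seq (R[i] * {ffun 'I_N -> int})) :=
  [seq (t.1, rexp s^-1 t.2) | t <- P].

Lemma ev_perm N (s : 'S_N) P (xi : 'I_N -> R[i]) :
  ev P (fun i => xi (s i)) = ev (perm_poly s P) xi.
Proof.
by rewrite /ev /perm_poly big_map; apply: eq_bigr => t _; rewrite mono_perm.
Qed.

Lemma rexpK N (s : 'S_N) : cancel (rexp s) (rexp s^-1).
Proof. by move=> m; apply/ffunP => i; rewrite !ffunE permKV. Qed.

Lemma rexpKV N (s : 'S_N) : cancel (rexp s^-1) (rexp s).
Proof. by move=> m; apply/ffunP => i; rewrite !ffunE permK. Qed.

Lemma appr_perm N (s : 'S_N) (Q Q' : {ffun 'I_N -> int} -> Prop) g :
  (forall m, Q m -> Q' (rexp s^-1 m)) -> appr r Q g ->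
  appr r Q' (fun xi => g (fun i => xi (s i))).
Proof.
move=> hQQ ga e e0; have [P [hQ hP]] := ga _ e0; exists (perm_poly s P); split.
  by move=> _ /mapP[t /hQ h ->]; exact: hQQ.
by move=> xi hxi; rewrite -ev_perm; apply: hP; exact: onT_perm.
Qed.

(** The integrals are iterated in a fixed order, but the coefficients of an
    approximant are renamed along with its variables. *)
Lemma coef_perm N (s : 'S_N) (Z : {ffun 'I_N -> int}) Q g : appr r Q g ->
  coef Z (fun xi => g (fun i => xi (s i))) = coef (rexp s Z) g.
Proof.
move=> /appr_any ga; apply/eqP; rewrite -subr_eq0; apply/eqP.
apply: (@nm_eps _ _ (kcoef Z + kcoef (rexp s Z))) => e e0.
have [P [_ hP]] := ga _ e0.
have c1 := coef_close (rexp s Z) ga hP.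
have c2 : nm (coef Z (fun xi => g (fun i => xi (s i))) - coefP Z (perm_poly s P)) <= kcoef Z * e.
  apply: (@coef_close _ _ (@anyexp N)); first exact: (appr_perm _ ga).
  by move=> xi hxi; rewrite -ev_perm; apply: hP; exact: onT_perm.
have E : coefP Z (perm_poly s P) = coefP (rexp s Z) P.
  rewrite /coefP big_map /=; apply: eq_bigl => t.
  by apply/eqP/eqP => [<-|->]; rewrite ?rexpKV ?rexpK.
rewrite E in c2.
set u := coef Z _ in c2 *.
have -> : u - coef (rexp s Z) g = (u - coefP (rexp s Z) P) -
  (coef (rexp s Z) g - coefP (rexp s Z) P) by ring.
by apply: le_trans (nmB _ _) _; rewrite mulrDl lerD.
Qed.

End Torus.

Section Bethe.
Context {R : realType}.
Variables (p q r : R).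
Hypotheses (p0 : 0 < p) (q0 : 0 < q) (adm : admissible_radius p q r).

Lemma adm_r0 : 0 < r. Proof. exact: adm.1. Qed.

(** Otherwise a = p / (1 + q r) and b = - r would both lie in the disc, and
    p + q a b - a vanishes there. *)
Lemma adm_bound : r * (1 + q * r) < p.
Proof.
have r0 := adm_r0; rewrite ltNge; apply/negP => h.
have d0 : 0 < 1 + q * r by rewrite addr_gt0 // mulr_gt0.
have h1 : `|(p / (1 + q * r))%:C| <= r%:C.
  by rewrite nmE nm_real lecR gtr0_norm ?divr_gt0 // ler_pdivrMr.
have h2 : `|(- r)%:C| <= r%:C by rewrite nmE nm_real lecR normrN gtr0_norm.
have := adm.2 _ _ h1 h2.
rewrite /bethe -!rmorphM -rmorphD -rmorphB /=.
have -> : p + q * (p / (1 + q * r)) * - r - p / (1 + q * r) = 0.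
  by field; rewrite gt_eqF.
by rewrite eqxx.
Qed.

Lemma bethe_neq0 N (xi : 'I_N -> R[i]) i j : onT r xi -> bethe p q (xi i) (xi j) != 0.
Proof. by move=> h; apply: adm.2; rewrite nmE h. Qed.

Definition unitm N (i : 'I_N) : {ffun 'I_N -> int} := [ffun k => (k == i)%:R].

Lemma mono_unitm N (i : 'I_N) (xi : 'I_N -> R[i]) : mono (unitm i) xi = xi i.
Proof.
rewrite /mono (bigD1 i) //= ffunE eqxx expr1z big1 ?mulr1 // => j ji.
by rewrite ffunE (negPf ji) expr0z.
Qed.

Lemma appr_var N (Q : {ffun 'I_N -> int} -> Prop) i : Q (unitm i) ->
  appr r Q (fun xi => xi i).
Proof.
move=> h; apply: (appr_ext (g := mono (unitm i))).
  by move=> xi _; rewrite mono_unitm.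
exact: appr_mono.
Qed.

Lemma appr_bethe N (Q : {ffun 'I_N -> int} -> Prop) i j : addclosed Q ->
  Q (unitm i) -> Q (unitm i + unitm j) ->
  appr r Q (fun xi => bethe p q (xi i) (xi j)).
Proof.
have r0 := adm_r0.
move=> [Q0 QD] Qi Qij; rewrite /bethe.
apply: apprD.
  apply: apprD; first exact: appr_cst.
  apply: (@appr_ext _ _ _ _ (fun xi => q%:C * mono (unitm i + unitm j) xi)).
    by move=> xi hxi; rewrite (monoD r0) // !mono_unitm mulrA.
  by apply: (apprZ r0); exact: appr_mono.
apply: (@appr_ext _ _ _ _ (fun xi => -1 * xi i)).
  by move=> xi _; rewrite mulN1r.
by apply: (apprZ r0); exact: appr_var.
Qed.

(** The inverse of p - a (1 - q b) is a geometric series in a (1 - q b) / p: it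
    has no negative exponents, and b never occurs without a. *)
Lemma appr_betheV N (Q : {ffun 'I_N -> int} -> Prop) i j : addclosed Q ->
  Q (unitm i) -> Q (unitm i + unitm j) ->
  appr r Q (fun xi => (bethe p q (xi i) (xi j))^-1).
Proof.
have r0 := adm_r0; have hb := adm_bound.
move=> Qa Qi Qij; have [Q0 QD] := Qa.
have pC : p%:C != 0 :> R[i] by rewrite fmorph_eq0 gt_eqF.
pose u := fun xi : 'I_N -> R[i] => (p%:C)^-1 * (xi i + - q%:C * mono (unitm i + unitm j) xi).
apply: (@appr_ext _ _ _ _ (fun xi => (p%:C)^-1 * (1 - u xi)^-1)).
  move=> xi hxi; rewrite /u (monoD r0) // !mono_unitm -invfM; congr (_^-1).
  by rewrite /bethe; field.
apply: (apprZ r0); apply: (@appr_geom _ _ r0 _ _ _ (r * (1 + q * r) / p)) => //.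
- apply: (apprZ r0); apply: apprD; first exact: appr_var.
  by apply: (apprZ r0); exact: appr_mono.
- rewrite ltr_pdivrMr // mul1r hb andbT divr_ge0 //; last exact: ltW.
  by rewrite mulr_ge0 ?addr_ge0 ?mulr_ge0 // ltW.
- move=> xi hxi; rewrite /u nmM nmV nm_real (gtr0_norm p0) mulrC.
  rewrite ler_wpM2r ?invr_ge0 //; first exact: ltW.
  apply: le_trans (nmD _ _) _; rewrite nmM nmN nm_real (gtr0_norm q0).
  rewrite (monoD r0) // !mono_unitm nmM !hxi; lra.
Qed.

End Bethe.

(** * Finitely supported sums *)

Section FiniteSums.
Context {K : numFieldType}.

(** For functions of finite support; the lemmas below exhibit a list that contains
    the support. *)
Definition fsum {T : choiceType} (F : T -> K) : K := \sum_(x \in [set: T]) F x.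

Definition fin {T : choiceType} (F : T -> K) :=
  exists s : seq T, forall x, F x != 0 -> x \in s.

(** A finite support contained in a rectangle, as needed to exchange two sums. *)
Definition fin2 {T U : choiceType} (F : T -> U -> K) :=
  exists (s : seq T) (t : seq U), forall x y, F x y != 0 -> x \in s /\ y \in t.

Implicit Types T U : choiceType.

Lemma fsumE T (s : seq T) (F : T -> K) : uniq s -> (forall x, F x != 0 -> x \in s) ->
  fsum F = \sum_(x <- s) F x.
Proof.
move=> us h; rewrite /fsum (@bigfs _ _ _ _ s xpredT) //.
  by apply: eq_fsbigl; apply/seteqP; split.
by move=> i _; apply: contraNeq; exact: h.
Qed.

Lemma fsum_undup T (s : seq T) (F : T -> K) : (forall x, F x != 0 -> x \in s) ->
  fsum F = \sum_(x <- undup s) F x.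
Proof.
move=> h; apply: fsumE; first exact: undup_uniq.
by move=> x /h; rewrite mem_undup.
Qed.

Lemma eq_fsum T (F G : T -> K) : F =1 G -> fsum F = fsum G.
Proof. by move=> /funext ->. Qed.

Lemma fsum0 T : fsum (fun _ : T => 0) = 0.
Proof. by rewrite (@fsumE _ [::]) ?big_nil // => x; rewrite eqxx. Qed.

Lemma fsum_eq0 T (F : T -> K) : (forall x, F x = 0) -> fsum F = 0.
Proof. by move=> h; rewrite (eq_fsum h) fsum0. Qed.

Lemma fsum_ne0 T (F : T -> K) : fsum F != 0 -> exists x, F x != 0.
Proof.
apply: contra_neqP => /forallNP h; apply: fsum_eq0 => x.
by apply/eqP/negPn/negP; exact: h.
Qed.

Lemma finD T (F G : T -> K) : fin F -> fin G -> fin (fun x => F x + G x).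
Proof.
move=> [s hs] [t ht]; exists (s ++ t) => x h; rewrite mem_cat.
have [Fx|/hs -> //] := eqVneq (F x) 0.
by move: h; rewrite Fx add0r => /ht ->; rewrite orbT.
Qed.

Lemma fsumD T (F G : T -> K) : fin F -> fin G ->
  fsum (fun x => F x + G x) = fsum F + fsum G.
Proof.
move=> [s hs] [t ht].
have hF x : F x != 0 -> x \in s ++ t by move/hs; rewrite mem_cat => ->.
have hG x : G x != 0 -> x \in s ++ t by move/ht; rewrite mem_cat orbC => ->.
rewrite (fsum_undup hF) (fsum_undup hG) -big_split /=.
apply: fsum_undup => x h.
have [Fx|/hF //] := eqVneq (F x) 0.
by move: h; rewrite Fx add0r => /hG.
Qed.

Lemma fsumZ T c (F : T -> K) : fsum (fun x => c * F x) = c * fsum F.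
Proof. by rewrite /fsum mulr_fsumr. Qed.

Lemma fsumZr T c (F : T -> K) : fsum (fun x => F x * c) = fsum F * c.
Proof. by rewrite /fsum mulr_fsuml. Qed.

Lemma finZ T c (F : T -> K) : fin F -> fin (fun x => c * F x).
Proof. by move=> [s h]; exists s => x; rewrite mulf_eq0 negb_or => /andP[_ /h]. Qed.

Lemma fsumB T (F G : T -> K) : fin F -> fin G ->
  fsum (fun x => F x - G x) = fsum F - fsum G.
Proof.
move=> fF fG; rewrite -[X in _ = _ + X]mulN1r -fsumZ -fsumD //; last exact: finZ.
by apply: eq_fsum => x; rewrite mulN1r.
Qed.

Lemma fin_sum T (I : Type) (s : seq I) (P : pred I) (F : I -> T -> K) :
  (forall i, P i -> fin (F i)) -> fin (fun x => \sum_(i <- s | P i) F i x).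
Proof.
move=> h; elim: s => [|i s [t ht]].
  by exists [::] => x; rewrite big_nil eqxx.
case pi : (P i); last by exists t => x; rewrite big_cons pi; exact: ht.
have [u hu] := h _ pi; exists (u ++ t) => x; rewrite big_cons pi mem_cat.
have [->|/hu -> //] := eqVneq (F i x) 0.
by rewrite add0r => /ht ->; rewrite orbT.
Qed.

Lemma fsum_sum T (I : Type) (s : seq I) (P : pred I) (F : I -> T -> K) :
  (forall i, P i -> fin (F i)) ->
  fsum (fun x => \sum_(i <- s | P i) F i x) = \sum_(i <- s | P i) fsum (F i).
Proof.
move=> h; elim: s => [|i s IH].
  by rewrite big_nil; apply: fsum_eq0 => x; rewrite big_nil.
rewrite big_cons -IH; case pi : (P i).
  rewrite -fsumD; [|exact: h|exact: fin_sum].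
  by apply: eq_fsum => x; rewrite big_cons pi.
by apply: eq_fsum => x; rewrite big_cons pi.
Qed.

Lemma fsum_exch T U (F : T -> U -> K) : fin2 F ->
  fsum (fun x => fsum (F x)) = fsum (fun y => fsum (F ^~ y)).
Proof.
move=> [s [t h]].
rewrite (@fsum_undup _ s); last by move=> x /fsum_ne0[y /h[]].
rewrite (@fsum_undup _ t); last by move=> y /fsum_ne0[x /h[]].
under eq_bigr => x _ do rewrite (@fsum_undup _ t _ (fun y hy => (h x y hy).2)).
under [RHS]eq_bigr => y _ do rewrite (@fsum_undup _ s _ (fun x hx => (h x y hx).1)).
exact: exchange_big.
Qed.

Lemma fsum_bij T U (h : T -> U) (F : U -> K) : bijective h ->
  fsum (fun x => F (h x)) = fsum F.
Proof. by move=> bh; rewrite /fsum (reindex_fsbigT h). Qed.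

Lemma fsum_single T (x0 : T) (F : T -> K) : (forall x, F x != 0 -> x = x0) ->
  fsum F = F x0.
Proof.
move=> h; rewrite (@fsumE _ [:: x0]) ?big_seq1 //.
by move=> x /h ->; rewrite inE.
Qed.

End FiniteSums.

Section Boxes.
Context {N : nat}.
Implicit Types (B Z : {ffun 'I_N -> int}).

Definition box (k : nat) B : seq {ffun 'I_N -> int} :=
  [seq B + [ffun i => (f i : nat)%:Z] | f : {ffun 'I_N -> 'I_k}].

Lemma boxP (k : nat) B Z : (forall i, B i <= Z i < B i + k%:Z) -> Z \in box k B.
Proof.
move=> h.
have h' i : (`|Z i - B i| < k)%N.
  by have /andP[h1 h2] := h i; lia.
apply/mapP; exists [ffun i => Ordinal (h' i)]; first by rewrite mem_enum.
apply/ffunP => i; rewrite !ffunE /=.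
by have /andP[h1 h2] := h i; rewrite gez0_abs ?subr_ge0 //; lia.
Qed.

Definition tot Z : int := \sum_i Z i.

Lemma totD Z B : tot (Z + B) = tot Z + tot B.
Proof. by rewrite /tot -big_split; apply: eq_bigr => i _; rewrite ffunE. Qed.

Lemma le_tot Z B : (forall i, B i <= Z i) -> tot B <= tot Z.
Proof. by move=> h; apply: ler_sum. Qed.

Lemma tot_eq Z B : (forall i, B i <= Z i) -> tot Z <= tot B -> Z = B.
Proof.
move=> h ht; apply/ffunP => i.
apply/eqP; rewrite eq_le h andbT.
move: ht; rewrite /tot (bigD1 i) //= [X in _ <= X](bigD1 i) //=.
have : \sum_(j < N | j != i) B j <= \sum_(j < N | j != i) Z j by apply: ler_sum.
by set u := (\sum_(j < N | j != i) B j); set v := (\sum_(j < N | j != i) Z j) => h1 h2; lia.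
Qed.

(** A lower bound on each coordinate and an upper bound on the sum leave finitely
    many points. *)
Lemma tot_box Z B (D : int) : (forall i, B i <= Z i) -> tot Z <= tot B + D ->
  Z \in box (`|D|).+1 B.
Proof.
move=> h ht; apply: boxP => i; rewrite h /=.
move: ht; rewrite /tot (bigD1 i) //= [X in _ <= X + _](bigD1 i) //=.
have : \sum_(j < N | j != i) B j <= \sum_(j < N | j != i) Z j by apply: ler_sum.
set u := (\sum_(j < N | j != i) B j); set v := (\sum_(j < N | j != i) Z j) => h1 h2.
have h3 := h i; lia.
Qed.

Lemma tot_bounded Z (c : int) : (forall i, Z i <= c) -> tot Z = 0 -> 0 <= c ->
  forall i, - (N%:Z * c) <= Z i.
Proof.
move=> h ht c0 i; move: ht; rewrite /tot (bigD1 i) //=.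
have : \sum_(j < N | j != i) Z j <= \sum_(j < N | j != i) c by apply: ler_sum.
move=> h1 h2.
have : \sum_(j < N) c = N%:Z * c by rewrite sumr_const card_ord -mulr_natl natz.
rewrite (bigD1 i) //=; move: h1 h2.
set u := \sum_(j < N | j != i) Z j; set v := \sum_(j < N | j != i) c; lia.
Qed.

End Boxes.

(** * The affine symmetric group *)

Section AffineGroup.
Context {N : nat}.
Variable (L : nat).
Local Notation expo := {ffun 'I_N -> int}.

(** The pair (s, l) stands for the permutation s followed by the translation by
    L l. The pairs with l of sum zero, singled out by [W0], index the terms of the
    formula. *)
Definition affine : Type := ('S_N * expo)%type.
HB.instance Definition _ := Choice.on affine.

Implicit Types (v w : affine) (X Z : expo).

Definition wact w X : expo := [ffun j => X (w.1^-1 j)%g + L%:Z * w.2 j].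
(** The action of period 1, for which the points [vert i] are the vertices of the
    fundamental alcove. *)
Definition wact1 w X : expo := [ffun j => X (w.1^-1 j)%g + w.2 j].

Definition mulw v w : affine := ((w.1 * v.1)%g, [ffun j => v.2 j + w.2 (v.1^-1 j)%g]).
Definition onew : affine := (1%g, 0).
Definition invw w : affine := (w.1^-1%g, [ffun j => - w.2 (w.1 j)]).
Definition W0 w : bool := tot w.2 == 0.

Lemma affineP v w : v.1 = w.1 -> (forall j, v.2 j = w.2 j) -> v = w.
Proof. by case: v w => [s l] [s' l'] /= -> h; congr pair; apply/ffunP. Qed.

Lemma mulwA : associative mulw.
Proof.
move=> u v w; apply: affineP => [|j]; rewrite /= ?mulgA //.
by rewrite !ffunE addrA; congr (_ + w.2 _); rewrite invMg permM.
Qed.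

Lemma mul1w : left_id onew mulw.
Proof.
move=> w; apply: affineP => [|j]; rewrite /= ?mulg1 //.
by rewrite !ffunE add0r invg1 perm1.
Qed.

Lemma mulw1 : right_id onew mulw.
Proof.
move=> w; apply: affineP => [|j]; rewrite /= ?mul1g //.
by rewrite !ffunE addr0.
Qed.

Lemma mulVw : left_inverse onew invw mulw.
Proof.
move=> w; apply: affineP => [|j]; rewrite /= ?mulgV //.
by rewrite !ffunE invgK addNr.
Qed.

Lemma mulwV : right_inverse onew invw mulw.
Proof.
move=> w; apply: affineP => [|j]; rewrite /= ?mulVg //.
by rewrite !ffunE permKV subrr.
Qed.

Lemma mulw_bijl v : bijective (mulw v).
Proof.
by exists (mulw (invw v)) => w; rewrite mulwA ?mulVw ?mulwV mul1w.
Qed.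

Lemma mulw_bijr w : bijective (mulw^~ w).
Proof.
by exists (mulw^~ (invw w)) => v; rewrite -mulwA ?mulVw ?mulwV mulw1.
Qed.

Lemma tot_perm (s : 'S_N) X : tot [ffun j => X (s j)] = tot X.
Proof.
rewrite /tot [RHS](reindex_inj (@perm_inj _ s)).
by apply: eq_bigr => i _; rewrite ffunE.
Qed.

Lemma tot_mulw v w : tot (mulw v w).2 = tot v.2 + tot w.2.
Proof.
rewrite -(tot_perm v.1^-1 w.2) -totD; congr tot.
by apply/ffunP => j; rewrite !ffunE.
Qed.

Lemma W0_mull v w : W0 v -> W0 (mulw v w) = W0 w.
Proof. by move=> /eqP h; rewrite /W0 tot_mulw h add0r. Qed.

Lemma W0_mulr v w : W0 w -> W0 (mulw v w) = W0 v.
Proof. by move=> /eqP h; rewrite /W0 tot_mulw h addr0. Qed.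

Lemma W0_one : W0 onew.
Proof. by rewrite /W0 /tot big1 // => i _; rewrite ffunE. Qed.

Lemma act_one X : wact onew X = X.
Proof. by apply/ffunP => j; rewrite !ffunE /= invg1 perm1 mulr0 addr0. Qed.

Lemma act1_mul v w X : wact1 (mulw v w) X = wact1 v (wact1 w X).
Proof. by apply/ffunP => j; rewrite !ffunE /= invMg permM; ring. Qed.

Lemma act1_one X : wact1 onew X = X.
Proof. by apply/ffunP => j; rewrite !ffunE /= invg1 perm1 addr0. Qed.

Lemma tot_act w X : W0 w -> tot (wact w X) = tot X.
Proof.
move=> /eqP h; rewrite -[RHS](tot_perm w.1^-1 X) -[RHS]addr0.
have -> : (0 : int) = tot [ffun j => L%:Z * w.2 j].
  rewrite -[LHS](mulr0 L%:Z) -h /tot mulr_sumr.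
  by apply: eq_bigr => j _; rewrite ffunE.
by rewrite -totD; congr tot; apply/ffunP => j; rewrite !ffunE.
Qed.

Definition wlist (M : nat) : seq affine :=
  [seq (s, l) | s <- enum 'S_N, l <- box (2 * M).+1 [ffun=> - M%:Z]].

Lemma wlistP (M : nat) w : (forall j, - M%:Z <= w.2 j <= M%:Z) -> w \in wlist M.
Proof.
case: w => s l /= h; apply/allpairsP; exists (s, l); split => //=.
  by rewrite mem_enum.
by apply: boxP => i; rewrite ffunE; have /andP[h1 h2] := h i; lia.
Qed.

(** A vector of sum zero that is bounded above is also bounded below. *)
Lemma W0_finite {K : numFieldType} (F : affine -> K) (c : nat) :
  (forall w, F w != 0 -> W0 w /\ forall j, w.2 j <= c%:Z) -> fin F.
Proof.
move=> h; exists (wlist (N * c + c)) => w /h[/eqP w0 hw]; apply: wlistP => j.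
have h1 := tot_bounded hw w0 (isT : 0 <= c%:Z) j; have h2 := hw j.
 apply/andP; split; nia.
Qed.

Definition wrapz (i : 'I_N) : int := (i.+1 == N)%:Z.
(** Distance to the next particle of the ring, the last particle being followed by
    the first one shifted by L. *)
Definition gap X (i : 'I_N) : int := X (ordS i) + wrapz i * L%:Z - X i.
Definition vert (i : 'I_N) : expo := [ffun j : 'I_N => (i < j)%N%:Z].
(** The reflection in the wall [gap i = 0]. *)
Definition refl (i : 'I_N) : affine :=
  (tperm i (ordS i), [ffun j => wrapz i * ((j == i)%:Z - (j == ordS i)%:Z)]).

Lemma W0_refl i : W0 (refl i).
Proof.
rewrite /W0 /tot /=; under eq_bigr do rewrite ffunE.
rewrite -mulr_sumr sumrB.
have h (k : 'I_N) : \sum_(j < N) (j == k)%:Z = 1.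
  by rewrite (bigD1 k) //= eqxx big1 ?addr0 // => j /negPf ->.
by rewrite !h subrr mulr0.
Qed.

Lemma val_ordS (i : 'I_N) : (ordS i : nat) = if i.+1 == N then 0%N else i.+1.
Proof.
rewrite /=; case: eqP => [->|h]; first by rewrite modnn.
by rewrite modn_small //; have := ltn_ord i; lia.
Qed.

Lemma gap_sum X : (0 < N)%N -> \sum_i gap X i = L%:Z.
Proof.
move=> N1; rewrite /gap big_split /= sumrN big_split /=.
have -> : \sum_(i < N) X (ordS i) = \sum_(i < N) X i.
  by rewrite [RHS](reindex_inj (@ordS_inj N)).
set u := \sum_(i < N) X i.
rewrite -mulr_suml.
have -> : \sum_(i < N) wrapz i = 1 :> int.
  have hN : (N.-1 < N)%N by lia.
  rewrite (bigD1 (Ordinal hN)) //= /wrapz /= prednK ?eqxx; last by lia.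
  rewrite big1 ?addr0 // => i; rewrite -val_eqE /= => hi.
  by case: eqP => //; lia.
by rewrite mul1r; lia.
Qed.

(** Abel summation along the ring. *)
Lemma gap_vert X (j : 'I_N) (j0 : 'I_N) : j0 = 0%N :> nat ->
  \sum_i gap X i * vert i j = X j - X j0.
Proof.
move=> j00.
have h (m : nat) (hm : (m < N)%N) : \sum_(i < N | (i < m)%N) gap X i = X (Ordinal hm) - X j0.
  elim: m hm => [|m IH] hm.
    rewrite big1 => [|i]; last by rewrite ltn0.
    by apply/esym/eqP; rewrite subr_eq0; apply/eqP; congr (X _); apply: val_inj.
  have hm' : (m < N)%N by lia.
  rewrite (bigD1 (Ordinal hm')) //=.
  rewrite (eq_bigl (fun i : 'I_N => (i < m)%N)); last first.
    move=> i; rewrite -val_eqE /=; lia.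
  rewrite (IH hm') /gap /wrapz /=.
  have -> : (m.+1 == N) = false by lia.
  have -> : ordS (Ordinal hm') = Ordinal hm.
    by apply: val_inj; rewrite /= modn_small.
  by lia.
have := h j (ltn_ord j).
have -> : Ordinal (ltn_ord j) = j by apply: val_inj.
move=> <-; rewrite [RHS]big_mkcond; apply: eq_bigr => i _.
by rewrite ffunE; case: ltnP; rewrite ?mulr1 ?mulr0.
Qed.

Hypothesis N2 : (1 < N)%N.

Lemma ordS_neq (i : 'I_N) : ordS i != i.
Proof.
apply/eqP => /(congr1 val) /=.
have [h|h] := ltnP i.+1 N; first by rewrite modn_small //; lia.
have -> : i.+1 = N by have := ltn_ord i; lia.
by rewrite modnn; have := ltn_ord i; lia.
Qed.

Lemma act_refl i X : wact (refl i) X =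
  [ffun j => if j == i then X (ordS i) - wrapz i * - L%:Z else
             if j == ordS i then X i - wrapz i * L%:Z else X j].
Proof.
have ni := ordS_neq i.
apply/ffunP => j; rewrite !ffunE /= tpermV; case: eqP => [->|/eqP ji].
  by rewrite tpermL [i == ordS i]eq_sym (negPf ni) /wrapz; case: (_ == N); lia.
case: eqP => [->|/eqP jS]; first by rewrite tpermR /wrapz; case: (_ == N); lia.
by rewrite tpermD 1?eq_sym // /wrapz; case: (_ == N); lia.
Qed.

Lemma odd_refl i : odd_perm (refl i).1.
Proof. by rewrite /= odd_tperm eq_sym ordS_neq. Qed.

Lemma refl_vert i k : k != i -> wact1 (refl i) (vert k) = vert k.
Proof.
move=> ki; have ni := ordS_neq i.
have vS := val_ordS i; have iN := ltn_ord i; have kN := ltn_ord k.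
have ki' : (k : nat) != i by [].
apply/ffunP => j; rewrite !ffunE /= tpermV; case: (eqVneq j i) => [->|ji].
  rewrite tpermL eq_sym (negPf ni) vS /wrapz; case: eqP => h; last by lia.
  by rewrite mul1r; lia.
case: (eqVneq j (ordS i)) => [->|jS].
  rewrite tpermR vS /wrapz; case: eqP => h; last by lia.
  by rewrite mul1r; lia.
by rewrite tpermD 1?eq_sym //; ring.
Qed.

End AffineGroup.

(** * Reduction to the faces of the alcove *)

Section Euler.
Context {K : numFieldType} {N : nat}.
Variable L : nat.
Hypotheses (N1 : (0 < N)%N) (L1 : (0 < L)%N).
Local Notation expo := {ffun 'I_N -> int}.
Local Notation wact := (wact L).
Local Notation gap := (gap L).
Implicit Types (v w : @affine N) (X Y Z : expo) (J : {set 'I_N}).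

(** The points on the positive side of the walls in J; for J the set of all walls
    this is the alcove. *)
Definition cone J Z : bool := [forall i, (i \in J) ==> (0 < gap Z i)].
(** The walls outside J are opposite to the vertices that v has to fix, so this is
    the group generated by the reflections in the walls of J, when J is proper. *)
Definition stab J v : bool := [forall i, (i \notin J) ==> (wact1 v (vert i) == vert i)].

(* k w Z X stands for the coefficient of exponent Z in the action of w on the
   monomial of exponent X. *)
Variable k : @affine N -> expo -> expo -> K.
Hypothesis k_ge : forall w Z X, k w Z X != 0 -> forall i, wact w X i <= Z i.
Hypothesis k_lead : forall w X, k w (wact w X) X = (-1) ^+ (w.1 : 'S_N).
Hypothesis k_mul : forall v w Z X,
  k (mulw v w) Z X = fsum (fun Z' => k v Z Z' * k w Z' X).
Definition partial J : bool := [exists i, i \notin J].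
Hypothesis k_cone : forall J X Z, partial J -> cone J X -> cone J Z ->
  fsum (fun v => (stab J v)%:R * k v Z X) = (Z == X)%:R.

Variable Y : expo.

Definition absum X : nat := \sum_i `|X i|.

Lemma absumP X i : `|X i| <= (absum X)%:Z.
Proof.
rewrite /absum (bigD1 i) //= -abszE lez_nat; exact: leq_addr.
Qed.

Lemma act_le w X Z : (forall j, wact w X j <= Z j) ->
  forall j, w.2 j <= (absum X + absum Z)%N%:Z.
Proof.
move=> h j; have := h j; rewrite ffunE => hj.
have h1 := absumP X (w.1^-1%g j); have h2 := absumP Z j.
have [w0|w0] := lerP (w.2 j) 0; first by lia.
have : w.2 j <= L%:Z * w.2 j by rewrite ler_peMl; lia.
by move: hj h1 h2; set u := X _; set u' := Z _; lia.
Qed.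

Lemma kW_tot w Z X : W0 w -> k w Z X != 0 -> tot X <= tot Z.
Proof. by move=> w0 /k_ge h; rewrite -(tot_act L X w0); exact: le_tot. Qed.

(** The action preserves the sum of the coordinates and k w Z X vanishes unless Z
    dominates the image of X coordinatewise: equal sums force equality. *)
Lemma k_top w Z X : W0 w -> k w Z X != 0 -> tot Z <= tot X -> Z = wact w X.
Proof.
move=> w0 /k_ge h ht; apply: tot_eq => //.
by rewrite (tot_act L X w0).
Qed.

Definition Zlist (D : int) w X := box (`|D - tot (wact w X)|).+1 (wact w X).

Lemma ZlistP D w X Z : k w Z X != 0 -> tot Z <= D -> Z \in Zlist D w X.
Proof.
by move=> /k_ge h hD; apply: tot_box => //; rewrite (addrC (tot _)) subrK.
Qed.

Lemma mulb_neq0 (b : bool) (x : K) : b%:R * x != 0 -> b /\ x != 0.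
Proof. by case: b; rewrite ?mul1r ?mul0r // eqxx. Qed.

Definition wlistZ (s : seq expo) : seq (@affine N) :=
  wlist (N * (\sum_(Z <- s) absum Z + absum Y) + (\sum_(Z <- s) absum Z + absum Y)).

Lemma wlistZP s v Z : Z \in s -> W0 v -> k v Y Z != 0 -> v \in wlistZ s.
Proof.
move=> Zs v0 /k_ge h; have hv := act_le h.
set c := (\sum_(Z <- s) absum Z + absum Y)%N.
have hc j : v.2 j <= c%:Z.
  apply: le_trans (hv j) _; rewrite lez_nat leq_add2r.
  rewrite (big_rem Z) //=; exact: leq_addr.
apply: wlistP => j.
have h1 := tot_bounded hc (eqP v0) (isT : 0 <= c%:Z) j; have h2 := hc j.
by rewrite -/c; apply/andP; split; nia.
Qed.

Lemma finW Z : fin (fun w => (W0 w)%:R * k w Y Z).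
Proof.
by exists (wlistZ [:: Z]) => w /mulb_neq0[w0 h]; apply: wlistZP h => //; rewrite inE.
Qed.

(** The sum over the group at time zero, which is to be the indicator of Y on the
    alcove. *)
Definition lam Z : K := fsum (fun w => (W0 w)%:R * k w Y Z).

Lemma lam_tot Z : lam Z != 0 -> tot Z <= tot Y.
Proof. by move=> /fsum_ne0[w /mulb_neq0[w0 /(kW_tot w0)]]. Qed.

(** The group is invariant under right translation by w, and [k_mul] splits off the
    action of w. *)
Lemma lamK w X : W0 w -> lam X = fsum (fun Z => lam Z * k w Z X).
Proof.
move=> w0; under [RHS]eq_fsum do rewrite -fsumZr.
rewrite fsum_exch.
  rewrite /lam -(fsum_bij _ (mulw_bijr w)); apply: eq_fsum => v.
  rewrite W0_mulr // k_mul -fsumZ; apply: eq_fsum => Z; by rewrite mulrA.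
exists (Zlist (tot Y) w X), (wlistZ (Zlist (tot Y) w X)) => Z v.
rewrite mulf_eq0 negb_or => /andP[/mulb_neq0[v0 hv] hw].
have Zs : Z \in Zlist (tot Y) w X by apply: ZlistP => //; exact: kW_tot hv.
by split => //; apply: wlistZP hv.
Qed.

(** The part of the expansion [lamK] carried by the cone of J. *)
Definition lamJ J w X : K := fsum (fun Z => (cone J Z)%:R * lam Z * k w Z X).

Lemma lamJ_in J w X Z : (cone J Z)%:R * lam Z * k w Z X != 0 ->
  [/\ cone J Z, tot Z <= tot Y, k w Z X != 0 & Z \in Zlist (tot Y) w X].
Proof.
rewrite mulf_eq0 negb_or => /andP[/mulb_neq0[c /lam_tot h] hk].
by split => //; exact: ZlistP.
Qed.

Lemma lamJ_tot J w X : W0 w -> lamJ J w X != 0 -> tot X <= tot Y.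
Proof.
move=> w0 /fsum_ne0[Z /lamJ_in[_ h hk _]].
exact: le_trans (kW_tot w0 hk) h.
Qed.

Lemma lamJ_comp J v w X : W0 v ->
  fsum (fun Z => lamJ J v Z * k w Z X) = lamJ J (mulw v w) X.
Proof.
move=> v0; under [LHS]eq_fsum do rewrite -fsumZr.
rewrite fsum_exch.
  apply: eq_fsum => Z'; rewrite k_mul -fsumZ; apply: eq_fsum => Z.
  by rewrite mulrA.
exists (Zlist (tot Y) w X), (flatten [seq Zlist (tot Y) v Z | Z <- Zlist (tot Y) w X]).
move=> Z Z'; rewrite mulf_eq0 negb_or => /andP[/lamJ_in[_ h hk hin] hw].
have Zs : Z \in Zlist (tot Y) w X.
  by apply: ZlistP => //; apply: le_trans h; exact: kW_tot hk.
by split => //; apply/flatten_mapP; exists Z.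
Qed.

Lemma stab_mul J v w : stab J v -> stab J w -> stab J (mulw v w).
Proof.
move=> /forallP hv /forallP hw; apply/forallP => i; apply/implyP => iJ.
have /implyP/(_ iJ)/eqP E := hv i; have /implyP/(_ iJ)/eqP E' := hw i.
by rewrite act1_mul E' E.
Qed.

Lemma stab_inv J v : stab J v -> stab J (invw v).
Proof.
move=> /forallP hv; apply/forallP => i; apply/implyP => iJ.
have /implyP/(_ iJ)/eqP E := hv i.
by rewrite -[X in wact1 _ X]E -act1_mul mulVw act1_one.
Qed.

Lemma stab_mulr J v w : stab J w -> stab J (mulw v w) = stab J v.
Proof.
move=> hw; apply/idP/idP => [h|h]; last exact: stab_mul.
by rewrite -[v]mulw1 -(mulwV w) mulwA; apply: stab_mul => //; exact: stab_inv.
Qed.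

Lemma stab_one J : stab J onew.
Proof. by apply/forallP => i; rewrite act1_one eqxx implybT. Qed.

Lemma tot_act1 w X : tot (wact1 w X) = tot X + tot w.2.
Proof.
rewrite -(tot_perm w.1^-1 X) -totD; congr tot.
by apply/ffunP => j; rewrite !ffunE.
Qed.

Section Parabolic.
Variable J : {set 'I_N}.
Hypothesis JT : partial J.

Lemma outJ : exists i0, i0 \notin J.
Proof. exact/existsP. Qed.

Lemma stab_W0 v : stab J v -> W0 v.
Proof.
move=> /forallP h; have [i0 i0J] := outJ.
have /implyP/(_ i0J)/eqP := h i0 => /(congr1 tot).
by rewrite tot_act1 => /eqP; rewrite -subr_eq0 addrAC subrr add0r.
Qed.

Lemma stab_wlist v : stab J v -> v \in wlist 1.
Proof.
move=> /forallP h; have [i0 i0J] := outJ.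
have /implyP/(_ i0J)/eqP := h i0 => /ffunP E.
apply: wlistP => j; have := E j; rewrite !ffunE.
by case: (i0 < _)%N; case: (i0 < _)%N; lia.
Qed.

(** The stabiliser of the face spreads the cone of J over all points; [sumJE] shows
    that nothing of [lam] is lost or counted twice. *)
Definition sumJ X := fsum (fun v => (stab J v)%:R * lamJ J v X).

Definition mu X := sumJ X - lam X.

(** On the cone, [k_cone] collapses the sum over the stabiliser. *)
Lemma mu_cone X : cone J X -> mu X = 0.
Proof.
move=> cX; apply/eqP; rewrite subr_eq0; apply/eqP.
rewrite /sumJ; under eq_fsum do rewrite -fsumZ.
rewrite fsum_exch.
  transitivity (fsum (fun Z => (cone J Z)%:R * lam Z * (Z == X)%:R)).
    apply: eq_fsum => Z; case cZ : (cone J Z); last first.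
      by rewrite !mul0r; apply: fsum_eq0 => v; rewrite !mul0r mulr0.
    rewrite -(k_cone JT cX cZ) -fsumZ; apply: eq_fsum => v.
    by rewrite mulrCA.
  rewrite (@fsum_single _ _ X) ?cX ?eqxx ?mulr1 ?mul1r //.
  by move=> Z; case: (Z =P X) => //= _; rewrite mulr0 eqxx.
exists (wlist 1), (flatten [seq Zlist (tot Y) v X | v <- wlist 1]) => v Z.
move=> /mulb_neq0[/stab_wlist hv /lamJ_in[_ _ _ h]]; split => //.
by apply/flatten_mapP; exists v.
Qed.

Lemma mu_tot X : mu X != 0 -> tot X <= tot Y.
Proof.
move=> h; rewrite leNgt; apply/negP => h'; move/eqP: h; apply.
rewrite /mu; have [->|/lam_tot] := eqVneq (lam X) 0; last by lia.
rewrite subr0; apply: fsum_eq0 => v; case sv : (stab J v); last by rewrite mul0r.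
have [->|/(lamJ_tot (stab_W0 sv))] := eqVneq (lamJ J v X) 0; first by rewrite mulr0.
by lia.
Qed.

Lemma sumJ_comp w X : W0 w ->
  fsum (fun Z => sumJ Z * k w Z X) = fsum (fun v => (stab J v)%:R * lamJ J (mulw v w) X).
Proof.
move=> w0; under [LHS]eq_fsum do rewrite -fsumZr.
rewrite fsum_exch.
  apply: eq_fsum => v; case sv : (stab J v).
    rewrite mul1r -(lamJ_comp _ _ _ (stab_W0 sv)); apply: eq_fsum => Z.
    by rewrite mul1r.
  by rewrite mul0r; apply: fsum_eq0 => Z; rewrite !mul0r.
exists (Zlist (tot Y) w X), (wlist 1) => Z v.
rewrite mulf_eq0 negb_or => /andP[/mulb_neq0[sv hv] hw].
split; last exact: stab_wlist sv.
by apply: ZlistP => //; exact: lamJ_tot (stab_W0 sv) hv.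
Qed.

Lemma sumJ_fin2 w X : fin (fun Z => sumJ Z * k w Z X).
Proof.
exists (Zlist (tot Y) w X) => Z; rewrite mulf_eq0 negb_or => /andP[/fsum_ne0[v]].
move=> /mulb_neq0[sv hv] hw; apply: ZlistP => //.
exact: lamJ_tot (stab_W0 sv) hv.
Qed.

Lemma lam_fin2 w X : fin (fun Z => lam Z * k w Z X).
Proof.
exists (Zlist (tot Y) w X) => Z; rewrite mulf_eq0 negb_or => /andP[/lam_tot h hw].
exact: ZlistP.
Qed.

Lemma mu_comp w X : stab J w -> mu X = fsum (fun Z => mu Z * k w Z X).
Proof.
move=> sw; have w0 := stab_W0 sw.
transitivity (fsum (fun Z => sumJ Z * k w Z X - lam Z * k w Z X)); last first.
  by apply: eq_fsum => Z; rewrite mulrBl.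
rewrite fsumB; [|exact: sumJ_fin2|exact: lam_fin2].
rewrite -lamK // sumJ_comp //; congr (_ - _).
rewrite /sumJ -(fsum_bij _ (mulw_bijr w)); apply: eq_fsum => v.
by rewrite stab_mulr.
Qed.

(** Squared distance, rescaled by N, to the point with coordinates j L / N inside
    the alcove. *)
Definition dist2 X : nat := `| \sum_(j < N) (N%:Z * X j - j%:Z * L%:Z) ^+ 2 |.

(** Reflecting in a wall that separates a point from the alcove brings it closer. *)
Lemma dist2_refl (N2 : (1 < N)%N) i X : gap X i < 0 ->
  (dist2 (wact (refl i) X) < dist2 X)%N.
Proof.
move=> g0; have ni := ordS_neq N2 i.
rewrite /dist2 -ltz_nat !gez0_abs; last 2 first.
- by apply: sumr_ge0 => j _; exact: sqr_ge0.
- by apply: sumr_ge0 => j _; exact: sqr_ge0.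
rewrite (bigD1 i) //= (bigD1 (ordS i)) //= [X in _ < X](bigD1 i) //=.
rewrite [X in _ < _ + X](bigD1 (ordS i)) //=.
rewrite (eq_bigr (fun j : 'I_N => (N%:Z * X j - j%:Z * L%:Z) ^+ 2)); last first.
  by move=> j /andP[/negPf ji /negPf jS]; rewrite (act_refl L N2) ffunE ji jS.
set S := \sum_(j < N | _) _.
rewrite !addrA ltrD2r (act_refl L N2) !ffunE eqxx (negPf ni) eqxx.
move: g0; rewrite /gap; move: (X i) (X (ordS i)) => a b.
have := val_ordS i; rewrite /= => ->; rewrite /wrapz.
case: eqP => h /=; last first.
  rewrite !mul0r ?subr0 ?addr0 subr_lt0 => g0.
  rewrite -subr_gt0.
  have -> : (N%:Z * a - i%:Z * L%:Z) ^+ 2 + (N%:Z * b - i.+1%:Z * L%:Z) ^+ 2 -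
    ((N%:Z * b - i%:Z * L%:Z) ^+ 2 + (N%:Z * a - i.+1%:Z * L%:Z) ^+ 2) =
    2 * N%:Z * L%:Z * (a - b) by (have -> : i.+1%:Z = i%:Z + 1 by lia); ring.
  by rewrite !mulr_gt0 // ?ltz_nat // subr_gt0.
rewrite !mul1r opprK => g0.
rewrite -subr_gt0.
have -> : (N%:Z * a - i%:Z * L%:Z) ^+ 2 + (N%:Z * b - 0%:Z * L%:Z) ^+ 2 -
    ((N%:Z * (b + L%:Z) - i%:Z * L%:Z) ^+ 2 + (N%:Z * (a - L%:Z) - 0%:Z * L%:Z) ^+ 2) =
    2 * N%:Z * L%:Z * (a - (b + L%:Z)).
  by (have -> : (i : nat)%:Z = N%:Z - 1 by lia); ring.
by rewrite !mulr_gt0 // ?ltz_nat // subr_gt0 -subr_lt0.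
Qed.

Lemma refl_stab (N2 : (1 < N)%N) i : i \in J -> stab J (refl i).
Proof.
move=> iJ; apply/forallP => j; apply/implyP => jJ; apply/eqP/refl_vert => //.
by apply: contraNneq jJ => ->.
Qed.

(** Downward induction on the total degree. In top degree equivariance becomes
    antisymmetry under the stabiliser, which kills the points on a wall and moves the
    others into the cone. *)
Lemma mu0 X : mu X = 0.
Proof.
have [d hd] : exists d : nat, tot Y - tot X < d%:Z by exists (`|tot Y - tot X|).+1; lia.
elim: d X hd => [|d IH] X hd.
  by apply/eqP/negPn/negP => /mu_tot; lia.
have hi Z : tot X < tot Z -> mu Z = 0 by move=> h; apply: IH; lia.
(* Terms of larger total degree vanish by induction; the remaining one carries
   the leading coefficient. *)
have red w Z : stab J w -> tot Z = tot X -> mu Z = mu (wact w Z) * (-1) ^+ (w.1 : 'S_N).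
  move=> sw tZ; rewrite -(k_lead w Z) (mu_comp _ sw); apply: fsum_single => Z'.
  rewrite mulf_eq0 negb_or => /andP[hm hk]; apply: (k_top (stab_W0 sw) hk).
  rewrite leNgt; apply/negP => h; rewrite hi ?eqxx // in hm; lia.
clear hd; have [n hn] : exists n, (dist2 X < n)%N by exists (dist2 X).+1.
suff : forall X', tot X' = tot X -> (dist2 X' < n)%N -> mu X' = 0 by apply.
elim: n {hn} => [//|n IHn] X' tX' dX'.
case cX : (cone J X'); first exact: mu_cone.
have [i iJ gi] : exists2 i, i \in J & gap X' i <= 0.
  move/negbT/negP: cX; apply: contra_notP => H; apply/forallP => i; apply/implyP => iJ.
  by rewrite ltNge; apply/negP => g; apply: H; exists i.
have N2 : (1 < N)%N.
  have [i0 i0J] := outJ; rewrite ltnNge; apply/negP => h.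
  have E : i0 = i by apply: val_inj => /=; have := ltn_ord i; have := ltn_ord i0; lia.
  by rewrite E iJ in i0J.
have ri := refl_stab N2 iJ.
(* On a wall antisymmetry gives mu = - mu; beyond it a reflection decreases the
   distance to the alcove. *)
move: gi; rewrite le_eqVlt => /orP[/eqP g0|g0].
  have E : wact (refl i) X' = X'.
    apply/ffunP => j; rewrite (act_refl L N2) ffunE; move: g0; rewrite /gap => g0.
    rewrite mulrN opprK; move: (wrapz i * L%:Z) g0 => u g0.
    case: eqP => [->|_]; first by apply/eqP; rewrite -subr_eq0 g0.
    by case: eqP => [->|_ //]; apply/eqP; rewrite eq_sym -subr_eq0 opprB addrA g0.
  have := red _ _ ri tX'; rewrite E odd_refl // expr1 mulrN1 => /eqP.
  by rewrite -subr_eq0 opprK -mulr2n -mulr_natr mulf_eq0 pnatr_eq0 orbF => /eqP.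
rewrite (red _ _ ri tX') IHn ?mul0r ?(tot_act L _ (W0_refl _)) //.
by have := dist2_refl N2 g0; lia.
Qed.

Lemma sumJE Z : sumJ Z = lam Z.
Proof. by apply/eqP; rewrite -subr_eq0; apply/eqP; exact: mu0. Qed.

Lemma lam_sumJ w X : W0 w ->
  lam X = fsum (fun v => (stab J v)%:R * lamJ J (mulw v w) X).
Proof.
move=> w0; rewrite -sumJ_comp // [LHS](lamK _ w0).
by apply: eq_fsum => Z; rewrite sumJE.
Qed.

End Parabolic.

(** Squared distance from the vertex i to the image of the origin by w, in period 1.
    Isometries that fix the vertex preserve it ([hvert_stab]). *)
Definition hvert w (i : 'I_N) : int := \sum_(j < N) (vert i j - w.2 j) ^+ 2.

Lemma hvert_stab J v w i : stab J v -> i \notin J -> hvert (mulw v w) i = hvert w i.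
Proof.
move=> /forallP/(_ i)/implyP h /h /eqP/ffunP E.
rewrite /hvert [RHS](reindex_inj (@perm_inj _ v.1^-1%g)).
apply: eq_bigr => j _; congr (_ ^+ 2).
by have := E j; rewrite !ffunE /= => <-; ring.
Qed.

Definition far (R : int) w : {set 'I_N} := finset (fun i => R < hvert w i).
Definition pos Z : {set 'I_N} := finset (fun i => 0 < gap Z i).

Lemma far_stab R J v w : stab J v -> (far R (mulw v w) \subset J) = (far R w \subset J).
Proof.
move=> sv; apply/fintype.subsetP/fintype.subsetP => h i; rewrite inE => hi;
  apply: contraT => iJ; move: (iJ).
- by rewrite h // inE (hvert_stab _ sv iJ).
- by rewrite h // inE -(hvert_stab w sv iJ).
Qed.

Lemma coneE J Z : cone J Z = (J \subset pos Z).
Proof.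
apply/forallP/fintype.subsetP => h i; first by move=> iJ; rewrite inE; move: (h i); rewrite iJ.
by apply/implyP => /h; rewrite inE.
Qed.

(** A bounded distance to a single vertex bounds the translation part. *)
Lemma far_finite R J w : partial J -> far R w \subset J -> w \in wlist (`|R| + 1).
Proof.
move=> /existsP[i iJ] /fintype.subsetP h.
have hi : hvert w i <= R.
  by rewrite leNgt; apply: contra iJ => hi; apply: h; rewrite inE.
apply: wlistP => j.
have : (vert i j - w.2 j) ^+ 2 <= R.
  apply: le_trans hi; rewrite /hvert (bigD1 j) //= lerDl.
  by apply: sumr_ge0 => ? _; exact: sqr_ge0.
rewrite ffunE; case: (i < j)%N; move: (w.2 j) => l /= hl; apply/andP; split; nia.
Qed.

Lemma alt_sum (B P : {set 'I_N}) : B != P ->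
  \sum_(J : {set 'I_N} | (B \subset J) && (J \subset P)) (-1) ^+ #|J| = 0 :> K.
Proof.
move=> BP; case: (set_0Vmem (P :\: B)) => [E|[x]].
  apply: big1 => J /andP[BJ JP].
  have PB : P \subset B by rewrite -finset.setD_eq0 E eqxx.
  move: BP; rewrite finset.eqEsubset PB andbT => /negP[].
  exact: fintype.subset_trans BJ JP.
rewrite inE => /andP[xB xP].
(* Toggling an element of P outside B pairs terms of opposite signs. *)
pose tog (J : {set 'I_N}) := if x \in J then (J :\ x)%SET else (x |: J)%SET.
have togK : involutive tog.
  move=> J; rewrite /tog; case xJ : (x \in J).
    by rewrite !inE eqxx /= finset.setD1K.
  by rewrite !inE eqxx /= finset.setU1K // xJ.
set S := \sum_(J | _) _.
have E : S = - S.
  rewrite {1}/S (reindex_inj (inv_inj togK)) -sumrN; apply: eq_big => J; last first.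
    move=> _; rewrite /tog; case: ifP => xJ.
      by rewrite [in RHS](cardsD1 x J) xJ add1n exprS mulN1r opprK.
    by rewrite cardsU1 xJ add1n exprS mulN1r.
  rewrite /tog; case: ifP => xJ.
    have -> : (J :\ x \subset P)%SET = (J \subset P).
      by rewrite -{2}(finset.setD1K xJ) finset.subUset finset.sub1set xP.
    by rewrite finset.subsetD1 xB andbT.
  have -> : (x |: J \subset P)%SET = (J \subset P) by rewrite finset.subUset finset.sub1set xP.
  have -> // : (B \subset x |: J)%SET = (B \subset J).
  apply/idP/idP => [/fintype.subsetP h|h]; last by apply: fintype.subset_trans h _; exact: finset.subsetUr.
  apply/fintype.subsetP => y yB; have := h y yB; rewrite !inE => /orP[/eqP yx|//].
  by rewrite yx (negPf xB) in yB.
move/eqP: E; rewrite -subr_eq0 opprK -mulr2n -mulr_natr mulf_eq0 pnatr_eq0 orbF.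
by move/eqP.
Qed.

Definition full : {set 'I_N} := finset (fun=> true).

Lemma partialE J : partial J = (J != full).
Proof.
apply/existsP/negP => [[i iJ] /eqP E|h].
  by move: iJ; rewrite E inE.
case: (pickP (fun i => i \notin J)) => [i iJ|E]; first by exists i.
by case: h; apply/eqP/finset.setP => i; rewrite inE; move: (E i) => /negbFE.
Qed.

(** Inclusion-exclusion, with the set of all walls moved to the right-hand side. *)
Lemma alt_sum_partial (B P : {set 'I_N}) : B != P ->
  \sum_(J : {set 'I_N} | partial J && (B \subset J)) (-1) ^+ #|J| * (J \subset P)%:R =
  (-1) ^+ N.+1 * (full \subset P)%:R :> K.
Proof.
move=> BP.
have E : \sum_(J : {set 'I_N} | B \subset J) (-1) ^+ #|J| * (J \subset P)%:R = 0 :> K.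
  rewrite -[RHS](alt_sum BP) [RHS]big_mkcondr; apply: eq_bigr => J _.
  by case: ifP; rewrite ?mulr1 ?mulr0.
have BT : (B \subset full) by apply/fintype.subsetP => i; rewrite inE.
move: E; rewrite (bigD1 full) //=.
have -> : #|full| = N by rewrite cardsT card_ord.
move/eqP; rewrite addrC addr_eq0 => /eqP; rewrite exprS mulN1r mulNr => <-.
by apply: eq_bigl => J; rewrite partialE andbC.
Qed.

(** The gaps of Z sum to L, so R bounds a weighted mean of the squared distances
    [hvert w], for all the Z that can contribute. *)
Definition good (R : int) X := forall w Z, W0 w -> (forall i, wact w X i <= Z i) ->
  tot Z <= tot Y -> \sum_i gap Z i * hvert w i <= L%:Z * R.

(** Otherwise [hvert w] would exceed R exactly where the gap of Z is positive, and
    so would its weighted mean. *)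
Lemma far_pos R X w Z : good R X -> W0 w -> k w Z X != 0 -> tot Z <= tot Y ->
  far R w != pos Z.
Proof.
move=> gR w0 /k_ge hk hZ; apply/eqP => E.
have := gR w Z w0 hk hZ.
have gs := gap_sum L Z N1; rewrite -{1}gs mulr_suml leNgt => /negP; apply.
have h i : 0 <= gap Z i * hvert w i - gap Z i * R.
  rewrite -mulrBr; move/finset.setP: E => /(_ i); rewrite !inE.
  case: ltrP => h1; case: ltrP => h2 // _.
    by rewrite mulr_ge0 // ?ltW // subr_gt0.
  by rewrite mulr_le0 // subr_le0.
have [i gi] : exists i, 0 < gap Z i.
  apply/existsP; rewrite -[X in is_true X]negbK negb_exists; apply/negP => /forallP hn.
  have : \sum_i gap Z i <= 0 by apply: sumr_le0 => i _; rewrite leNgt.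
  by rewrite gs; lia.
rewrite -subr_gt0 -sumrB (bigD1 i) //=.
apply: ltr_wpDr; first by apply: sumr_ge0.
rewrite -mulrBr mulr_gt0 // subr_gt0.
by move/finset.setP: E => /(_ i); rewrite !inE gi.
Qed.

(** As Z is L l up to bounded terms, the weighted mean is a negative definite
    quadratic form in l, up to linear terms. *)
Lemma good_ex X : exists2 R0 : int, 0 <= R0 & forall R, R0 <= R -> good R X.
Proof.
pose A := (absum X)%:Z; pose D := `|tot Y - tot X|; pose c1 := 2 * (A + D) + N%:Z * L%:Z.
have A0 : 0 <= A by [].
have D0 : 0 <= D by exact: normr_ge0.
have c10 : 0 <= c1 by rewrite /c1 addr_ge0 // mulr_ge0 // addr_ge0.
(* c1 collects the linear terms, and c1 |l| - l^2 is at most c1^2. *)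
pose R0 := `|tot Y| + N%:Z * A + N%:Z * c1 ^+ 2.
have R00 : 0 <= R0.
  by rewrite /R0 !addr_ge0 // ?normr_ge0 // mulr_ge0 // sqr_ge0.
exists R0 => // R hR w Z w0 hZ tZ.
apply: (@le_trans _ _ R0); last first.
  apply: (le_trans hR); rewrite ler_peMl //; first exact: le_trans hR.
pose j0 := Ordinal N1.
have hj (j : 'I_N) : 0 <= Z j - wact w X j <= D.
  apply/andP; split; first by rewrite subr_ge0.
  apply: le_trans (_ : tot Z - tot (wact w X) <= _); last first.
    by rewrite tot_act // (le_trans _ (ler_norm _)) // lerB.
  rewrite /tot (bigD1 j) //= [X in _ <= _ - X](bigD1 j) //=.
  have : \sum_(i < N | i != j) wact w X i <= \sum_(i < N | i != j) Z i by apply: ler_sum.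
  by set u := (\sum_(i < N | i != j) wact w X i); set v := (\sum_(i < N | i != j) Z i); lia.
have -> : \sum_i gap Z i * hvert w i =
    \sum_(j < N) ((1 - 2 * w.2 j) * (Z j - Z j0) + L%:Z * w.2 j ^+ 2).
  under eq_bigr do rewrite /hvert mulr_sumr.
  rewrite exchange_big /=; apply: eq_bigr => j _.
  rewrite -(gap_vert L Z j (j0 := j0)) // -(gap_sum L Z N1) mulr_sumr mulr_suml -big_split /=.
  apply: eq_bigr => i _; rewrite ffunE; case: (i < j)%N => /=; ring.
have l0 : \sum_j w.2 j = 0 by apply/eqP.
have -> : \sum_(j < N) ((1 - 2 * w.2 j) * (Z j - Z j0) + L%:Z * w.2 j ^+ 2) =
    \sum_(j < N) (Z j - Z j0 - 2 * w.2 j * Z j + L%:Z * w.2 j ^+ 2).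
  apply/eqP; rewrite -subr_eq0 -sumrB; apply/eqP.
  rewrite (eq_bigr (fun j => w.2 j * (2 * Z j0))); last by move=> j _; ring.
  by rewrite -mulr_suml l0 mul0r.
apply: (@le_trans _ _ (\sum_(j < N) (Z j + A + L%:Z * `|w.2 j0|
    + (- w.2 j ^+ 2 + 2 * (A + D) * `|w.2 j|)))).
  apply: ler_sum => j _.
  have h0 := hj j0; have h1 := hj j; rewrite !ffunE in h0 h1.
  have a0 := absumP X (w.1^-1%g j0); have a1 := absumP X (w.1^-1%g j).
  have e1 : - Z j0 <= A + L%:Z * `|w.2 j0|.
    have : - w.2 j0 <= `|w.2 j0| by rewrite -normrN ler_norm.
    move=> hl; have : L%:Z * - w.2 j0 <= L%:Z * `|w.2 j0| by rewrite ler_wpM2l.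
    rewrite mulrN; move: (L%:Z * w.2 j0) (L%:Z * `|w.2 j0|) h0 => u u' h0.
    by rewrite -/A in a0; move: (X _) a0 h0 => x a0 h0; lia.
  have e2 : - (2 * w.2 j * Z j) + L%:Z * w.2 j ^+ 2 <= - w.2 j ^+ 2 + 2 * (A + D) * `|w.2 j|.
    have [s [sE sb]] : exists s, Z j = X (w.1^-1%g j) + L%:Z * w.2 j + s /\ 0 <= s <= D.
      by exists (Z j - (X (w.1^-1%g j) + L%:Z * w.2 j)); split => //; ring.
    rewrite sE; rewrite -/A in a1; move: (X _) a1 => x a1; move: (w.2 j) => l.
    have b1 : - (x + s) * l <= (A + D) * `|l|.
      apply: le_trans (ler_norm _) _; rewrite normrM normrN; apply: ler_wpM2r => //; lia.
    have b2 : l ^+ 2 <= L%:Z * l ^+ 2 by rewrite ler_peMl // ?sqr_ge0 // lez_nat.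
    rewrite -subr_ge0.
    have -> : - l ^+ 2 + 2 * (A + D) * `|l| - (- (2 * l * (x + L%:Z * l + s)) + L%:Z * l ^+ 2)
      = 2 * ((A + D) * `|l| - - (x + s) * l) + (L%:Z * l ^+ 2 - l ^+ 2) by ring.
    by rewrite addr_ge0 ?mulr_ge0 // subr_ge0.
  move: e1 e2; move: (2 * w.2 j * Z j) (L%:Z * w.2 j ^+ 2) (L%:Z * `|w.2 j0|)
    (2 * (A + D) * `|w.2 j|) (w.2 j ^+ 2) => u1 u2 u3 u4 u5; lia.
rewrite !big_split /= -/(tot Z) !sumr_const card_ord.
have -> : A *+ N = N%:Z * A by rewrite -mulr_natl natz.
have -> : (L%:Z * `|w.2 j0|) *+ N = N%:Z * L%:Z * `|w.2 j0| by rewrite -mulr_natl natz mulrA.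
have f1 : N%:Z * L%:Z * `|w.2 j0| <= \sum_(j < N) N%:Z * L%:Z * `|w.2 j|.
  rewrite (bigD1 j0) //= lerDl; apply: sumr_ge0 => j _.
  by rewrite mulr_ge0.
have f2 : \sum_(j < N) N%:Z * L%:Z * `|w.2 j| + \sum_(j < N) (- w.2 j ^+ 2 + 2 * (A + D) * `|w.2 j|)
    <= N%:Z * c1 ^+ 2.
  have -> : N%:Z * c1 ^+ 2 = \sum_(j < N) c1 ^+ 2 by rewrite sumr_const card_ord -mulr_natl natz.
  rewrite -big_split /=; apply: ler_sum => j _.
  have -> : N%:Z * L%:Z * `|w.2 j| + (- w.2 j ^+ 2 + 2 * (A + D) * `|w.2 j|) =
    c1 * `|w.2 j| - `|w.2 j| ^+ 2 by rewrite real_normK ?num_real // /c1; ring.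
  have := normr_ge0 (w.2 j); move: (`|w.2 j|) c10 => l c10 l0'.
  nia.
rewrite big_split /= in f2.
have f3 : tot Z <= `|tot Y| by apply: le_trans tZ (ler_norm _).
move: f1 f2 f3; rewrite /R0.
move: (N%:Z * A) (N%:Z * c1 ^+ 2) (N%:Z * L%:Z * `|w.2 j0|) (\sum_(j < N) N%:Z * L%:Z * `|w.2 j|).
move: (\sum_(i < N) - w.2 i ^+ 2) (\sum_(i < N) 2 * (A + D) * `|w.2 i|) (tot Z) (`|tot Y|).
by clear; lia.
Qed.

Lemma cone_mono X (i j : 'I_N) : cone full X -> (i < j)%N -> X i < X j /\ X j < X i + L%:Z.
Proof.
move=> cX ij; pose j0 := Ordinal N1.
have g0 m : 0 < gap X m by move/forallP: cX => /(_ m); rewrite inE.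
have E : X j - X i = \sum_m gap X m * (vert m j - vert m i).
  under eq_bigr do rewrite mulrBr.
  by rewrite sumrB !(@gap_vert _ L X _ j0) //; ring.
have v01 m : 0 <= vert m j - vert m i <= 1 by rewrite !ffunE; lia.
split.
  rewrite -subr_gt0 E (bigD1 i) //=; apply: ltr_wpDr.
    by apply: sumr_ge0 => m _; rewrite mulr_ge0 ?(ltW (g0 _)) //; have /andP[] := v01 m.
  by rewrite !ffunE ij ltnn mulr1.
rewrite -ltrBlDl E -(gap_sum L X N1) -subr_gt0 -sumrB (bigD1 j) //=; apply: ltr_wpDr.
  apply: sumr_ge0 => m _; rewrite -[X in X - _]mulr1 -mulrBr mulr_ge0 ?(ltW (g0 _)) //.
  by rewrite subr_ge0; have /andP[] := v01 m.
rewrite !ffunE ltnn; have -> : (j < i)%N = false by lia.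
by rewrite subrr mulr0 subr0.
Qed.

Lemma cone_spread X (i j : 'I_N) : cone full X -> `|X i - X j| < L%:Z.
Proof.
move=> cX; case: (ltngtP i j) => h.
- by have [h1 h2] := cone_mono cX h; lia.
- by have [h1 h2] := cone_mono cX h; lia.
- by have -> : i = j by [apply: val_inj]; rewrite subrr normr0; lia.
Qed.

Lemma perm_incr (s : 'S_N) : (forall i j : 'I_N, (i < j)%N -> (s i < s j)%N) -> s = 1%g.
Proof.
have h (t : 'S_N) : (forall i j : 'I_N, (i < j)%N -> (t i < t j)%N) ->
    forall i : 'I_N, (i <= t i)%N.
  move=> ht [m hm] /=; elim: m hm => [//|m IH] hm.
  have hm' : (m < N)%N by lia.
  have h1 := IH hm'; have := ht (Ordinal hm') (Ordinal hm) (ltnSn _); lia.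
move=> hs; have hV : forall i j : 'I_N, (i < j)%N -> ((s^-1)%g i < (s^-1)%g j)%N.
  move=> i j ij; case: ltngtP => // h1.
    by have := hs _ _ h1; rewrite !permKV; lia.
  by have := val_inj h1 => /(congr1 s); rewrite !permKV => e; rewrite e ltnn in ij.
apply/permP => i; rewrite perm1; apply: val_inj; apply/eqP => /=.
rewrite eqn_leq (h _ hs i) andbT.
by have := h _ hV (s i); rewrite permK.
Qed.

(** In the alcove all coordinates differ by less than L, so the translation part
    has to be constant, hence zero; what remains is an increasing permutation. *)
Lemma cone_free w X : cone full X -> cone full (wact w X) -> W0 w -> w = onew.
Proof.
move=> cX cwX /eqP w0.
have d1 i j : `|w.2 i - w.2 j| <= 1.
  have := cone_spread i j cwX; have := cone_spread (w.1^-1%g i) (w.1^-1%g j) cX.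
  rewrite !ffunE; move: (w.2 i) (w.2 j) (X _) (X _) => a b y x h1 h2.
  have h3 : `|L%:Z * (a - b)| < L%:Z + L%:Z.
    have -> : L%:Z * (a - b) = (x + L%:Z * a - (y + L%:Z * b)) - (x - y) by ring.
    by apply: le_lt_trans (ler_normB _ _) _; apply: ltrD.
  by rewrite normrM in h3; move: h3; rewrite -mulr2n -mulr_natr ltr_pM2l //; lia.
have l0 j : w.2 j = 0.
  move: w0; rewrite /tot (bigD1 j) //= => w0.
  have [h|h|//] := ltrgtP (w.2 j) 0.
    have : \sum_(i < N | i != j) w.2 i <= 0.
      by apply: sumr_le0 => i _; have := d1 i j; lia.
    by move: w0; set u := \sum_(i < N | i != j) _; lia.
  have : 0 <= \sum_(i < N | i != j) w.2 i.
    by apply: sumr_ge0 => i _; have := d1 i j; lia.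
  by move: w0; set u := \sum_(i < N | i != j) _; lia.
apply: affineP => [|j]; last by rewrite l0 ffunE.
apply: (can_inj invgK); rewrite invg1; apply: perm_incr => i j ij.
have := (cone_mono cwX ij).1; rewrite !ffunE !l0 !mulr0 !addr0 => h.
case: ltngtP => // h1.
  by have := lt_trans h (cone_mono cX h1).1; rewrite ltxx.
by rewrite (val_inj h1) ltxx in h.
Qed.

Definition lamC w X := lamJ full w X.

(** The coefficient of each Z is an alternating sum over the sets J between the far
    walls of w and the positive walls of Z, two sets that differ by [far_pos]. *)
Lemma alt_local R w X : good R X -> W0 w ->
  \sum_(J : {set 'I_N} | partial J && (far R w \subset J)) (-1) ^+ #|J| * lamJ J w X =
  (-1) ^+ N.+1 * lamC w X.
Proof.
move=> gR w0; rewrite /lamC /lamJ -fsumZ.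
under eq_bigr do rewrite -fsumZ.
rewrite -fsum_sum; last first.
  move=> J _; apply: finZ; exists (Zlist (tot Y) w X) => Z /lamJ_in[] //.
apply: eq_fsum => Z.
have [h0|] := eqVneq (lam Z * k w Z X) 0.
  rewrite -mulrA h0 !mulr0 big1 // => J _; by rewrite -mulrA h0 !mulr0.
rewrite mulf_eq0 negb_or => /andP[/lam_tot hZ hk].
have := alt_sum_partial (far_pos gR w0 hk hZ) => E.
rewrite coneE -mulrA mulrA -E mulr_suml; apply: eq_bigr => J _.
by rewrite coneE !mulrA.
Qed.

Definition cnt R J : K := fsum (fun w => (W0 w && (far R w \subset J))%:R).
Definition nstab J : K := fsum (fun v => (stab J v)%:R).

Lemma nstab_neq0 J : partial J -> nstab J != 0.
Proof.
move=> pJ; rewrite /nstab (@fsum_undup _ _ (wlist 1)); last first.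
  by move=> v; case sv : (stab J v); rewrite ?eqxx // => _; exact: stab_wlist sv.
rewrite -natr_sum pnatr_eq0 -lt0n.
have h1 : onew \in undup (wlist 1 : seq (@affine N)).
  by rewrite mem_undup; apply: (@stab_wlist J) => //; exact: stab_one.
by rewrite (big_rem onew) //= stab_one.
Qed.

(** The walls far from w are contained in J or not for a whole coset of the
    stabiliser at once, and [lamJ] sums to [lam] over a coset. *)
Lemma coset_sum R J X : partial J ->
  nstab J * fsum (fun w => (W0 w && (far R w \subset J))%:R * lamJ J w X) =
  cnt R J * lam X.
Proof.
move=> pJ; rewrite /cnt -fsumZr /nstab -fsumZr.
transitivity (fsum (fun w => fsum (fun v => (W0 w && (far R w \subset J))%:R *
    ((stab J v)%:R * lamJ J (mulw v w) X)))); last first.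
  apply: eq_fsum => w; rewrite fsumZ; case w0 : (W0 w); last by rewrite !mul0r.
  by rewrite -lam_sumJ.
rewrite fsum_exch; last first.
  exists (wlist (`|R| + 1)), (wlist 1) => w v.
  case hw : (W0 w && (far R w \subset J)); last by rewrite mul0r eqxx.
  case sv : (stab J v); last by rewrite mul0r mulr0 eqxx.
  case/andP: hw => _ hw _; split; last exact: stab_wlist sv.
  exact: far_finite hw.
apply: eq_fsum => v; case sv : (stab J v); last first.
  by rewrite mul0r; apply/esym/fsum_eq0 => w; rewrite mul0r mulr0.
rewrite mul1r -(fsum_bij _ (mulw_bijl v)); apply: eq_fsum => w.
by rewrite mul1r far_stab // W0_mull //; exact: stab_W0 sv.
Qed.

(** An Euler characteristic: it counts the cosets of the proper parabolic subgroups
    within distance R, with signs. Its value is found by taking X = Y. *)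
Definition chi R : K :=
  \sum_(J : {set 'I_N} | partial J) (-1) ^+ #|J| * (cnt R J / nstab J).

(** Summation of [alt_local] over the group, one set of walls at a time. *)
Lemma alt_global R X : good R X ->
  fsum (fun w => (W0 w)%:R * ((-1) ^+ N.+1 * lamC w X)) = chi R * lam X.
Proof.
move=> gR; rewrite /chi mulr_suml.
transitivity (\sum_(J : {set 'I_N} | partial J) fsum (fun w =>
    (-1) ^+ #|J| * ((W0 w && (far R w \subset J))%:R * lamJ J w X))).
  rewrite -fsum_sum; last first.
    move=> J pJ; apply: finZ; exists (wlist (`|R| + 1)) => w /mulb_neq0[/andP[_ h] _].
    exact: far_finite h.
  apply: eq_fsum => w; case w0 : (W0 w); last first.
    by rewrite mul0r big1 // => J _; rewrite mul0r mulr0.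
  rewrite mul1r -(alt_local gR w0) big_mkcondr; apply: eq_bigr => J _.
  by case: (far R w \subset J); rewrite ?mul1r // mul0r mulr0.
apply: eq_bigr => J pJ; rewrite fsumZ -mulrA; congr (_ * _).
have n0 := nstab_neq0 pJ; apply: (mulfI n0); rewrite coset_sum //.
by field.
Qed.

Hypothesis cY : cone full Y.

Lemma lam_base : lam Y = 1.
Proof.
rewrite /lam (@fsum_single _ _ onew).
  have := k_lead onew Y; rewrite act_one => ->.
  by rewrite W0_one odd_perm1 expr0 mulr1.
move=> w /mulb_neq0[w0 hk]; have E := k_top w0 hk (lexx _).
by apply: (cone_free (X := Y)) => //; rewrite -E.
Qed.

Lemma lamC_base : fsum (fun w => (W0 w)%:R * lamC w Y) = 1.
Proof.
have h w : (W0 w)%:R * lamC w Y != 0 -> w = onew.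
  move=> /mulb_neq0[w0 /fsum_ne0[Z /lamJ_in[cZ tZ hk _]]].
  have E := k_top w0 hk tZ.
  by apply: (cone_free (X := Y)) => //; rewrite -E.
rewrite (fsum_single h) W0_one mul1r /lamC /lamJ (@fsum_single _ _ Y).
  have := k_lead onew Y; rewrite act_one => ->.
  by rewrite cY lam_base odd_perm1 expr0 !mulr1.
move=> Z /lamJ_in[cZ tZ hk _].
by have := k_top W0_one hk tZ; rewrite act_one.
Qed.

(** The constant of [alt_global] does not depend on X, and both sides are 1 at
    X = Y. *)
Lemma lamC_sum X : fsum (fun w => (W0 w)%:R * lamC w X) = lam X.
Proof.
have [R1 R10 h1] := good_ex X; have [R2 R20 h2] := good_ex Y.
have g1 := h1 (R1 + R2) (ler_wpDr R20 (lexx _)).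
have g2 := h2 (R1 + R2) (ler_wpDl R10 (lexx _)).
have E (X' : expo) : fsum (fun w => (W0 w)%:R * ((-1) ^+ N.+1 * lamC w X')) =
    (-1) ^+ N.+1 * fsum (fun w => (W0 w)%:R * lamC w X').
  by rewrite -fsumZ; apply: eq_fsum => w; rewrite mulrCA.
have := alt_global g1; rewrite E.
have := alt_global g2; rewrite E lamC_base lam_base !mulr1 => <- /mulfI; apply.
by rewrite signr_eq0.
Qed.

(** By [lamC_sum] the difference between [lam] and the indicator satisfies a
    homogeneous triangular system on the alcove, so it vanishes by downward induction
    on the total degree. *)
Theorem lam_delta X : cone full X -> lam X = (X == Y)%:R.
Proof.
pose d Z := lam Z - (Z == Y)%:R.
suff H : forall n X, tot Y - tot X < n%:Z -> cone full X -> d X = 0.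
  move=> cX; apply/eqP; rewrite -subr_eq0; apply/eqP.
  by apply: (H (`|tot Y - tot X|).+1) => //; lia.
have dtot Z : d Z != 0 -> tot Z <= tot Y.
  rewrite leNgt => h; apply/negP => h'; move/eqP: h; apply.
  rewrite /d; case: eqP => [e|_]; first by rewrite e ltxx in h'.
  by rewrite subr0; apply/eqP/negPn/negP => /lam_tot; lia.
elim=> [|n IH] {}X hn cX.
  by apply/eqP/negPn/negP => /dtot; lia.
have hk : fsum (fun w => (W0 w)%:R * fsum (fun Z => (cone full Z)%:R * d Z * k w Z X)) = 0.
  transitivity (fsum (fun w => (W0 w)%:R * lamC w X - (W0 w)%:R * k w Y X)).
    apply: eq_fsum => w; rewrite -mulrBr; congr (_ * _).
    rewrite /lamC /lamJ.
    have -> : k w Y X = fsum (fun Z => (cone full Z)%:R * (Z == Y)%:R * k w Z X).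
      rewrite (@fsum_single _ _ Y) ?cY ?eqxx ?mul1r //.
      by move=> Z; case: (Z =P Y) => //= _; rewrite mulr0 mul0r eqxx.
    rewrite -fsumB.
    - by apply: eq_fsum => Z; rewrite /d mulrBr mulrBl.
    - by exists (Zlist (tot Y) w X) => Z /lamJ_in[].
    - by exists [:: Y] => Z; case: (Z =P Y) => [->|_]; rewrite ?mem_seq1 //= mulr0 mul0r eqxx.
  rewrite fsumB; [by rewrite lamC_sum subrr| |exact: finW].
  have [R1 _ h1] := good_ex X; have gR := h1 R1 (lexx _).
  have s0 : (-1) ^+ N.+1 != 0 :> K by rewrite signr_eq0.
  exists (flatten [seq (if partial J then wlist (`|R1| + 1) else [::])
     | J : {set 'I_N}]) => w /mulb_neq0[w0 hw].
  have : \sum_(J : {set 'I_N} | partial J && (far R1 w \subset J))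
     (-1) ^+ #|J| * lamJ J w X != 0 by rewrite alt_local // mulf_neq0.
  move=> hs; have [J /andP[pJ fJ]] : exists J, partial J && (far R1 w \subset J).
    apply/existsP; rewrite -[X in is_true X]negbK negb_exists; apply/negP => /forallP hn'.
    move/eqP: hs; apply; apply: big1 => J hJ; by have := hn' J; rewrite hJ.
  apply/flatten_mapP; exists J; first by rewrite mem_enum.
  by rewrite pJ; exact: far_finite fJ.
(* Larger total degrees are covered by the induction; in equal degree Z is the
   image of X, and the action on the alcove is free. *)
have key w Z : W0 w -> (cone full Z)%:R * d Z * k w Z X != 0 -> w = onew /\ Z = X.
  move=> w0; rewrite mulf_eq0 negb_or => /andP[/mulb_neq0[cZ dZ] hw].
  have tZ : tot Z <= tot X.
    rewrite leNgt; apply/negP => h; move/eqP: dZ; apply.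
    by apply: IH => //; lia.
  have E := k_top w0 hw tZ.
  have w1 : w = onew by apply: (cone_free (X := X)) => //; rewrite -E.
  by rewrite E w1 act_one.
move: hk; rewrite (@fsum_single _ _ onew); last first.
  by move=> w /mulb_neq0[w0 /fsum_ne0[Z /(key _ _ w0)[]]].
rewrite W0_one mul1r (@fsum_single _ _ X); last first.
  by move=> Z /(key _ _ W0_one)[].
have := k_lead onew X; rewrite act_one => ->.
by rewrite cX mul1r odd_perm1 expr0 mulr1.
Qed.

End Euler.

(** * The action on functions of the spectral variables *)

Section Star.
Context {R : realType} {N : nat}.
Variables (L : nat) (p q r : R).
Hypotheses (p0 : 0 < p) (q0 : 0 < q) (adm : admissible_radius p q r).
Local Notation expo := {ffun 'I_N -> int}.
Local Notation b := (bethe p q).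
Implicit Types (v w : @affine N) (X Z B : expo).
Let r0 : 0 < r := adm_r0 adm.

(** Exponents of the Bethe factors in the product of A and D for w. They only
    involve differences of l and inversions of s, and form a cocycle ([nij_mul]). *)
Definition nij w (i j : 'I_N) : int :=
  w.2 i - w.2 j + (w.1^-1 j < w.1^-1 i)%g%N%:Z - (j < i)%N%:Z.

Definition amp (e : 'I_N -> 'I_N -> int) (xi : 'I_N -> R[i]) : R[i] :=
  \prod_(i < N) \prod_(j < N) b (xi i) (xi j) ^ e i j.

Definition Acoef w (xi : 'I_N -> R[i]) : R[i] :=
  (-1) ^+ (w.1 : 'S_N) * amp (fun i j => - nij w i j) xi.

Definition trans w : expo := [ffun j => L%:Z * w.2 j].

(** A term of the formula as an operator; by [star_mul] these operators form an
    action of the affine group. *)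
Definition star w (g : ('I_N -> R[i]) -> R[i]) (xi : 'I_N -> R[i]) : R[i] :=
  Acoef w xi * mono (trans w) xi * g (fun i => xi (w.1 i)).

Lemma ampD e e' xi : onT r xi -> amp (fun i j => e i j + e' i j) xi = amp e xi * amp e' xi.
Proof.
move=> h; rewrite /amp -big_split /=; apply: eq_bigr => i _.
rewrite -big_split /=; apply: eq_bigr => j _.
by rewrite exprzDr // unitfE (bethe_neq0 adm).
Qed.

Lemma amp_perm e (s : 'S_N) xi :
  amp e (fun i => xi (s i)) = amp (fun i j => e ((s^-1)%g i) ((s^-1)%g j)) xi.
Proof.
rewrite /amp [RHS](reindex_inj (@perm_inj _ s)); apply: eq_bigr => i _ /=.
rewrite [RHS](reindex_inj (@perm_inj _ s)); apply: eq_bigr => j _ /=.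
by rewrite !permK.
Qed.

Lemma amp_eq e e' xi : (forall i j, e i j = e' i j) -> amp e xi = amp e' xi.
Proof.
by move=> h; apply: eq_bigr => i _; apply: eq_bigr => j _; rewrite h.
Qed.

Lemma nij_mul v w i j :
  nij (mulw v w) i j = nij v i j + nij w ((v.1^-1)%g i) ((v.1^-1)%g j).
Proof. by rewrite /nij /= !ffunE !invMg !permM; ring. Qed.

Lemma star_mul v w g xi : onT r xi -> star (mulw v w) g xi = star v (star w g) xi.
Proof.
move=> h; rewrite /star /Acoef /= odd_permM.
have -> : amp (fun i j => - nij (mulw v w) i j) xi =
    amp (fun i j => - nij v i j) xi * amp (fun i j => - nij w i j) (fun i => xi (v.1 i)).
  rewrite amp_perm -ampD //; apply: amp_eq => i j; rewrite nij_mul; ring.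
have -> : mono (trans (mulw v w)) xi = mono (trans v) xi * mono (trans w) (fun i => xi (v.1 i)).
  rewrite mono_perm -(monoD r0) //; congr mono; apply/ffunP => j; rewrite !ffunE /=; ring.
rewrite signr_addb.
have -> : (fun i => xi ((w.1 * v.1)%g i)) = (fun i => xi (v.1 (w.1 i))).
  by apply/funext => i; rewrite permM.
set a1 := amp _ xi; set a2 := amp _ _; set m1 := mono _ xi; set m2 := mono _ _.
set g1 := g _; set s1 := (-1) ^+ v.1; set s2 := (-1) ^+ w.1.
by move: a1 a2 m1 m2 g1 s1 s2 => a1 a2 m1 m2 g1 s1 s2; ring.
Qed.

Definition Qnn (m : expo) := forall i, 0 <= m i.
Definition Qge B (m : expo) := forall i, B i <= m i.
Definition Qpos (m : expo) := Qnn m /\ exists i, 0 < m i.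

Lemma Qnn_add : addclosed Qnn.
Proof.
split=> [i|a c ha hc i]; rewrite ffunE //.
by rewrite addr_ge0.
Qed.

Lemma Qnn_unit i : Qnn (unitm i).
Proof. by move=> j; rewrite ffunE. Qed.

Lemma QposM a c : Qpos a -> Qnn c -> Qpos (a + c).
Proof.
move=> [ha [i hi]] hc; split; first exact: Qnn_add.2.
by exists i; rewrite ffunE ltr_wpDr.
Qed.

Lemma appr_betheX (Q : expo -> Prop) i j (z : int) : addclosed Q ->
  Q (unitm i) -> Q (unitm i + unitm j) ->
  appr r Q (fun xi => b (xi i) (xi j) ^ z).
Proof.
move=> Qa Qi Qij; case: z => n.
  by apply: (apprX r0) => //; exact: appr_bethe.
apply: (appr_ext (g := fun xi => (b (xi i) (xi j))^-1 ^+ n.+1)).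
  by move=> xi _; rewrite NegzE -exprnN exprVn.
by apply: (apprX r0) => //; exact: appr_betheV.
Qed.

Lemma appr_amp e : appr r Qnn (amp e).
Proof.
apply: (appr_prod r0) => [|i _]; first exact: Qnn_add.
apply: (appr_prod r0) => [|j _]; first exact: Qnn_add.
apply: appr_betheX; [exact: Qnn_add|exact: Qnn_unit|].
by apply: Qnn_add.2; exact: Qnn_unit.
Qed.

Lemma appr_Acoef w : appr r Qnn (Acoef w).
Proof. by apply: (apprZ r0); exact: appr_amp. Qed.

Lemma appr_Amono w : appr r (Qge (trans w)) (fun xi => Acoef w xi * mono (trans w) xi).
Proof.
have am : appr r (Qge (trans w)) (mono (trans w)) by apply: appr_mono => i.
apply: (apprM r0 _ (appr_Acoef w) am).
by move=> a c ha hc i; rewrite [(a + c) i]ffunE ler_wpDl.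
Qed.

Lemma appr_star w B g : appr r (Qge B) g -> appr r (Qge (wact L w B)) (star w g).
Proof.
move=> ga.
apply: (apprM r0 _ (appr_Amono w) (@appr_perm _ _ _ w.1 (Qge B) (Qge (rexp w.1^-1 B)) _ _ ga)).
  move=> a c ha hc i; have := ha i; have := hc i; rewrite !ffunE => h1 h2.
  by rewrite addrC lerD.
by move=> m h i; rewrite !ffunE.
Qed.

(** The matrix of [star] in the basis of monomials. *)
Definition ker w Z X : R[i] := coef r Z (star w (mono X)).

Lemma star_mono w X xi : onT r xi -> star w (mono X) xi = Acoef w xi * mono (wact L w X) xi.
Proof.
move=> h; rewrite /star mono_perm -mulrA -(monoD r0) //; congr (_ * mono _ _).
by apply/ffunP => i; rewrite !ffunE addrC.
Qed.

Lemma appr_star_mono w X : appr r (Qge (wact L w X)) (star w (mono X)).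
Proof. by apply: appr_star; apply: appr_mono => i. Qed.

(** The amplitude is a power series, so exponents only increase from those of the
    leading monomial. *)
Lemma ker_ge w Z X : ker w Z X != 0 -> forall i, wact L w X i <= Z i.
Proof.
apply: contra_neqP => h; apply: (coef_eq0 r0 (appr_star_mono w X)) => h'.
by apply: h => i; exact: h'.
Qed.

(** Having the constant term c in the expansion at the origin. *)
Definition hasc (c : R[i]) (g : ('I_N -> R[i]) -> R[i]) :=
  appr r Qnn g /\ appr r Qpos (fun xi => g xi - c).

Lemma hasc_cst c : hasc c (fun=> c).
Proof.
split; first by apply: appr_cst; exact: Qnn_add.1.
by apply: (appr_ext (g := ev [::])) => [xi _|]; rewrite ?subrr /ev ?big_nil //; apply: appr_ev.
Qed.

Lemma hascM c d g h : hasc c g -> hasc d h -> hasc (c * d) (fun xi => g xi * h xi).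
Proof.
move=> [g1 g2] [h1 h2]; split.
  exact: (apprM r0 Qnn_add.2 g1 h1).
apply: (appr_ext (g := fun xi => (g xi - c) * h xi + c * (h xi - d))).
  by move=> xi _; ring.
apply: apprD; first exact: (apprM r0 QposM g2 h1).
exact: (apprZ r0).
Qed.

Lemma hasc_prod (I : Type) (s : seq I) (c : I -> R[i]) (g : I -> ('I_N -> R[i]) -> R[i]) :
  (forall i, hasc (c i) (g i)) -> hasc (\prod_(i <- s) c i) (fun xi => \prod_(i <- s) g i xi).
Proof.
move=> h; elim: s => [|i s IH].
  rewrite big_nil (_ : (fun xi => _) = fun=> 1); first exact: hasc_cst.
  by apply/funext => xi; rewrite big_nil.
rewrite big_cons (_ : (fun xi => _) = fun xi => g i xi * \prod_(i <- s) g i xi).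
  exact: hascM.
by apply/funext => xi; rewrite big_cons.
Qed.

Lemma pC_neq0 : p%:C != 0 :> R[i].
Proof. by rewrite fmorph_eq0 gt_eqF. Qed.

Lemma hasc_bethe i j : hasc (p%:C) (fun xi => b (xi i) (xi j)).
Proof.
have uij := Qnn_add.2 _ _ (Qnn_unit i) (Qnn_unit j).
split; first by apply: appr_bethe => //; [exact: Qnn_add|exact: Qnn_unit].
have pu : Qpos (unitm i) by split; [exact: Qnn_unit|exists i; rewrite ffunE eqxx].
apply: (appr_ext (g := fun xi => q%:C * mono (unitm i + unitm j) xi + -1 * mono (unitm i) xi)).
  by move=> xi h; rewrite (monoD r0) // !mono_unitm /bethe; ring.
apply: apprD; apply: (apprZ r0); apply: appr_mono => //.
apply: QposM => //; exact: Qnn_unit.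
Qed.

Lemma hasc_betheV i j : hasc (p%:C)^-1 (fun xi => (b (xi i) (xi j))^-1).
Proof.
have uij := Qnn_add.2 _ _ (Qnn_unit i) (Qnn_unit j).
have ba : appr r Qnn (fun xi => (b (xi i) (xi j))^-1).
  by apply: appr_betheV => //; [exact: Qnn_add|exact: Qnn_unit].
split => //.
apply: (appr_ext (g := fun xi => - (p%:C)^-1 * ((b (xi i) (xi j) - p%:C) * (b (xi i) (xi j))^-1))).
  move=> xi h; have b0 := bethe_neq0 adm i j h; have p0' := pC_neq0; by field; apply/andP.
apply: (apprZ r0); exact: (apprM r0 QposM (hasc_bethe i j).2 ba).
Qed.

Lemma hasc_betheX i j (z : int) : hasc (p%:C ^ z) (fun xi => b (xi i) (xi j) ^ z).
Proof.
case: z => n.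
  elim: n => [|n IH]; first exact: hasc_cst.
  rewrite (_ : (fun xi => _) = fun xi => b (xi i) (xi j) * b (xi i) (xi j) ^ n%:Z).
    by rewrite [p%:C ^ _]exprS; apply: hascM => //; exact: hasc_bethe.
  by apply/funext => xi; rewrite -exprS.
elim: n => [|n IH].
  rewrite (_ : (fun xi => _) = fun xi => (b (xi i) (xi j))^-1).
    by rewrite /exprz expr1; exact: hasc_betheV.
  by apply/funext => xi; rewrite /exprz expr1.
rewrite (_ : (fun xi => _) = fun xi => (b (xi i) (xi j))^-1 * b (xi i) (xi j) ^ Negz n).
  have -> : p%:C ^ Negz n.+1 = (p%:C)^-1 * p%:C ^ Negz n :> R[i].
    by rewrite /exprz -!exprVn exprS.
  by apply: hascM => //; exact: hasc_betheV.
by apply/funext => xi; rewrite /exprz -!exprVn exprS.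
Qed.

Lemma nij_anti w i j : nij w i j + nij w j i = 0.
Proof.
rewrite /nij.
have h (x y : 'I_N) : (x < y)%N%:Z + (y < x)%N%:Z = (x != y)%:Z.
  by rewrite -val_eqE /=; case: ltngtP.
have := h j i; have := h (w.1^-1%g i) (w.1^-1%g j) .
rewrite (inj_eq perm_inj) (eq_sym j i) => h1 h2.
move: h1 h2; move: (i < j)%N%:Z (j < i)%N%:Z ((w.1^-1)%g i < _)%N%:Z ((w.1^-1)%g j < _)%N%:Z => a b' c d.
by move: (w.2 i) (w.2 j) (i != j)%:Z => x y z; lia.
Qed.

(** The exponents are antisymmetric, so the powers of p cancel. *)
Lemma amp_const w : \prod_(i < N) \prod_(j < N) (p%:C ^ (- nij w i j)) = 1 :> R[i].
Proof.
have pu : p%:C \is a @GRing.unit R[i] by rewrite unitfE pC_neq0.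
have E (I : finType) (f : I -> int) : \prod_i p%:C ^ f i = p%:C ^ (\sum_i f i) :> R[i].
  elim: (index_enum I) => [|i s IH]; first by rewrite !big_nil expr0z.
  by rewrite !big_cons IH exprzDr.
under eq_bigr do rewrite E.
rewrite E.
have -> : \sum_i \sum_j - nij w i j = 0 :> int; last by rewrite expr0z.
set S := \sum_i _.
have : S + S = 0.
  rewrite {2}/S exchange_big /= /S -big_split /= big1 // => i _.
  by rewrite -big_split /= big1 // => j _; rewrite -opprD nij_anti oppr0.
by lia.
Qed.

Lemma hasc_Acoef w : hasc ((-1) ^+ (w.1 : 'S_N)) (Acoef w).
Proof.
have h : hasc 1 (amp (fun i j => - nij w i j)).
  rewrite -(amp_const w); apply: hasc_prod => i; apply: hasc_prod => j.
  exact: hasc_betheX.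
rewrite -[X in hasc X]mulr1; exact: (hascM (hasc_cst _) h).
Qed.

(** At the origin every Bethe factor equals p. *)
Lemma ker_lead w X : ker w (wact L w X) X = (-1) ^+ (w.1 : 'S_N).
Proof.
have [_ h2] := hasc_Acoef w.
set c := (-1) ^+ _ in h2 *; set m := wact L w X.
have a1 : appr r (Qge m) (fun xi => c * mono m xi) by apply: (apprZ r0); apply: appr_mono.
have a2 : appr r (fun k => Qge m k /\ k <> m) (fun xi => (Acoef w xi - c) * mono m xi).
  apply: (apprM r0 _ h2 (appr_mono _ (Q := fun k => k = m) (erefl m))).
  move=> a k [ha [i hi]] ->; split; first by move=> j; rewrite [(a + m) j]ffunE ler_wpDl.
  move/ffunP/(_ i)/eqP; rewrite [(a + m) i]ffunE -subr_eq0 addrK => /eqP h.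
  by rewrite h ltxx in hi.
rewrite /ker.
have -> : coef r m (star w (mono X)) =
    coef r m (fun xi => c * mono m xi + (Acoef w xi - c) * mono m xi).
  apply: (coef_ext r0 _ (appr_star_mono w X)) => xi h.
  by rewrite star_mono //; ring.
rewrite (@coefD _ _ r0 _ _ (Qge m)) //; last by apply: appr_weak a2 => k [].
rewrite (coefZ r0 _ _ (appr_mono _ (m := m) (Q := Qge m) (fun i => lexx _))).
rewrite (coef_mono r0) eqxx mulr1 (coef_eq0 r0 a2) ?addr0 //.
by move=> [].
Qed.

Lemma coefB (Z : expo) Q g h : appr r Q g -> appr r Q h ->
  coef r Z (fun xi => g xi - h xi) = coef r Z g - coef r Z h.
Proof.
move=> ga ha; have ha' := apprZ r0 (-1) ha.
rewrite -[X in _ = _ + X]mulN1r -(coefZ r0 _ _ ha) -(coefD r0 _ ga ha').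
by apply: (@coef_ext _ _ r0 _ _ Q) => [|xi _]; rewrite ?mulN1r //;
  apply: appr_ext (apprD ga ha') => xi _; rewrite mulN1r.
Qed.

Definition kbox v Z B : seq expo :=
  box (\sum_i `|(Z (v.1 i) - L%:Z * v.2 (v.1 i) - B i)%R|%N).+1 B.

Lemma kboxP v Z B Z' : Qge B Z' -> ker v Z Z' != 0 -> Z' \in kbox v Z B.
Proof.
move=> hB /ker_ge h; apply: boxP => i; rewrite (hB i) /=.
have := h (v.1 i); rewrite ffunE permK.
have : (`|(Z (v.1 i) - L%:Z * v.2 (v.1 i) - B i)%R|%N <=
  \sum_i `|(Z (v.1 i) - L%:Z * v.2 (v.1 i) - B i)%R|%N)%N by rewrite (bigD1 i) //= leq_addr.
have := hB i; move: (L%:Z * _) (Z (v.1 i)) (\sum_i _)%N => u z s; lia.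
Qed.

(** Only finitely many exponents Z' matter: Z bounds them above because the action
    does not lower exponents, B bounds them below. *)
Lemma coef_star v Z B g : appr r (Qge B) g ->
  coef r Z (star v g) = fsum (fun Z' => ker v Z Z' * coef r Z' g).
Proof.
move=> ga; pose S := undup (kbox v Z B).
rewrite (@fsum_undup _ _ (kbox v Z B)); last first.
  move=> Z'; rewrite mulf_eq0 negb_or => /andP[hk hg].
  apply: kboxP => // i.
  have : Qge B Z' by apply: contrapT => hn; rewrite (coef_eq0 r0 ga hn) eqxx in hg.
  exact.
have [M M0 hM] := appr_bnd r0 (appr_Amono v).
apply/eqP; rewrite -subr_eq0; apply/eqP.
pose K := kcoef r Z * M + \sum_(Z' <- S) nm (ker v Z Z') * kcoef r Z'.
apply: (@nm_eps _ _ K) => e e0.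
have [P [hQ hP]] := ga _ e0.
have sP : appr r (Qge B) (ev P) by apply: appr_ev.
have E1 : coef r Z (star v (ev P)) = \sum_(t <- P) t.1 * ker v Z t.2.
  transitivity (coef r Z (fun xi => \sum_(t <- P) t.1 * star v (mono t.2) xi)).
    apply: (coef_ext r0 _ (appr_star v sP)) => xi hxi.
    by rewrite /star /ev mulr_sumr; apply: eq_bigr => t _; ring.
  rewrite (@coef_sum _ _ r0 _ _ (@anyexp N)); last first.
    by move=> t _; apply: (apprZ r0); exact: appr_any (appr_star_mono _ _).
  by apply: eq_bigr => t _; rewrite (coefZ r0 _ _ (appr_star_mono _ _)).
have E2 : \sum_(t <- P) t.1 * ker v Z t.2 = \sum_(Z' <- S) ker v Z Z' * coefP Z' P.
  under [RHS]eq_bigr do rewrite /coefP big_mkcond mulr_sumr.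
  rewrite exchange_big /=; rewrite big_seq_cond [RHS]big_seq_cond; apply: eq_bigr => t.
  rewrite andbT => tP.
  have [k0|hk] := eqVneq (ker v Z t.2) 0.
    rewrite k0 mulr0 big1 // => Z' _; case: eqP => [<-|]; rewrite ?mulr0 //.
    by rewrite k0 mul0r.
  have tS : t.2 \in S by rewrite mem_undup; apply: kboxP => //; exact: hQ.
  rewrite (bigD1_seq t.2) ?undup_uniq //= eqxx big1 ?addr0 1?mulrC //.
  by move=> Z' /negPf; rewrite eq_sym => ->; rewrite mulr0.
have D1 : nm (coef r Z (star v g) - coef r Z (star v (ev P))) <= kcoef r Z * (M * e).
  rewrite -(coefB _ (appr_star v ga) (appr_star v sP)).
  apply: (@coef_bnd _ _ r0 _ _ (Qge (wact L v B))).
    apply: (appr_ext (g := fun xi => star v g xi + -1 * star v (ev P) xi)).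
      by move=> xi _; rewrite mulN1r.
    by apply: apprD; [exact: appr_star|apply: (apprZ r0); exact: appr_star].
  move=> xi hxi; rewrite /star -mulrBr nmM; apply: ler_pM; rewrite ?nm_ge0 ?hM //.
  by apply: hP; exact: onT_perm.
have D2 : nm (\sum_(Z' <- S) ker v Z Z' * coef r Z' g - \sum_(Z' <- S) ker v Z Z' * coefP Z' P)
    <= (\sum_(Z' <- S) nm (ker v Z Z') * kcoef r Z') * e.
  rewrite -sumrB mulr_suml; apply: le_trans (nm_sum _ _ _) _; apply: ler_sum => Z' _.
  rewrite -mulrBr nmM -mulrA; apply: ler_wpM2l; first exact: nm_ge0.
  exact: (coef_close r0 _ ga).
have -> : coef r Z (star v g) - \sum_(Z' <- S) ker v Z Z' * coef r Z' g =
  (coef r Z (star v g) - coef r Z (star v (ev P))) -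
  (\sum_(Z' <- S) ker v Z Z' * coef r Z' g - \sum_(Z' <- S) ker v Z Z' * coefP Z' P).
  by rewrite E1 E2; ring.
by apply: le_trans (nmB _ _) _; rewrite /K mulrDl -(mulrA (kcoef r Z)) lerD.
Qed.

Lemma ker_mul v w Z X :
  ker (mulw v w) Z X = fsum (fun Z' => ker v Z Z' * ker w Z' X).
Proof.
rewrite -(coef_star _ _ (appr_star_mono w X)); apply: (coef_ext r0 _ (appr_star_mono (mulw v w) X)).
by move=> xi h; exact: star_mul.
Qed.

End Star.

(** * Cancellation over the stabiliser of a face *)

Section Alternation.
Context {K : numFieldType} {N : nat}.
Variable P : {set 'I_N}.
Implicit Types (h : 'I_N -> 'I_N -> K).

(** A determinant restricted to the rows and columns in P. *)
Definition altsum h : K :=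
  \sum_(tau : 'S_N | perm_on P tau) (-1) ^+ tau * \prod_(i in P) h i (tau i).

Lemma altsum_ext h h' : (forall i j, i \in P -> j \in P -> h i j = h' i j) ->
  altsum h = altsum h'.
Proof.
move=> e; apply: eq_bigr => tau ht; congr (_ * _); apply: eq_bigr => i iP.
by apply: e; rewrite ?perm_closed.
Qed.

(** The transposition of two equal rows changes the sign. *)
Lemma altsum_eq0 h i0 j0 : i0 \in P -> j0 \in P -> i0 != j0 ->
  (forall j, h i0 j = h j0 j) -> altsum h = 0.
Proof.
move=> iP jP ij e.
have tP : perm_on P (tperm i0 j0).
  apply/fintype.subsetP => k; rewrite inE; case: tpermP => [->|->|] //.
  by move=> _ _; rewrite eqxx.
suff : altsum h = - altsum h by move/eqP; rewrite -addr_eq0 -mulr2n mulrn_eq0 => /eqP.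
rewrite {1}/altsum (reindex_inj (mulgI (tperm i0 j0))) /altsum -sumrN /=.
apply: eq_big => [tau|tau _].
  apply/idP/idP => ht; last exact: perm_onM.
  by rewrite -[tau](mulKg (tperm i0 j0)) tpermV; exact: perm_onM.
rewrite odd_permM odd_tperm ij signr_addb expr1 mulN1r -mulNr; congr (_ * _).
rewrite (reindex_inj (@perm_inj _ (tperm i0 j0))) /=.
apply: eq_big => [k|k _]; first by rewrite perm_closed.
by rewrite permM tpermK; case: tpermP => [->|->|//]; rewrite e.
Qed.

Lemma altsum_row h i0 j0 c : i0 \in P -> j0 \in P -> i0 != j0 ->
  altsum (fun i j => if i == i0 then h i0 j - c * h j0 j else h i j) = altsum h.
Proof.
move=> iP jP ij.
have e0 : altsum (fun i j => if i == i0 then h j0 j else h i j) = 0.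
  by apply: (altsum_eq0 iP jP ij) => j; rewrite eqxx eq_sym (negPf ij).
apply/eqP; rewrite -subr_eq0 -[X in X == _]addr0 -[X in _ + X == _](mulr0 c).
rewrite -[X in c * X]e0 /altsum mulr_sumr -sumrB -big_split /= big1 // => tau _.
rewrite !(bigD1 i0 iP) /= eqxx.
rewrite (eq_bigr (fun i => h i (tau i))) => [|i /andP[_ /negPf ->] //].
rewrite [X in c * (_ * (_ * X))](eq_bigr (fun i => h i (tau i))) => [|i /andP[_ /negPf ->] //].
set e := (-1) ^+ _; set a1 := h i0 _; set a2 := h j0 _; set a3 := \prod_(i < N | _) _.
by move: e a1 a2 a3 => e a1 a2 a3; ring.
Qed.

(** Row operations, from smaller to larger weight: the last row to be modified is
    reduced against a row outside S, which is still the original one. *)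
Lemma altsum_reduce h (mu : 'I_N -> int) (c : 'I_N -> K) (nx : 'I_N -> 'I_N) (S : {set 'I_N}) :
  S \subset P -> (forall i, i \in S -> nx i \in P /\ mu i < mu (nx i)) ->
  altsum (fun i j => if i \in S then h i j - c i * h (nx i) j else h i j) = altsum h.
Proof.
have [k] := ubnP #|S|; elim: k S => // k IH S hk SP hS.
have [->|[i0 i0S]] := set_0Vmem S.
  by apply: altsum_ext => i j _ _; rewrite inE.
have [i iS hi] : exists2 i, i \in S & forall j, j \in S -> mu j <= mu i.
  by case: (arg_maxP mu i0S) => i iS hi; exists i.
have [nP hlt] := hS i iS.
have iP : i \in P by apply: (fintype.subsetP SP).
have ni : i != nx i by apply: contraTneq hlt => <-; rewrite ltxx.
have nS : nx i \notin S by apply/negP => /hi; rewrite leNgt hlt.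
pose S' := S :\ i.
have <- : altsum (fun i j => if i \in S' then h i j - c i * h (nx i) j else h i j) = altsum h.
  apply: IH.
  - by move: hk; rewrite (cardsD1 i S) iS /S'; lia.
  - by apply: fintype.subset_trans SP; exact: subD1set.
  - by move=> j; rewrite !inE => /andP[_]; exact: hS.
rewrite -[RHS](altsum_row _ (c i) iP nP ni); apply: altsum_ext => a j _ _.
rewrite /S' !inE eqxx /= (negPf nS) andbF.
by case: (eqVneq a i) => [->|] //=; rewrite iS.
Qed.

Variable mu : 'I_N -> int.
Hypothesis mu_inj : {in P &, injective mu}.

(** The element of P of next larger weight. *)
Definition nextup (i : 'I_N) : 'I_N :=
  odflt i [pick j in P | (mu i < mu j) && [forall k in P, (mu i < mu k) ==> (mu j <= mu k)]].

Lemma nextupP i t : t \in P -> mu i < mu t ->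
  [/\ nextup i \in P, mu i < mu (nextup i) & forall k, k \in P -> mu i < mu k -> mu (nextup i) <= mu k].
Proof.
move=> tP ht; rewrite /nextup; case: pickP => [j /and3P[jP hj /forall_inP h]|hn] /=.
  by split => // k kP; apply/implyP; apply: h.
have h0 : (t \in P) && (mu i < mu t) by rewrite tP ht.
case: (arg_minP (P := [pred j | (j \in P) && (mu i < mu j)]) mu h0) => j /andP[jP hj] hmin.
have := hn j; rewrite jP hj /= => /negP[]; apply/forall_inP => k kP; apply/implyP => hk.
by apply: hmin; rewrite inE kP.
Qed.

(** A telescoping sum, since [nextup] runs through P without its smallest element. *)
Lemma nextup_sum t (a : int) : t \in P -> (forall i, i \in P -> mu i <= mu t) ->
  (forall i, i \in P -> a <= mu i) ->
  \sum_(i in P :\ t) (mu (nextup i) - mu i) <= mu t - a.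
Proof.
move=> tP ht ha.
have lt_t i : i \in P :\ t -> mu i < mu t.
  rewrite !inE => /andP[it iP]; rewrite lt_neqAle ht // andbT.
  by apply: contra_neq it => e; exact: (mu_inj iP tP e).
have inP i : i \in P :\ t -> i \in P by rewrite !inE => /andP[].
have nx i (iP : i \in P :\ t) := nextupP tP (lt_t i iP).
have inj : {in P :\ t &, injective nextup}.
  move=> i j iP jP e; have [n1 l1 m1] := nx i iP; have [n2 l2 m2] := nx j jP.
  apply: (mu_inj (inP i iP) (inP j jP)); apply/eqP; rewrite eq_le !leNgt; apply/andP; split.
    by apply/negP => hh; have := m2 _ (inP i iP) hh; rewrite -e leNgt l1.
  by apply/negP => hh; have := m1 _ (inP j jP) hh; rewrite e leNgt l2.
have [b bP hb] : exists2 b, b \in P & forall j, j \in P -> mu b <= mu j.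
  by case: (arg_minP mu tP) => b bP hb; exists b.
have im : nextup @: (P :\ t) = P :\ b.
  apply/eqP; rewrite eqEcard; apply/andP; split.
    apply/fintype.subsetP => j /imsetP[i iP ->]; have [n1 l1 _] := nx i iP.
    rewrite !inE n1 andbT; apply: contraTneq l1 => ->; rewrite -leNgt; exact/hb/inP.
  rewrite (card_in_imset inj); move: (cardsD1 t P) (cardsD1 b P); rewrite tP bP => e1 e2.
  by rewrite -(leq_add2l 1) -[X in (X <= _)%N]e2 e1.
rewrite sumrB -(big_imset (fun j => mu j) inj) /= im.
have e x : x \in P -> \sum_(i in P) mu i = mu x + \sum_(i in P :\ x) mu i.
  by move=> xP; exact: big_setD1.
have -> : \sum_(j in P :\ b) mu j - \sum_(i in P :\ t) mu i = mu t - mu b.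
  by apply: (addrI (mu b)); rewrite addrA -(e b bP) (e t tP) addrK addrC subrK.
by rewrite lerB // ha.
Qed.

End Alternation.

Section Cancellation.
Context {R : realType} {N : nat}.
Variables (p q r : R).
Hypotheses (p0 : 0 < p) (q0 : 0 < q) (adm : admissible_radius p q r).
Local Notation expo := {ffun 'I_N -> int}.
Local Notation b := (bethe p q).
Implicit Types (X Z mu : expo).
Let r0 : 0 < r := adm_r0 adm.

Variables (n : 'I_N) (P : {set 'I_N}).
Hypothesis nP : n \notin P.

(** Such upper bounds on exponents add up under products. *)
Definition excess (s : 'I_N) (c : int) (k : expo) := k n - k s <= c.

Lemma excessM s c d (g h : ('I_N -> R[i]) -> R[i]) :
  appr r (excess s c) g -> appr r (excess s d) h ->
  appr r (excess s (c + d)) (fun xi => g xi * h xi).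
Proof.
apply: (apprM r0) => a a'; rewrite /excess !ffunE => h1 h2.
by have := lerD h1 h2; congr (_ <= _); ring.
Qed.

Lemma excess_weak s c d (g : ('I_N -> R[i]) -> R[i]) : c <= d ->
  appr r (excess s c) g -> appr r (excess s d) g.
Proof. by move=> cd; apply: appr_weak => m; rewrite /excess => h; exact: le_trans cd. Qed.

Lemma excess_cst s (c : R[i]) : appr r (excess s 0) (fun=> c).
Proof. by apply: appr_cst; rewrite /excess !ffunE subrr. Qed.

Lemma excess_prod (I : Type) (e : seq I) (Q : pred I) s (c : I -> int)
    (g : I -> ('I_N -> R[i]) -> R[i]) :
  (forall i, Q i -> appr r (excess s (c i)) (g i)) ->
  appr r (excess s (\sum_(i <- e | Q i) c i)) (fun xi => \prod_(i <- e | Q i) g i xi).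
Proof.
move=> h; elim: e => [|i e IH].
  rewrite big_nil; apply: (appr_ext (g := fun=> 1)) => [xi _|]; first by rewrite big_nil.
  exact: excess_cst.
rewrite big_cons; case: ifP => Qi.
  apply: (appr_ext (g := fun xi => g i xi * \prod_(i <- e | Q i) g i xi)).
    by move=> xi _; rewrite big_cons Qi.
  by apply: excessM => //; exact: h.
apply: (appr_ext (g := fun xi => \prod_(i <- e | Q i) g i xi)) => // xi _.
by rewrite big_cons Qi.
Qed.

Lemma excess_exp s c (g : ('I_N -> R[i]) -> R[i]) l : appr r (excess s c) g ->
  appr r (excess s (c * l%:Z)) (fun xi => g xi ^+ l).
Proof.
move=> h; elim: l => [|l IH]; first by rewrite mulr0; exact: excess_cst.
apply: (appr_ext (g := fun xi => g xi * g xi ^+ l)) => [xi _|]; first by rewrite exprS.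
by rewrite intS mulrDr mulr1; exact: excessM.
Qed.

Lemma excess_mono s (m : expo) : appr r (excess s (m n - m s)) (mono m).
Proof. by apply: appr_mono; rewrite /excess. Qed.

Lemma excess_pow s j (z : int) : j \in P -> s \in P ->
  appr r (excess s (- (z * (j == s)%:Z))) (fun xi => xi j ^ z).
Proof.
move=> jP sP; pose m : expo := [ffun i => if i == j then z else 0].
apply: (appr_ext (g := mono m)).
  move=> xi _; rewrite /mono (bigD1 j) //= ffunE eqxx big1 ?mulr1 // => i /negPf ij.
  by rewrite ffunE ij.
apply: excess_weak (excess_mono s m); rewrite !ffunE.
have -> : (n == j) = false by apply: contraNF nP => /eqP ->.
by rewrite eq_sym; case: eqP => _; rewrite ?mulr1 ?mulr0 sub0r.
Qed.

Lemma excess_num s j : j \in P -> s \in P ->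
  appr r (excess s 1) (fun xi => b (xi n) (xi j)).
Proof.
move=> jP sP; have nj : (n == j) = false by apply: contraNF nP => /eqP ->.
have sn : (s == n) = false by apply: contraNF nP => /eqP <-.
apply: (appr_ext (g := fun xi => p%:C * mono 0 xi +
   (q%:C * mono (unitm n + unitm j) xi + (-1) * mono (unitm n) xi))).
  by move=> xi h; rewrite mono0 (monoD r0) // !mono_unitm /bethe; ring.
apply: apprD; first by apply: (apprZ r0); apply: appr_mono; rewrite /excess !ffunE.
apply: apprD; apply: (apprZ r0); apply: appr_mono;
  by rewrite /excess !ffunE eqxx ?nj sn; case: (s == j).
Qed.

Lemma excess_den s : s \in P -> appr r (excess s 0) (fun xi => (b (xi s) (xi n))^-1).
Proof.
move=> sP; have sn : (s == n) = false by apply: contraNF nP => /eqP <-.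
apply: appr_betheV => //.
- split; first by rewrite /excess !ffunE.
  move=> a c h1 h2; have := lerD h1 h2; rewrite addr0; apply: le_trans.
  by rewrite !ffunE opprD addrACA.
- by rewrite /excess !ffunE eqxx eq_sym sn.
- by rewrite /excess !ffunE !eqxx sn eq_sym sn.
Qed.

Lemma excess_lin s j : j \in P -> s \in P ->
  appr r (excess s 1) (fun xi => (1 - q%:C * xi n) * xi j / p%:C).
Proof.
move=> jP sP; have nj : (n == j) = false by apply: contraNF nP => /eqP ->.
have sn : (s == n) = false by apply: contraNF nP => /eqP <-.
apply: (appr_ext (g := fun xi => (p%:C)^-1 * mono (unitm j) xi +
   - q%:C / p%:C * mono (unitm n + unitm j) xi)).
  by move=> xi h; rewrite (monoD r0) // !mono_unitm; ring.
apply: apprD; apply: (apprZ r0); apply: appr_mono;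
  by rewrite /excess !ffunE ?eqxx ?nj ?sn; case: (s == j).
Qed.

Definition ratio (xi : 'I_N -> R[i]) (j : 'I_N) := b (xi n) (xi j) / b (xi j) (xi n).

Definition exn (k : expo) := exists2 i, i \in P & k n <= k i.

Variable t0 : 'I_N.
Hypothesis t0P : t0 \in P.

(** The factor b (xi j) (xi n) = p - xi j (1 - q xi n) divides
    1 - (xi j (1 - q xi n) / p)^k, so the denominator of the ratio disappears from the
    difference. *)
Lemma ratio_reduce xi j (m : int) (k : nat) : onT r xi ->
  xi j ^ m * ratio xi j - ((1 - q%:C * xi n) / p%:C) ^+ k * (xi j ^ (m + k%:Z) * ratio xi j) =
  xi j ^ m * (p%:C^-1 * b (xi n) (xi j) * \sum_(l < k) ((1 - q%:C * xi n) * xi j / p%:C) ^+ l).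
Proof.
move=> h; have xj0 := onT_neq0 r0 j h; have d0 := bethe_neq0 adm j n h.
have p0' := @pC_neq0 R p p0.
rewrite exprzDr ?unitfE // -exprnP.
set u := (1 - q%:C * xi n); set z := xi n in u *; set y := xi j in xj0 d0 *.
have -> : (u / p%:C) ^+ k * (y ^ m * y ^+ k * ratio xi j) =
    y ^ m * ratio xi j * (u * y / p%:C) ^+ k.
  rewrite [u * y / _]mulrAC [(_ * y) ^+ k]exprMn.
  move: ((_ / _) ^+ k) (ratio _ _) (y ^ m) (y ^+ k) => *; ring.
rewrite -{1}[_ * ratio xi j]mulr1 -mulrBr -[1 in X in X = _](expr1n _ k).
rewrite -(opprB (_ ^+ k)) expr1n subrX1.
have -> : u * y / p%:C - 1 = - (b y z / p%:C) by rewrite /bethe /u; field.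
by rewrite /ratio -/y -/z; field; apply/andP.
Qed.

(** Jointly, the ratios could raise the exponent of n by more than that of any single
    element of P. Antisymmetry in P prevents this: after row reduction a single
    denominator is left, in the row of largest exponent, and the powers of xi n
    created by the reduction add up to at most the difference between the largest
    exponent and that of n. *)
Lemma alt_mono mu : (forall i, i \in P -> mu n < mu i) ->
  appr r exn (fun xi => (\prod_(j in P) ratio xi j) *
    \sum_(tau : 'S_N | perm_on P tau) (-1) ^+ tau * mono mu (fun i => xi (tau i))).
Proof.
move=> hmu.
pose out xi := \prod_(i | i \notin P) xi i ^ mu i : R[i].
pose h (xi : 'I_N -> R[i]) i j := xi j ^ mu i * ratio xi j.
have E xi : (\prod_(j in P) ratio xi j) *
    (\sum_(tau : 'S_N | perm_on P tau) (-1) ^+ tau * mono mu (fun i => xi (tau i))) =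
    out xi * altsum P (h xi).
  rewrite /altsum !mulr_sumr; apply: eq_bigr => tau ht.
  have -> : mono mu (fun i => xi (tau i)) = (\prod_(i in P) xi (tau i) ^ mu i) * out xi.
    rewrite /mono (bigID (mem P)) /=; congr (_ * _).
    by apply: eq_bigr => i iP; rewrite (out_perm ht).
  rewrite [X in _ = _ * (_ * X)]big_split /=.
  have -> : \prod_(i in P) ratio xi (tau i) = \prod_(j in P) ratio xi j.
    rewrite [RHS](reindex_inj (@perm_inj _ tau)) /=; apply: eq_bigl => i.
    by rewrite perm_closed.
  move: (\prod_(j in P) _) (\prod_(j in P) _) (out xi) ((-1) ^+ tau) => a1 a2 a3 a4.
  by ring.
(* Two equal exponents give two equal rows. *)
have [inj|ninj] := pselect {in P &, injective mu}; last first.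
  apply: (appr_ext (g := ev [::])); last by apply: appr_ev.
  move=> xi _; rewrite E /ev big_nil.
  have [i [j [iP jP ij e]]] : exists i j, [/\ i \in P, j \in P, i != j & mu i = mu j].
    apply: contrapT => hn; apply: ninj => i j iP jP e; apply/eqP; apply: contrapT => /negP ij.
    by apply: hn; exists i, j.
  by rewrite (altsum_eq0 iP jP ij) ?mulr0 // => k; rewrite /h e.
have [t tP ht] : exists2 t, t \in P & forall j, j \in P -> mu j <= mu t.
  by case: (arg_maxP mu t0P) => t tP ht; exists t.
have lt_t i : i \in P :\ t -> mu i < mu t.
  rewrite !inE => /andP[it iP]; rewrite lt_neqAle ht // andbT.
  by apply: contra_neq it => e; exact: (inj _ _ iP tP e).
pose k i := `|mu (nextup P mu i) - mu i|%N.
have nxP i : i \in P :\ t -> nextup P mu i \in P /\ mu i < mu (nextup P mu i).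
  by move=> /lt_t /(nextupP tP)[].
have kE i : i \in P :\ t -> mu (nextup P mu i) = mu i + (k i)%:Z.
  by move=> /nxP[_ hh]; rewrite /k; lia.
(* Every row but that of the largest exponent is reduced against the next one. *)
pose h' xi i j := if i \in P :\ t then
  xi j ^ mu i * (p%:C^-1 * b (xi n) (xi j) * \sum_(l < k i) ((1 - q%:C * xi n) * xi j / p%:C) ^+ l)
  else h xi i j.
have E' xi : onT r xi -> altsum P (h xi) = altsum P (h' xi).
  move=> hxi.
  rewrite -(@altsum_reduce _ _ P _ mu (fun i => ((1 - q%:C * xi n) / p%:C) ^+ k i) (nextup P mu) (P :\ t)) //.
  - apply: altsum_ext => i j iP jP; rewrite /h'; case: ifP => // iPt.
    by rewrite /h kE // ratio_reduce.
  - exact: subD1set.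
apply: (appr_ext (g := fun xi => \sum_(tau : 'S_N | perm_on P tau)
   (-1) ^+ tau * (out xi * \prod_(i in P) h' xi i (tau i)))).
  move=> xi hxi; rewrite E E' // /altsum mulr_sumr; apply: eq_bigr => tau _; exact: mulrCA.
apply: appr_sum => tau htau; apply: (apprZ r0).
(* The variable that carries the largest exponent is the witness. *)
set s := tau t; have sP : s \in P by rewrite perm_closed.
suff : appr r (excess s 0) (fun xi => out xi * \prod_(i in P) h' xi i (tau i)).
  by apply: appr_weak => m; rewrite /excess => hm; exists s => //; rewrite -subr_le0.
have a1 : appr r (excess s (mu n)) out.
  pose m : expo := [ffun i => if i \in P then 0 else mu i].
  apply: (appr_ext (g := mono m)).
    move=> xi _; rewrite /mono (bigID (mem P)) /= big1 ?mul1r.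
      by apply: eq_bigr => i /negPf iP; rewrite ffunE iP.
    by move=> i iP; rewrite ffunE iP expr0z.
  by apply: excess_weak (excess_mono s m); rewrite !ffunE sP (negPf nP) subr0.
have a2 i : i \in P :\ t -> appr r (excess s (k i)%:Z) (fun xi => h' xi i (tau i)).
  move=> iPt; move: (iPt); rewrite !inE => /andP[it iP].
  have tiP : tau i \in P by rewrite perm_closed.
  have ne : (tau i == s) = false by rewrite (inj_eq perm_inj) (negPf it).
  rewrite /h' iPt -[X in excess s X]add0r; apply: excessM.
    by have := @excess_pow s (tau i) (mu i) tiP sP; rewrite ne mulr0 oppr0.
  apply: (excess_weak (c := 0 + 1 + ((k i)%:Z - 1))); first by rewrite add0r addrC subrK.
  apply: excessM; first by apply: excessM; [exact: excess_cst|exact: excess_num].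
  apply: appr_sum => l _; apply: (excess_weak (c := 1 * l%:Z)).
    by rewrite mul1r lerBrDr addrC -intS lez_nat.
  exact/excess_exp/excess_lin.
have a3 : appr r (excess s (1 - mu t)) (fun xi => h' xi t (tau t)).
  rewrite /h' !inE eqxx /= /h /ratio -/s addrC; apply: excessM.
    by have := @excess_pow s s (mu t) sP sP; rewrite eqxx mulr1.
  rewrite -[X in excess s X]addr0; apply: excessM; [exact: excess_num|exact: excess_den].
apply: (excess_weak (c := mu n + ((1 - mu t) + \sum_(i in P :\ t) (k i)%:Z))).
  have := @nextup_sum N P mu inj t (mu n + 1) tP ht.
  have -> : \sum_(i in P :\ t) (mu (nextup P mu i) - mu i) = \sum_(i in P :\ t) (k i)%:Z.
    by apply: eq_bigr => i /kE ->; rewrite addrC addKr.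
  move=> /(_ _); have hh i : i \in P -> mu n + 1 <= mu i by move=> /hmu; lia.
  by move=> /(_ hh); lia.
apply: excessM => //.
apply: (appr_ext (g := fun xi => h' xi t (tau t) * \prod_(i in P :\ t) h' xi i (tau i))).
  by move=> xi _; rewrite (big_setD1 t tP).
by apply: excessM => //; apply: excess_prod.
Qed.

End Cancellation.

Section Parabolic.
Context {R : realType} {N : nat}.
Variables (p q r : R).
Hypotheses (p0 : 0 < p) (q0 : 0 < q) (adm : admissible_radius p q r).
Local Notation expo := {ffun 'I_N -> int}.
Local Notation b := (bethe p q).
Local Notation ampl := (amp p q).
Let r0 : 0 < r := adm_r0 adm.

Variables (T : eqType) (rho : 'I_N -> nat) (beta : 'I_N -> T).
Hypothesis rho_inj : injective rho.
Hypothesis beta_conv : forall i j k, (rho i <= rho j <= rho k)%N ->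
  beta i = beta k -> beta j = beta i.
Variables (X Z : expo).
Hypothesis incX : forall i j, beta i = beta j -> (rho i < rho j)%N -> X i < X j.
Hypothesis incZ : forall i j, beta i = beta j -> (rho i < rho j)%N -> Z i < Z j.

Definition inv i j : int := (rho j < rho i)%N%:Z.

(** The entries of [ker] for the stabiliser of a face, once the ring is cut open at
    a vertex of the face: rho ranks the particles along the resulting line, and beta
    labels the blocks that the stabiliser preserves. *)
Definition kpar (s : 'S_N) : R[i] :=
  coef r Z (fun xi => (-1) ^+ s *
    ampl (fun i j => inv i j - inv ((s^-1)%g i) ((s^-1)%g j)) xi * mono X (fun i => xi (s i))).

Definition blocked (s : 'S_N) : bool := [forall j, beta (s j) == beta j].

Lemma appr_kpar (s : 'S_N) : appr r (@anyexp N) (fun xi => (-1) ^+ s *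
    ampl (fun i j => inv i j - inv ((s^-1)%g i) ((s^-1)%g j)) xi * mono X (fun i => xi (s i))).
Proof.
apply: (apprM r0 (Q1 := @anyexp N) (Q2 := @anyexp N)) => //.
  by apply: (apprZ r0); apply: appr_any (appr_amp p0 q0 adm _).
apply: (appr_ext (g := mono (rexp s^-1 X))) => [xi _|]; first by rewrite mono_perm.
exact: appr_mono.
Qed.

Definition Qz (n : 'I_N) (k : expo) := k n = 0.

Lemma appr_amp0 n e : (forall i, e n i = 0 /\ e i n = 0) -> appr r (fun k => Qnn k /\ Qz n k) (ampl e).
Proof.
move=> he; have Qa : addclosed (fun k : expo => Qnn k /\ Qz n k).
  split; first by split; [exact: Qnn_add.1|rewrite /Qz ffunE].
  by move=> a c [a1 a2] [c1 c2]; split; [exact: Qnn_add.2|rewrite /Qz ffunE a2 c2].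
have Qu i : i != n -> Qnn (unitm i) /\ Qz n (unitm i).
  by move=> ni; split; [exact: Qnn_unit|rewrite /Qz ffunE eq_sym (negPf ni)].
apply: (appr_prod r0) => // i _; apply: (appr_prod r0) => // j _.
have [->|ni] := eqVneq i n.
  by apply: (appr_ext (g := fun=> 1)) => [xi _|]; rewrite ?(he j).1 //; apply: appr_cst; exact: Qa.1.
have [->|nj] := eqVneq j n.
  by apply: (appr_ext (g := fun=> 1)) => [xi _|]; rewrite ?(he i).2 //; apply: appr_cst; exact: Qa.1.
apply: (appr_betheX p0 q0 adm) => //; [exact: Qu|].
by apply: Qa.2; exact: Qu.
Qed.

Variables (m n : 'I_N) (s0 : 'S_N).
Hypotheses (s0b : blocked s0) (s0n : s0 n = m) (nem : n != m).
Hypothesis s0_fix : forall i, (rho m < rho i)%N -> s0 i = i.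

(** The ranks jumped over by n when it is moved to the place of m. *)
Definition arc : {set 'I_N} := [set i | (rho n < rho i <= rho m)%N].

Lemma lt_nm : (rho n < rho m)%N.
Proof.
rewrite ltn_neqAle (inj_eq rho_inj) nem /= leqNgt; apply/negP => h.
by have := s0_fix h; rewrite s0n => e; have := nem; rewrite e eqxx.
Qed.

Lemma arc_beta i : i \in arc -> beta i = beta n.
Proof.
rewrite inE => /andP[h1 h2]; apply: (@beta_conv _ _ m); first by rewrite ltnW.
by rewrite -s0n; apply/esym/eqP; exact: (forallP s0b).
Qed.

Lemma beta_m : beta m = beta n.
Proof. by rewrite -s0n; apply/eqP; exact: (forallP s0b). Qed.

Lemma n_arc : n \notin arc. Proof. by rewrite inE ltnn. Qed.
Lemma m_arc : m \in arc. Proof. by rewrite inE lt_nm leqnn. Qed.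

Lemma s0_lt i : i != n -> (rho (s0 i) < rho m)%N = (rho i <= rho m)%N.
Proof.
move=> ni; case: (leqP (rho i) (rho m)) => h; last by rewrite s0_fix // ltnNge ltnW.
have sm : s0 i != m by rewrite -s0n (inj_eq perm_inj).
rewrite ltn_neqAle (inj_eq rho_inj) sm /= leqNgt; apply/negP => h'.
have e := s0_fix h'; have := perm_inj e => e'.
by rewrite e' ltnNge h in h'.
Qed.

(** The exponents of tau * s0 split into three parts: within the arc, between n and
    the arc, and away from n. Only the first one involves tau ([exponentE]), and the
    second one gives the ratios of [alt_mono]. *)
Definition e_in i j : int := - (inv i j * ((i \in arc) && (j \in arc))%:Z).
Definition e_free i j : int := ((i != n) && (j != n))%:Z *
   (inv (s0 i) (s0 j) - inv i j * (1 - ((i \in arc) && (j \in arc))%:Z)).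
Definition e_ratio i j : int := ((i == n) && (j \in arc))%:Z - ((j == n) && (i \in arc))%:Z.

Lemma inv_arc (tau : 'S_N) i j : perm_on arc tau ->
  inv (tau i) (tau j) * (1 - ((tau i \in arc) && (tau j \in arc))%:Z) =
  inv i j * (1 - ((i \in arc) && (j \in arc))%:Z).
Proof.
move=> ht; rewrite !(perm_closed _ ht).
have hc k := perm_closed k ht.
case iP: (i \in arc); case jP: (j \in arc); rewrite ?subrr ?mulr0 //= subr0 !mulr1.
- rewrite (out_perm ht (negbT jP)); have := hc i; rewrite iP => tiP.
  move: iP tiP jP; rewrite !inE /inv => /andP[a1 a2] /andP[a3 a4] /negbT.
  by rewrite negb_and -!leqNgt -ltnNge; case/orP; lia.
- rewrite (out_perm ht (negbT iP)); have := hc j; rewrite jP => tiP.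
  move: jP tiP iP; rewrite !inE /inv => /andP[a1 a2] /andP[a3 a4] /negbT.
  by rewrite negb_and -!leqNgt -ltnNge; case/orP; lia.
- by rewrite (out_perm ht (negbT jP)) (out_perm ht (negbT iP)).
Qed.

Lemma exponent_split i j : inv (s0 i) (s0 j) - inv i j * (1 - ((i \in arc) && (j \in arc))%:Z) =
  e_free i j + e_ratio i j.
Proof.
rewrite /e_free /e_ratio; have lnm := lt_nm.
case: (eqVneq i n) => [->|ni] /=; rewrite ?mul0r ?add0r.
  rewrite (negPf n_arc) andbF /= !subr0 mulr1 /inv s0n.
  case: (eqVneq j n) => [->|nj]; first by rewrite s0n !ltnn (negPf n_arc).
  rewrite s0_lt // inE; move: (leq_total (rho j) (rho n)).
  have : rho j != rho n by rewrite (inj_eq rho_inj).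
  by move: (rho j) (rho n) (rho m) lnm => a c d; lia.
case: (eqVneq j n) => [->|nj] /=; last by rewrite mul1r subr0.
rewrite (negPf n_arc) andbF [0%Z * _]mul0r add0r /= subr0 mulr1 /inv s0n.
have -> : (rho m < rho (s0 i))%N = (rho m < rho i)%N.
  rewrite !ltnNge; congr negb.
  have sm : s0 i != m by rewrite -s0n (inj_eq perm_inj).
  by rewrite -(s0_lt ni) ltn_neqAle (inj_eq rho_inj) sm.
rewrite inE.
have : rho i != rho n by rewrite (inj_eq rho_inj).
by move: (rho i) (rho n) (rho m) lnm => a c d; lia.
Qed.

Lemma exponentE (tau : 'S_N) i j : perm_on arc tau ->
  inv (s0 i) (s0 j) - inv ((tau^-1)%g i) ((tau^-1)%g j) =
  e_free i j + e_ratio i j + e_in ((tau^-1)%g i) ((tau^-1)%g j).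
Proof.
move=> ht; rewrite -exponent_split /e_in.
have := @inv_arc tau ((tau^-1)%g i) ((tau^-1)%g j) ht; rewrite !permKV => ->.
by ring.
Qed.

Lemma amp_ratio xi : ampl e_ratio xi = \prod_(k in arc) ratio p q n xi k.
Proof.
rewrite /ratio big_split /= prodfV /amp.
transitivity (\prod_(i < N) \prod_(j < N)
   ((if (i == n) && (j \in arc) then b (xi i) (xi j) else 1) *
    (if (j == n) && (i \in arc) then (b (xi i) (xi j))^-1 else 1))).
  apply: eq_bigr => i _; apply: eq_bigr => j _; rewrite /e_ratio.
  case: eqVneq => [->|ni] /=; case: eqVneq => [->|nj] /=;
    rewrite ?(negPf n_arc) /= ?subr0 ?expr0z ?mulr1 //.
    by case: ifP => _; rewrite ?mulr1.
  by case: ifP => _; rewrite ?mul1r // sub0r expN1r.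
rewrite (eq_bigr _ (fun i _ => big_split _ _ _ _ _)) /= [LHS]big_split /=; congr (_ * _).
  rewrite (bigD1 n) //= eqxx [X in _ * X]big1 ?mulr1 -?big_mkcond //.
  by move=> i /negPf ni; rewrite big1 // => j _; rewrite ni.
rewrite -prodfV [RHS]big_mkcond; apply: eq_bigr => i _.
rewrite (bigD1 n) //= eqxx [X in _ * X]big1 ?mulr1 //.
by move=> j /negPf nj; rewrite nj.
Qed.

Let inner xi : R[i] := mono X xi * ampl e_in xi.

Lemma appr_inner : appr r (fun k => forall i, i \in arc -> k n < k i) inner.
Proof.
apply: (apprM r0 (Q1 := fun k => k = X) (Q2 := fun k => Qnn k /\ Qz n k)).
- move=> _ a -> [h1 h2] i iP; rewrite !ffunE h2 addr0.
  apply: (lt_le_trans (y := X i)); last by rewrite lerDl.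
  by apply: incX; [rewrite arc_beta|move: iP; rewrite inE => /andP[]].
- exact: appr_mono.
- by apply: appr_amp0 => i; rewrite /e_in (negPf n_arc) andbF !mulr0 oppr0.
Qed.

Let altf (f : ('I_N -> R[i]) -> R[i]) xi : R[i] := (\prod_(k in arc) ratio p q n xi k) *
  \sum_(tau : 'S_N | perm_on arc tau) (-1) ^+ tau * f (fun i => xi (tau i)).

Lemma appr_altf f : appr r (fun k => forall i, i \in arc -> k n < k i) f ->
  appr r (exn n arc) (altf f).
Proof.
move=> fa; apply: appr_lim => e e0.
have ra : appr r (@anyexp N) (fun xi => \prod_(k in arc) ratio p q n xi k).
  by apply: (appr_ext (g := ampl e_ratio)) => [xi _|]; [exact: amp_ratio|apply: appr_any (appr_amp p0 q0 adm _)].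
have [M M0 hM] := appr_bnd r0 ra.
pose c : R := \sum_(tau : 'S_N) 1.
have c0 : 0 < c by rewrite /c (bigD1 1%g) //= ltr_wpDr // sumr_ge0.
have K0 : 0 < M * c by rewrite mulr_gt0.
have [P [hP hfP]] := fa (e / (M * c)) (divr_gt0 e0 K0).
exists (altf (ev P)).
  apply: (appr_ext (g := fun xi => \sum_(u <- P | u \in P) u.1 * altf (mono u.2) xi)).
    move=> xi _; rewrite -big_seq /altf /ev.
    under eq_bigr do rewrite mulrCA mulr_sumr.
    rewrite -mulr_sumr exchange_big /=; congr (_ * _); apply: eq_bigr => tau _.
    by rewrite mulr_sumr; apply: eq_bigr => u _; rewrite mulrCA.
  apply: appr_sum => u uP; apply: (apprZ r0).
  by apply: (alt_mono p0 q0 adm n_arc m_arc) => i iP; exact: hP.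
move=> xi hxi; rewrite /altf -mulrBr -sumrB nmM.
apply: le_trans (ler_pM (nm_ge0 _) (nm_ge0 _) (hM xi hxi) (nm_sum _ _ _)) _.
apply: (le_trans (y := M * \sum_(tau : 'S_N) (e / (M * c)))).
  apply: ler_wpM2l; first exact: ltW.
  rewrite [X in X <= _]big_mkcond; apply: ler_sum => tau _.
  have h0 : 0 <= e / (M * c) by rewrite ltW // divr_gt0.
  case: ifP => _; last by rewrite h0.
  rewrite -mulrBr nmM.
  have -> : nm ((-1) ^+ tau : R[i]) = 1 by rewrite nmX nmN nm1 expr1n.
  by rewrite mul1r; apply: hfP; exact: onT_perm.
have -> : \sum_(tau : 'S_N) (e / (M * c)) = e / (M * c) * c.
  by rewrite /c [in RHS]mulr_sumr; apply: eq_bigr => tau _; rewrite mulr1.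
by rewrite le_eqVlt; apply/orP; left; apply/eqP; field; rewrite !gt_eqF.
Qed.

(** The sum over tau is an alternating sum to which [alt_mono] applies: its
    exponents give n no more than the largest of the arc. In Z, on the contrary, the
    place m where n is sent has an entry larger than those of the places before it in
    the block. *)
Lemma kpar_cancel : \sum_(tau : 'S_N | perm_on arc tau) kpar (tau * s0)%g = 0.
Proof.
rewrite -(@coef_sum _ _ r0 _ _ (@anyexp N)); last by move=> tau _; exact: appr_kpar.
pose F xi := (-1) ^+ s0 * (ampl e_free xi * altf inner xi) : R[i].
have Fa : appr r (exn n arc) F.
  apply: (apprZ r0); apply: (apprM r0 _ (appr_amp0 (e := e_free) (n := n) _) (appr_altf appr_inner)).
    move=> a c [h1 h2] [i iP hi]; exists i => //.
    by rewrite !ffunE h2 add0r ler_wpDl.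
  by move=> i; rewrite /e_free eqxx andbF !mul0r.
transitivity (coef r Z (fun xi => F (fun i => xi (s0 i)))).
  apply: (@coef_ext _ _ r0 _ _ (@anyexp N)).
    by apply: appr_sum => tau _; exact: appr_kpar.
  move=> xi hxi; rewrite /F /altf -amp_ratio mulrA -(ampD adm) ?mulr_sumr; last exact: onT_perm.
  apply: eq_bigr => tau ht.
  have -> : ampl (fun i j => inv i j - inv (((tau * s0)^-1)%g i) (((tau * s0)^-1)%g j)) xi =
    ampl (fun i j => e_free i j + e_ratio i j) (fun i => xi (s0 i)) *
    ampl e_in (fun i => xi (s0 (tau i))).
    rewrite (amp_perm _ _ e_in tau (fun i => xi (s0 i))) -(ampD adm); last exact: onT_perm.
    rewrite amp_perm; apply: amp_eq => i j; rewrite -exponentE // !permKV.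
    by rewrite invMg !permM.
  have -> : (fun i => xi ((tau * s0)%g i)) = (fun i => xi (s0 (tau i))).
    by apply/funext => i; rewrite permM.
  rewrite odd_permM signr_addb /inner.
  move: (ampl _ _) (ampl _ _) (mono _ _) ((-1) ^+ tau) ((-1) ^+ s0) => *; ring.
rewrite (coef_perm r0 _ _ Fa); apply: (coef_eq0 r0 Fa) => -[i iP].
rewrite !ffunE s0n; apply/negP; rewrite -ltNge; apply: incZ.
  rewrite (eqP (forallP s0b i)) arc_beta // beta_m //.
have ni : i != n by apply: contraTneq iP => ->; exact: n_arc.
by rewrite s0_lt //; move: iP; rewrite inE => /andP[].
Qed.

End Parabolic.

Section ParabolicSum.
Context {R : realType} {N : nat}.
Variables (p q r : R).
Hypotheses (p0 : 0 < p) (q0 : 0 < q) (adm : admissible_radius p q r).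
Local Notation expo := {ffun 'I_N -> int}.
Let r0 : 0 < r := adm_r0 adm.
Variables (T : eqType) (rho : 'I_N -> nat) (beta : 'I_N -> T).
Hypothesis rho_inj : injective rho.
Hypothesis beta_conv : forall i j k, (rho i <= rho j <= rho k)%N ->
  beta i = beta k -> beta j = beta i.
Variables (X Z : expo).
Hypothesis incX : forall i j, beta i = beta j -> (rho i < rho j)%N -> X i < X j.
Hypothesis incZ : forall i j, beta i = beta j -> (rho i < rho j)%N -> Z i < Z j.

Local Notation kp := (kpar p q r rho X Z).
Local Notation blocked := (blocked beta).

Definition fixes_from (c : nat) (s : 'S_N) : bool := [forall i, (c <= rho i)%N ==> (s i == i)].

(** The fibre is stable under the permutations of the arc, which act by left
    multiplication, so [kpar_cancel] applies to each orbit. *)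
Lemma kpar_fibre (m n : 'I_N) : n != m ->
  \sum_(s : 'S_N | blocked s && fixes_from (rho m).+1 s && ((s^-1)%g m == n)) kp s = 0.
Proof.
move=> nem; pose A := arc rho m n.
pose Kp (s : 'S_N) := blocked s && fixes_from (rho m).+1 s && ((s^-1)%g m == n).
have nA : n \notin A by rewrite inE ltnn.
have KpP s : Kp s -> [/\ blocked s, s n = m & forall i, (rho m < rho i)%N -> s i = i].
  move=> /andP[/andP[h1 /forallP h2] /eqP h3]; split => //; first by rewrite -h3 permKV.
  by move=> i hi; apply/eqP; exact: (implyP (h2 i)).
have stable (tau s : 'S_N) : perm_on A tau -> Kp s -> Kp (tau * s)%g.
  move=> ht hs; have [h1 h2 h3] := KpP s hs; apply/andP; split; [apply/andP; split|].
  - apply/forallP => j; rewrite permM (eqP (forallP h1 _)); apply/eqP.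
    have [jA|jA] := boolP (j \in A); last by rewrite (out_perm ht).
    by rewrite !(arc_beta beta_conv h1 h2) // perm_closed.
  - apply/forallP => i; apply/implyP => hi; rewrite permM (out_perm ht) ?h3 //.
    by rewrite inE negb_and -!leqNgt -!ltnNge hi orbT.
  - by rewrite -h2 invMg permM permK -{1}(out_perm ht nA) permK.
have cancel_s s : Kp s -> \sum_(tau : 'S_N | perm_on A tau) kp (tau * s)%g = 0.
  by move=> /KpP[h1 h2 h3]; apply: (kpar_cancel p0 q0 adm rho_inj beta_conv incX incZ h1 h2 nem h3).
have shift tau : perm_on A tau -> \sum_(s | Kp s) kp (tau * s)%g = \sum_(s | Kp s) kp s.
  move=> ht; rewrite [RHS](reindex_inj (mulgI tau)); apply: eq_bigl => s.
  apply/idP/idP => [|h]; first exact: stable.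
  by rewrite -[s](mulKg tau); apply: stable => //; exact: perm_onV.
(* The sum over the fibre, multiplied by the number of permutations of the arc. *)
have : \sum_(tau : 'S_N | perm_on A tau) \sum_(s | Kp s) kp (tau * s)%g = 0.
  by rewrite exchange_big /= big1.
rewrite (eq_bigr _ shift) sumr_const => /eqP; rewrite mulrn_eq0 => /orP[|/eqP //].
move=> /eqP/card0_eq/(_ 1%g); rewrite unfold_in => h.
by have := perm_on1 A; rewrite /perm_on h.
Qed.

(** All permutations but the identity cancel, grouped by their largest moved point
    m and by the point n sent to it. *)
Lemma kpar_sum : \sum_(s : 'S_N | blocked s) kp s = (Z == X)%:R.
Proof.
pose S c := \sum_(s : 'S_N | blocked s && fixes_from c s) kp s.
have S0 : S 0%N = (Z == X)%:R.
  rewrite /S (bigD1 1%g) /=; last first.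
    by apply/andP; split; apply/forallP => i; rewrite perm1 eqxx ?implybT.
  rewrite big1 ?addr0; last first.
    move=> s /andP[/andP[_ /forallP h]] /negP[]; apply/eqP/perm.permP => i.
    by rewrite perm1; apply/eqP; exact: (implyP (h i)).
  rewrite /kpar eq_sym -(coef_mono r0); apply: (@coef_ext _ _ r0 _ _ (@anyexp N)).
    exact: (appr_kpar p0 q0 adm).
  move=> xi hxi; rewrite odd_perm1 expr0 mul1r invg1.
  rewrite (_ : (fun i => xi ((1%g : 'S_N) i)) = xi); last by apply/funext => i; rewrite perm1.
  rewrite /amp big1 ?mul1r // => i _; rewrite big1 // => j _.
  by rewrite !perm1 subrr expr0z.
have SS c : S c.+1 = S c.
  have [[m mc]|hc] := pselect (exists m, rho m = c); last first.
    apply: eq_bigl => s; congr (_ && _); apply: eq_forallb => i.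
    rewrite [(c <= _)%N]leq_eqVlt; case: (c =P rho i) => //= e; by case: hc; exists i.
  rewrite /S (partition_big (fun s : 'S_N => (s^-1)%g m) predT) //= (bigD1 m) //=.
  rewrite [X in _ + X]big1 ?addr0; last by move=> n nm; rewrite -mc; exact: kpar_fibre.
  apply: eq_bigl => s; rewrite -andbA; congr (_ && _); apply/andP/forallP.
    move=> [/forallP h /eqP e] i; rewrite leq_eqVlt; apply/implyP => /orP[|hi]; last exact: (implyP (h i)).
    by rewrite -mc (inj_eq rho_inj) => /eqP <-; rewrite -{1}e permKV.
  move=> h; split; last first.
    have /implyP := h m; rewrite mc leqnn => /(_ isT)/eqP e.
    by rewrite -{1}e permK.
  by apply/forallP => i; apply/implyP => hi; apply: (implyP (h i)); rewrite ltnW.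
have SE c : S c = S 0%N by elim: c => // c <-.
rewrite -S0 -(SE (\sum_i rho i).+1); apply: eq_bigl => s.
rewrite [fixes_from _ _](_ : _ = true) ?andbT //; apply/forallP => i.
by rewrite (bigD1 i) //= ltnNge leq_addr.
Qed.

End ParabolicSum.

Section Faces.
Context {R : realType} {N : nat}.
Variables (L : nat) (p q r : R).
Hypotheses (p0 : 0 < p) (q0 : 0 < q) (adm : admissible_radius p q r).
Local Notation expo := {ffun 'I_N -> int}.
Let r0 : 0 < r := adm_r0 adm.
Implicit Types (X Z : expo) (v : @affine N).

Variables (J : {set 'I_N}) (i0 : 'I_N).
Hypothesis i0J : i0 \notin J.

(** Rank in the cyclic order that starts just after i0. *)
Definition crank (j : 'I_N) : nat := (if i0 < j then j - i0.+1 else j + N - i0.+1)%N.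
(** The vertices of the face met before j; they label the blocks of consecutive
    particles between two such vertices. *)
Definition passed (j : 'I_N) : {set 'I_N} := [set i | (i \notin J) && (crank i < crank j)%N].
(** Undoes the shift by L of the particles beyond i0, so that the ring becomes a
    line on which [crank] is the order. *)
Definition flat X : expo := [ffun j => X j - L%:Z * vert i0 j].

Lemma crankP (j : 'I_N) : ((i0 < j)%N /\ (crank j + i0.+1 = j)%N \/ (j <= i0)%N /\ (crank j + i0.+1 = j + N)%N)
  /\ (j < N)%N.
Proof.
rewrite /crank; have h := ltn_ord j; have h0 := ltn_ord i0; split => //.
by case: (ltnP i0 j) => hj; [left|right]; split => //; lia.
Qed.

Lemma crank_inj : injective crank.
Proof.
move=> i j e; apply: val_inj => /=; move: e (crankP i) (crankP j).
by move: (crank i) (crank j) (i : nat) (j : nat) (i0 : nat) => a a' c c' d; clear; lia.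
Qed.

Lemma passed_conv i j k : (crank i <= crank j <= crank k)%N -> passed i = passed k -> passed j = passed i.
Proof.
move=> /andP[h1 h2] e; apply/eqP; rewrite finset.eqEsubset; apply/andP; split.
  by rewrite e; apply/fintype.subsetP => a; rewrite !inE => /andP[-> h]; exact: leq_trans h2.
by apply/fintype.subsetP => a; rewrite !inE => /andP[-> h]; exact: leq_trans h1.
Qed.

Lemma crankE i j : (crank j < crank i)%N%:Z = (j < i)%N%:Z - vert i0 i + vert i0 j.
Proof.
rewrite !ffunE; have := crankP i; have := crankP j.
move: (crank i) (crank j) (i : nat) (j : nat) (i0 : nat) => a a' c c' d; clear.
by case: (ltnP a' a); case: (ltnP c' c); case: (ltnP d c); case: (ltnP d c'); lia.
Qed.

Lemma crank_succ i : i != i0 -> crank (ordS i) = (crank i).+1.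
Proof.
move=> ne; have := val_ordS i; have := crankP i; have := crankP (ordS i).
have : (i : nat) != i0 by []; have := ltn_ord i0.
move: (crank (ordS i)) (crank i) (ordS i : nat) (i : nat) (i0 : nat) => a a' c c' d; clear.
by case: (c'.+1 =P N); lia.
Qed.

Lemma flat_succ X i : i != i0 -> flat X (ordS i) - flat X i = gap L X i.
Proof.
move=> ne; have := val_ordS i; have := ltn_ord i; have := ltn_ord i0.
have : (i : nat) != i0 by [].
rewrite !ffunE /gap /wrapz; move: (X (ordS i)) (X i) (ordS i : nat) => x y a.
case: (i.+1 =P N) => h h1 h2 h3 ->.
  rewrite ltn0; have -> : (i0 < i)%N = true by lia.
  by rewrite mulr0 subr0 mulr1 mul1r; lia.
have -> : (i0 < i.+1)%N = (i0 < i)%N by lia.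
by rewrite mul0r addr0; lia.
Qed.

Lemma flat_inc X : cone L J X -> forall i j, passed i = passed j -> (crank i < crank j)%N ->
  flat X i < flat X j.
Proof.
move=> /forallP hX i j; have [d] := ubnP (crank j - crank i)%N.
elim: d i => // d IH i hd e hlt.
have crank_max k : (crank k <= crank i0)%N.
  have := crankP k; have := crankP i0; move: (crank k) (crank i0) (k : nat) (i0 : nat).
  by move=> a a' c c'; clear; lia.
have ne : i != i0 by apply: contraTneq hlt => ->; rewrite -leqNgt.
have hS := crank_succ ne.
have iJ : i \in J.
  apply: contrapT => /negP iJ; have : i \in passed j by rewrite inE iJ hlt.
  by rewrite -e inE ltnn andbF.
have g : flat X i < flat X (ordS i) by rewrite -subr_gt0 flat_succ //; exact: (implyP (hX i)).
have [eS|nS] := eqVneq (ordS i) j; first by rewrite -eS.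
have ltS : (crank (ordS i) < crank j)%N.
  by rewrite ltn_neqAle (inj_eq crank_inj) nS hS hlt.
apply: lt_trans g (IH _ _ _ ltS); first by rewrite hS; lia.
by rewrite -e; apply: passed_conv e; rewrite hS leqnSn hlt.
Qed.

Definition lift_perm_face (s : 'S_N) : @affine N :=
  (s, [ffun j => vert i0 j - vert i0 ((s^-1)%g j)]).

Lemma stabE v : stab J v = (v == lift_perm_face v.1) && blocked passed v.1.
Proof.
have flatv i j : vert i j - vert i0 j =
    (crank i < crank j)%N%:Z - vert i0 i.
  by rewrite crankE addrK !ffunE.
have key : v = lift_perm_face v.1 -> stab J v = blocked passed v.1.
  move=> e; have h i j : (wact1 v (vert i) j == vert i j) =
      ((crank i < crank ((v.1^-1)%g j))%N == (crank i < crank j)%N).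
    have e2 : v.2 j = vert i0 j - vert i0 ((v.1^-1)%g j) by rewrite {1}e /= ffunE.
    rewrite [wact1 _ _ _]ffunE e2; have := flatv i j; have := flatv i ((v.1^-1)%g j).
    move: (vert i0 j) (vert i0 _) (vert i j) (vert i _) => a1 a2 a3 a4.
    move: (vert i0 i) => a5.
    by case: (_ < crank (_ j))%N; case: (_ < crank j)%N; lia.
  apply/forallP/forallP => hh.
    move=> j; apply/eqP/setP => i; rewrite !inE; case iJ: (i \in J) => //=.
    have /implyP := hh i; rewrite iJ => /(_ isT)/eqP/ffunP/(_ (v.1 j))/eqP.
    by rewrite h permK => /eqP ->.
  move=> i; apply/implyP => iJ; apply/eqP/ffunP => j; apply/eqP; rewrite h.
  have := eqP (hh ((v.1^-1)%g j)); rewrite permKV => /setP/(_ i); rewrite !inE iJ /= => ->.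
  exact: eqxx.
case: eqP => [/key -> //|ne] /=; apply/negP => /forallP/(_ i0)/implyP/(_ i0J)/eqP/ffunP h.
case: ne; apply: affineP => // j; have := h j; rewrite [wact1 _ _ _]ffunE => e.
have -> : (lift_perm_face v.1).2 j = vert i0 j - vert i0 ((v.1^-1)%g j) by rewrite /= ffunE.
by rewrite -e addrC addKr.
Qed.

Lemma ker_face s X Z : ker L p q r (lift_perm_face s) Z X = kpar p q r crank (flat X) (flat Z) s.
Proof.
pose a : expo := [ffun j => L%:Z * vert i0 j].
have ga := @appr_kpar R N p q r p0 q0 adm crank (flat X) s.
have -> : flat Z = Z - a by apply/ffunP => j; rewrite !ffunE.
rewrite /kpar -(coef_shift r0 _ _ ga); rewrite /ker.
apply: (coef_ext r0 _ (appr_star_mono L p0 q0 adm (lift_perm_face s) X)).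
move=> xi hxi; rewrite (star_mono L adm) // /Acoef /=.
have -> : wact L (lift_perm_face s) X = rexp s^-1 (flat X) + a.
  by apply/ffunP => j; rewrite !ffunE /=; ring.
rewrite (monoD r0) // -mono_perm mulrA; congr (_ * _ * _ * _); apply: amp_eq => i j.
rewrite /nij /inv !crankE /= !ffunE; move: (_ < _)%N%:Z (_ < _)%N%:Z => *; ring.
Qed.

(** The stabiliser of the face consists of the permutations of the blocks, lifted
    by [lift_perm_face], to which [kpar_sum] applies. *)
Lemma ker_cone X Z : cone L J X -> cone L J Z ->
  fsum (fun v => (stab J v)%:R * ker L p q r v Z X) = (Z == X)%:R.
Proof.
move=> cX cZ; pose s := [seq lift_perm_face t | t <- enum 'S_N].
rewrite (@fsum_undup _ _ s); last first.
  move=> v; rewrite stabE; case: (v =P lift_perm_face v.1) => [->|] /=; last by rewrite mul0r eqxx.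
  by move=> _; apply/mapP; exists v.1; rewrite // mem_enum.
rewrite undup_id; last by rewrite map_inj_uniq ?enum_uniq // => a c [].
rewrite big_map big_enum /=.
rewrite (eq_bigr (fun t => if blocked passed t then kpar p q r crank (flat X) (flat Z) t else 0)).
  rewrite -big_mkcond (kpar_sum p0 q0 adm crank_inj passed_conv (flat_inc cX) (flat_inc cZ)).
  suff -> : (flat Z == flat X) = (Z == X) by [].
  apply/eqP/eqP => [/ffunP h|-> //]; apply/ffunP => j.
  by have := h j; rewrite !ffunE; apply: addIr.
by move=> t _; rewrite stabE /= eqxx ker_face; case: ifP; rewrite ?mul1r ?mul0r.
Qed.

End Faces.

(** * Configurations and the jump chain *)

Section Configurations.
Context {N : nat}.
Variable L : nat.
Hypotheses (N1 : (0 < N)%N) (L1 : (0 < L)%N).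
Local Notation expo := {ffun 'I_N -> int}.
Implicit Types (X Z : expo) (i j : 'I_N).

(** The gaps of the ring are positive exactly when the particles are strictly
    ordered and the last one is less than L ahead of the first one. *)
Lemma config_cone X : is_config L X = cone L full X.
Proof.
apply/idP/idP => [/andP[/forallP h1 /forallP h2]|h].
  apply/forallP => i; apply/implyP => _; rewrite /gap /wrapz.
  have vS := val_ordS i; case: (i.+1 =P N) vS => hi vS.
    rewrite mul1r subr_gt0; apply: (implyP (forallP (h2 (ordS i)) i)).
    by rewrite vS hi !eqxx.
  rewrite mul0r addr0 subr_gt0; apply: (implyP (forallP (h1 i) (ordS i))).
  by rewrite vS.
apply/andP; split; apply/forallP => i; apply/forallP => j; apply/implyP.
  by move=> hij; have [] := cone_mono N1 L1 h hij.
move=> /andP[/eqP hi /eqP hj].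
have [e|ne] := eqVneq i j; first by rewrite e ltrDl ltz_nat.
have hij : (i < j)%N by rewrite hi lt0n -hi; apply: contra ne => /eqP e; apply/eqP/val_inj.
by have [] := cone_mono N1 L1 h hij.
Qed.

Lemma shiftE X i (e : int) : shift_particle X i e = X + [ffun k => (k == i)%:Z * e].
Proof.
by apply/ffunP => k; rewrite !ffunE; case: eqP; rewrite ?mul1r ?mul0r ?addr0.
Qed.

Lemma shift_right X i : shift_particle X i 1 = X + unitm i.
Proof. by rewrite shiftE; congr (_ + _); apply/ffunP => k; rewrite !ffunE mulr1; case: eqP. Qed.

Lemma shift_left X i : shift_particle X i (-1) = X - unitm i.
Proof. by rewrite shiftE; congr (_ + _); apply/ffunP => k; rewrite !ffunE mulrN1; case: eqP. Qed.

Lemma attempt_config X i d : is_config L X -> is_config L (attempt_jump L X i d).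
Proof. by rewrite /attempt_jump => h; case: ifP. Qed.

Lemma gap_add X Z k : gap L (X + Z) k = gap L X k + (Z (ordS k) - Z k).
Proof. by rewrite /gap !ffunE; ring. Qed.

Lemma config1 X : N = 1%N -> is_config L X.
Proof.
move=> e; rewrite config_cone; apply/forallP => i; apply/implyP => _.
have -> : gap L X i = L%:Z.
  rewrite /gap /wrapz; have -> : ordS i = i.
    by apply: ord_inj; rewrite val_ordS; case: eqP => //; have := ltn_ord i; lia.
  have -> : i.+1 == N by have := ltn_ord i; lia.
  by rewrite mul1r addrAC subrr add0r.
by rewrite ltz_nat.
Qed.

Hypothesis N2 : (1 < N)%N.

Lemma config_right X j : is_config L X -> is_config L (X + unitm j) = (gap L X j != 1).
Proof.
rewrite !config_cone => /forallP hX; apply/forallP/idP => [/(_ j)|hj k].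
  rewrite inE gap_add !ffunE eqxx (negPf (ordS_neq N2 j)) /=.
  by apply: contraTneq => ->.
have := hX k; rewrite !inE gap_add !ffunE /= => hk.
have [e|ne] := eqVneq k j; last by case: eqP => _; lia.
move: hk; rewrite e (negPf (ordS_neq N2 j)) => hk.
by move: hj; lia.
Qed.

Lemma config_left X j : is_config L X -> is_config L (X - unitm (ordS j)) = (gap L X j != 1).
Proof.
rewrite !config_cone => /forallP hX; apply/forallP/idP => [/(_ j)|hj k].
  rewrite inE gap_add !ffunE eqxx eq_sym (negPf (ordS_neq N2 j)) /=.
  by apply: contraTneq => ->.
have := hX k; rewrite !inE gap_add !ffunE (inj_eq (@ordS_inj N)) /= => hk.
have [e|ne] := eqVneq k j; last by case: eqP => _; lia.
move: hk hj; rewrite e [j == ordS j]eq_sym (negPf (ordS_neq N2 j)) /=.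
by move: (gap L X j) => z; lia.
Qed.

End Configurations.

Section JumpMean.
Context {R : realType} {N : nat}.
Variables (L : nat) (p q : R).
Hypotheses (N1 : (0 < N)%N) (L1 : (0 < L)%N).
Local Notation expo := {ffun 'I_N -> int}.
Implicit Types (X Y Z : expo) (f g : expo -> R).

(** Not normalised: the N clocks ring at total rate N, and the factor 1 / N of the
    jump chain is absorbed by (N t)^n. *)
Definition jump_mean f Z : R :=
  \sum_(i < N) (p * f (attempt_jump L Z i true) + q * f (attempt_jump L Z i false)).

Definition at_conf X Z : R := (Z == X)%:R.

Lemma mean_ext n f g Y : (forall Z, is_config L Z -> f Z = g Z) -> is_config L Y ->
  iter n jump_mean f Y = iter n jump_mean g Y.
Proof.
move=> h; elim: n Y => [|n IH] Y cY; first exact: h.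
by rewrite /= /jump_mean; apply: eq_bigr => i _; rewrite !IH //; exact: attempt_config.
Qed.

Lemma meanD n f g Y : iter n jump_mean (fun Z => f Z + g Z) Y =
  iter n jump_mean f Y + iter n jump_mean g Y.
Proof.
elim: n Y => // n IH Y /=; rewrite /jump_mean -big_split; apply: eq_bigr => i _ /=.
by rewrite !IH; ring.
Qed.

Lemma meanZ n c f Y : iter n jump_mean (fun Z => c * f Z) Y = c * iter n jump_mean f Y.
Proof.
elim: n Y => // n IH Y /=; rewrite /jump_mean mulr_sumr; apply: eq_bigr => i _ /=.
by rewrite !IH; ring.
Qed.

Lemma mean_sum n (f : 'I_N -> expo -> R) Y :
  iter n jump_mean (fun Z => \sum_i f i Z) Y = \sum_i iter n jump_mean (f i) Y.
Proof.
elim: n Y => // n IH Y /=; rewrite /jump_mean exchange_big /=; apply: eq_bigr => i _ /=.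
by rewrite !IH !mulr_sumr -big_split.
Qed.

(** A configuration is reached by moving a particle from the neighbouring site, or
    by a blocked attempt from itself. *)
Lemma attempt_at X Z i d : is_config L X -> is_config L Z ->
  at_conf X (attempt_jump L Z i d) =
  (is_config L (shift_particle X i (if d then -1 else 1)))%:R *
    at_conf (shift_particle X i (if d then -1 else 1)) Z +
  (~~ is_config L (shift_particle X i (if d then 1 else -1)))%:R * at_conf X Z.
Proof.
move=> cX cZ; rewrite /attempt_jump /at_conf.
have K (U V : expo) : (shift_particle U i (if d then 1 else -1) == V) =
    (U == shift_particle V i (if d then -1 else 1)).
  rewrite !shiftE; case: d; apply/eqP/eqP => [<-|->]; apply/ffunP => k;
    by rewrite !ffunE; case: eqP => _; rewrite /=; ring.
case cS: (is_config L (shift_particle Z i _)).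
  rewrite K; have [e|ne] := eqVneq Z X.
    rewrite e in cS *; rewrite cS mul0r addr0; case: eqP => [e'|_]; last by rewrite mulr0.
    by rewrite -e' cX mul1r.
  rewrite mulr0 addr0; case: eqP => [<-|_]; first by rewrite cZ mul1r.
  by rewrite mulr0.
have [e|ne] := eqVneq Z X.
  rewrite -e cS mul1r; suff -> : (Z == shift_particle Z i (if d then -1 else 1)) = false.
    by rewrite mulr0 add0r.
  by rewrite -K; apply/negP => /eqP e'; rewrite e' cZ in cS.
rewrite mulr0 addr0; case: eqP => [e|_]; last by rewrite mulr0.
by move/eqP: e; rewrite -K => /eqP e; rewrite e cX in cS.
Qed.

(** Conditioning on the last of the n + 1 jumps: the forward equation. *)
Lemma meanS n X Y : is_config L X -> is_config L Y ->
  iter n.+1 jump_mean (at_conf X) Y =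
  \sum_(i < N)
   (p * ((is_config L (X - unitm i))%:R * iter n jump_mean (at_conf (X - unitm i)) Y
       + (~~ is_config L (X + unitm i))%:R * iter n jump_mean (at_conf X) Y)
  + q * ((is_config L (X + unitm i))%:R * iter n jump_mean (at_conf (X + unitm i)) Y
       + (~~ is_config L (X - unitm i))%:R * iter n jump_mean (at_conf X) Y)).
Proof.
move=> cX cY; rewrite iterSr.
rewrite (mean_ext n (g := fun Z => \sum_(i < N)
   (p * ((is_config L (X - unitm i))%:R * at_conf (X - unitm i) Z
       + (~~ is_config L (X + unitm i))%:R * at_conf X Z)
  + q * ((is_config L (X + unitm i))%:R * at_conf (X + unitm i) Z
       + (~~ is_config L (X - unitm i))%:R * at_conf X Z))) _ cY).
  rewrite mean_sum; apply: eq_bigr => i _.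
  by rewrite meanD !meanZ !meanD !meanZ.
move=> Z cZ; apply: eq_bigr => i _.
by rewrite !(attempt_at _ _ cX cZ) shift_right shift_left.
Qed.

End JumpMean.

(** * Free evolution and boundary relation *)

Section Evolution.
Context {R : realType} {N : nat}.
Variables (L : nat) (p q r : R).
Hypotheses (N1 : (0 < N)%N) (L1 : (0 < L)%N).
Hypotheses (p0 : 0 < p) (q0 : 0 < q) (pq1 : p + q = 1) (adm : admissible_radius p q r).
Local Notation expo := {ffun 'I_N -> int}.
Local Notation b := (bethe p q).
Let r0 : 0 < r := adm_r0 adm.
Implicit Types (v w : @affine N) (X Z B : expo) (xi : 'I_N -> R[i]).
Variable Y : expo.

(** The energies without their constants -1, which only contribute exp (- N t). *)
Definition ham xi : R[i] := \sum_i (p%:C * (xi i)^-1 + q%:C * xi i).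

Definition lowered (n : nat) B : expo := [ffun i => B i - n%:Z].

Lemma ham_perm (s : 'S_N) xi : ham (fun i => xi (s i)) = ham xi.
Proof. by rewrite /ham [RHS](reindex_inj (@perm_inj _ s)). Qed.

Lemma mono_unitmN i xi : onT r xi -> mono (- unitm i) xi = (xi i)^-1.
Proof.
move=> h; apply: (mulIf (onT_neq0 r0 i h)); rewrite mulVf ?(onT_neq0 r0) //.
by rewrite -[X in _ * X](mono_unitm i xi) -(monoD r0) // addNr mono0.
Qed.

Lemma appr_ham : appr r (Qge (lowered 1 0)) ham.
Proof.
apply: appr_sum => i _; apply: apprD; apply: (apprZ r0).
  apply: (appr_ext (g := mono (- unitm i))) => [xi h|]; first exact: mono_unitmN.
  by apply: appr_mono => j; rewrite !ffunE; case: eqP.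
by apply: appr_var => j; rewrite !ffunE; case: eqP.
Qed.

Lemma appr_hamM n B (g : ('I_N -> R[i]) -> R[i]) : appr r (Qge B) g ->
  appr r (Qge (lowered n B)) (fun xi => ham xi ^+ n * g xi).
Proof.
move=> ga; elim: n => [|n IH].
  apply: (appr_ext (g := g)) => [xi _|]; first by rewrite mul1r.
  by apply: appr_weak ga => m h i; rewrite ffunE subr0.
apply: (appr_ext (g := fun xi => ham xi * (ham xi ^+ n * g xi))).
  by move=> xi _; rewrite exprS mulrA.
apply: (apprM r0 _ appr_ham IH) => a c h1 h2 i; have := h1 i; have := h2 i.
rewrite /lowered [(a + c) i]ffunE !ffunE /=.
by move: (a i) (c i) (B i) => x y z; rewrite intS; lia.
Qed.

(** The coefficient of t^n / n! in the term of w, before summation over w. *)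
Definition hcoef n w X : R[i] := coef r Y (fun xi => ham xi ^+ n * star L p q w (mono X) xi).

Lemma appr_hcoef n w X : appr r (Qge (lowered n (wact L w X)))
  (fun xi => ham xi ^+ n * star L p q w (mono X) xi).
Proof. by apply: appr_hamM; exact: (appr_star_mono L p0 q0 adm). Qed.

Lemma hcoef_ge n w X : hcoef n w X != 0 -> forall i, wact L w X i <= (Y + [ffun=> n%:Z]) i.
Proof.
apply: contra_neqP => h; apply: (coef_eq0 r0 (appr_hcoef n w X)) => h'.
apply: h => i; have := h' i; rewrite /lowered !ffunE.
by rewrite lerBlDr.
Qed.

Definition hbound n X : nat := absum X + absum (Y + [ffun=> n%:Z]).

Lemma hcoef_le n w X : hcoef n w X != 0 -> forall i, w.2 i <= (hbound n X)%:Z.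
Proof. by move=> /hcoef_ge/(act_le N1 L1). Qed.

Definition lamn n X : R[i] := fsum (fun w => (W0 w)%:R * hcoef n w X).

Lemma lamn_fin n X : fin (fun w => (W0 w)%:R * hcoef n w X).
Proof.
by apply: (@W0_finite _ _ _ (hbound n X)) => w /mulb_neq0[-> /hcoef_le].
Qed.

Lemma trans_mono w X xi : onT r xi ->
  mono (trans L w) xi * mono X (fun i => xi (w.1 i)) = mono (wact L w X) xi.
Proof.
move=> h; rewrite mono_perm -(monoD r0) //; congr (mono _ _).
by apply/ffunP => i; rewrite !ffunE addrC.
Qed.

Lemma hcoefS n w X : hcoef n.+1 w X =
  \sum_i (p%:C * hcoef n w (X - unitm i) + q%:C * hcoef n w (X + unitm i)).
Proof.
transitivity (coef r Y (fun xi => \sum_i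
   (p%:C * (ham xi ^+ n * star L p q w (mono (X - unitm i)) xi) +
    q%:C * (ham xi ^+ n * star L p q w (mono (X + unitm i)) xi)))).
  apply: (coef_ext r0 _ (appr_hcoef _ _ _)) => xi h.
  rewrite exprS -[X in X * _ * _](ham_perm w.1) [X in X * _ * _]/ham !mulr_suml; apply: eq_bigr => i _.
  rewrite /star !(monoD r0) ?mono_unitm ?mono_unitmN; try exact: onT_perm.
  move: (ham xi ^+ n) (Acoef _ _ _ _) (mono _ _) (mono _ _) ((xi (w.1 i))^-1) (xi (w.1 i)) => *; ring.
have aZ c X' : appr r (@anyexp N) (fun xi => c * (ham xi ^+ n * star L p q w (mono X') xi)).
  by apply: (apprZ r0); exact: appr_any (appr_hcoef _ _ _).
rewrite (coef_sum r0 _ (Q := @anyexp N)); last by move=> i _; exact: apprD.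
apply: eq_bigr => i _; rewrite (coefD r0 _ (aZ _ _) (aZ _ _)).
by rewrite !(coefZ r0 _ _ (appr_hcoef _ _ _)).
Qed.

(** [ham] is symmetric, hence commutes with the action, and multiplies the monomial
    by powers of single variables. *)
Lemma lamnS n X : lamn n.+1 X =
  \sum_i (p%:C * lamn n (X - unitm i) + q%:C * lamn n (X + unitm i)).
Proof.
rewrite /lamn; have ff c X' : fin (fun w => c * ((W0 w)%:R * hcoef n w X')).
  by apply: finZ; exact: lamn_fin.
under eq_bigr do rewrite -!fsumZ -fsumD //.
rewrite -fsum_sum; last by move=> i _; exact: finD.
apply: eq_fsum => w; rewrite hcoefS mulr_sumr; apply: eq_bigr => i _.
by rewrite mulrDr; congr (_ + _); exact: mulrCA.
Qed.

(** The kernel has the four properties on which [lam_delta] rests. *)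
Lemma lamn0 X : is_config L Y -> is_config L X -> lamn 0 X = (X == Y)%:R.
Proof.
rewrite !config_cone // => cY cX.
rewrite -(lam_delta N1 L1 (ker_ge p0 q0 adm) (ker_lead L p0 q0 adm) (ker_mul L p0 q0 adm) _ cY cX).
  apply: eq_fsum => w; congr (_ * _); apply: (coef_ext r0 _ (appr_hcoef _ _ _)) => xi _.
  by rewrite expr0 mul1r.
move=> J X' Z /existsP[i0 hi0] cX' cZ; exact: (ker_cone p0 q0 adm hi0 cX' cZ).
Qed.

Hypothesis N2 : (1 < N)%N.

Lemma amp_pair (e : 'I_N -> 'I_N -> int) i j xi : i != j ->
  e i j = -1 -> e j i = 1 -> (forall k l, (k, l) != (i, j) -> (k, l) != (j, i) -> e k l = 0) ->
  amp p q e xi = b (xi j) (xi i) / b (xi i) (xi j).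
Proof.
move=> ij eij eji e0; rewrite /amp pair_big /=.
rewrite (bigD1 (i, j)) //= eij mulrC; congr (_ * _).
rewrite (bigD1 (j, i)) /=; last by rewrite xpair_eqE negb_and eq_sym ij.
rewrite eji expr1z big1 ?mulr1 // => -[k l] /andP[h1 h2] /=.
by rewrite e0 ?expr0z.
Qed.

Lemma nij_refl (i : 'I_N) :
  [/\ nij (refl i) i (ordS i) = 1, nij (refl i) (ordS i) i = -1 &
   forall k l, (k, l) != (i, ordS i) -> (k, l) != (ordS i, i) -> nij (refl i) k l = 0].
Proof.
have ne := ordS_neq N2 i.
have key : nij (refl i) i (ordS i) = 1.
  rewrite /nij [(refl i).2]/= !ffunE !eqxx [(refl i).1]/= tpermV tpermL tpermR eq_sym (negPf ne).
  move: (val_ordS i) (ltn_ord i); rewrite /wrapz; move: (ordS i : nat) (i : nat) => a c.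
  by case: (c.+1 =P N) => h ->; rewrite /=; lia.
split => //.
  by have := nij_anti p0 q0 adm (refl i) i (ordS i); rewrite key; lia.
move=> k l h1 h2; rewrite /nij [(refl i).2]/= !ffunE [(refl i).1]/= tpermV.
have T (x : 'I_N) : (tperm i (ordS i) x : nat) =
    (if x == i :> nat then ordS i : nat else if x == ordS i :> nat then i : nat else x).
  case: tpermP => [->|->|/eqP h /eqP h']; rewrite ?eqxx //.
    by have -> : (ordS i == i :> nat) = (ordS i == i) by []; rewrite (negPf ne).
  have -> : (x == i :> nat) = (x == i) by []; rewrite (negPf h).
  by have -> : (x == ordS i :> nat) = (x == ordS i) by []; rewrite (negPf h').
have V (x y : 'I_N) : (x == y) = (x == y :> nat) by [].
rewrite !T; move: h1 h2; rewrite !xpair_eqE !V /wrapz.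
have vS := val_ordS i; have iN := ltn_ord i; have kN := ltn_ord k; have lN := ltn_ord l.
move: vS iN kN lN.
move: (ordS i : nat) (i : nat) (k : nat) (l : nat) => s i' k' l'; clear.
case: (i'.+1 =P N) => h -> iN kN lN.
  by case: (k' =P i'); case: (l' =P i'); case: (k' =P 0%N); case: (l' =P 0%N); rewrite /=; lia.
by case: (k' =P i'); case: (l' =P i'); case: (k' =P i'.+1); case: (l' =P i'.+1); rewrite /=; lia.
Qed.

(** The reflection contributes the sign -1 and exchanges the two Bethe factors of
    the particles that meet at the wall. *)
Lemma star_refl (i : 'I_N) X xi : onT r xi -> gap L X i = 0 ->
  star L p q (refl i) (fun xi => mono X xi * b (xi (ordS i)) (xi i)) xi =
  - (mono X xi * b (xi (ordS i)) (xi i)).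
Proof.
move=> h g0; have [n1 n2 n3] := nij_refl i; have ne := ordS_neq N2 i.
rewrite /star mulrA -(mulrA (Acoef _ _ _ _)) trans_mono //.
have -> : wact L (refl i) X = X.
  apply/ffunP => j; rewrite act_refl // ffunE; move: g0; rewrite /gap.
  rewrite mulrN opprK; case: (j =P i) => [->|_] /eqP; rewrite subr_eq0 => /eqP e; first by rewrite e.
  by case: (j =P ordS i) => [->|_] //; rewrite -e addrK.
rewrite /Acoef odd_refl // expr1 (@amp_pair _ i (ordS i)) 1?eq_sym //.
- rewrite /= tpermL tpermR.
  have b0 := bethe_neq0 adm i (ordS i) h.
  move: (mono X xi) (b (xi (ordS i)) (xi i)) (b _ _) b0 => x y z z0; by field.
- by rewrite n1.
- by rewrite n2 opprK.
- by move=> k l h1 h2; rewrite n3 ?oppr0.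
Qed.

(** By [star_refl] the terms of w and of w times the reflection in the wall cancel,
    when the monomial of X is multiplied by the Bethe factor of the two particles.
    Expanding this factor gives the three terms. *)
Lemma lamn_wall n (i : 'I_N) X : gap L X i = 0 ->
  p%:C * lamn n X + q%:C * lamn n (X + unitm i + unitm (ordS i)) = lamn n (X + unitm (ordS i)).
Proof.
move=> g0; pose G xi := mono X xi * b (xi (ordS i)) (xi i).
pose F w := (W0 w)%:R * coef r Y (fun xi => ham xi ^+ n * star L p q w G xi).
pose X1 := X + unitm i + unitm (ordS i); pose X2 := X + unitm (ordS i).
have GE xi : onT r xi -> G xi = p%:C * mono X xi + q%:C * mono X1 xi - mono X2 xi.
  by move=> h; rewrite /G /X1 /X2 !(monoD r0) // !mono_unitm /bethe; ring.
pose H X' w xi := ham xi ^+ n * star L p q w (mono X') xi.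
have aH X' w : appr r (@anyexp N) (H X' w) by exact: appr_any (appr_hcoef _ _ _).
have aHZ c X' w : appr r (@anyexp N) (fun xi => c * H X' w xi) by exact: (apprZ r0).
have HE w xi : onT r xi -> p%:C * H X w xi + q%:C * H X1 w xi + -1 * H X2 w xi =
    ham xi ^+ n * star L p q w G xi.
  move=> h; rewrite /H /star GE; last exact: onT_perm.
  move: (ham xi ^+ n) (Acoef _ _ _ _) (mono _ _) (mono _ _) (mono X1 _) (mono X2 _) => *; ring.
have aD w : appr r (@anyexp N) (fun xi => p%:C * H X w xi + q%:C * H X1 w xi).
  exact: apprD.
have FE w : F w = p%:C * ((W0 w)%:R * hcoef n w X) + q%:C * ((W0 w)%:R * hcoef n w X1)
    - (W0 w)%:R * hcoef n w X2.
  rewrite /F -(coef_ext r0 _ (apprD (aD w) (aHZ (-1) X2 w)) (HE w)).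
  rewrite (coefD r0 _ (aD w) (aHZ _ _ _)) (coefD r0 _ (aHZ _ _ _) (aHZ _ _ _)).
  by rewrite !(coefZ r0 _ _ (aH _ _)) /H -!/(hcoef n w _); ring.
have ff c X' : fin (fun w => c * ((W0 w)%:R * hcoef n w X')).
  by apply: finZ; exact: lamn_fin.
have F0 : fsum F = 0.
  have : fsum F = - fsum F.
    rewrite -{1}(fsum_bij _ (mulw_bijr (refl i))) -mulN1r -fsumZ.
    apply: eq_fsum => w; rewrite /F W0_mulr ?W0_refl // mulN1r -mulrN; congr (_ * _).
    have aF : appr r (@anyexp N) (fun xi => ham xi ^+ n * star L p q w G xi).
      exact: appr_ext (HE w) (apprD (aD w) (aHZ (-1) X2 w)).
    rewrite -mulN1r -(coefZ r0 _ _ aF).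
    apply/esym/(coef_ext r0 _ (apprZ r0 (-1) aF)) => xi h.
    rewrite (star_mul L adm) // mulN1r -mulrN; congr (_ * _).
    rewrite /star -mulrN; congr (_ * _); apply/esym.
    by rewrite -[RHS](star_refl _ g0) //; apply: onT_perm.
  by move/eqP; rewrite -addr_eq0 -mulr2n mulrn_eq0 => /eqP.
apply/eqP; rewrite -subr_eq0 -F0 /lamn -!fsumZ -fsumD // -fsumB; first last.
- exact: lamn_fin.
- exact: finD.
by apply/eqP/eq_fsum => w; rewrite FE.
Qed.

End Evolution.

Section JumpChain.
Context {R : realType} {N : nat}.
Variables (L : nat) (p q r : R).
Hypotheses (N1 : (0 < N)%N) (L1 : (0 < L)%N).
Hypotheses (p0 : 0 < p) (q0 : 0 < q) (pq1 : p + q = 1) (adm : admissible_radius p q r).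
Variable Y : {ffun 'I_N -> int}.
Hypotheses (cY : is_config L Y).

(** The free recursion of [lamnS] differs from the forward equation [meanS] in the
    terms that leave the alcove. Each wall contributes two of them, one for each of
    the particles that meet there, and [lamn_wall] turns them into the terms of the
    blocked attempts. *)
Lemma lamn_jump n X : is_config L X ->
  lamn L p q r Y n X = (iter n (jump_mean L p q) (at_conf X) Y)%:C.
Proof.
have C0 : (0 : R)%:C = 0 :> R[i] by [].
elim: n X => [|n IH] X cX.
  rewrite lamn0 //= /at_conf eq_sym; by case: eqP.
rewrite lamnS // meanS //.
transitivity (\sum_(i < N)
   (p%:C * ((is_config L (X - unitm i))%:R * lamn L p q r Y n (X - unitm i)
       + (~~ is_config L (X + unitm i))%:R * lamn L p q r Y n X)
  + q%:C * ((is_config L (X + unitm i))%:R * lamn L p q r Y n (X + unitm i)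
       + (~~ is_config L (X - unitm i))%:R * lamn L p q r Y n X))); last first.
  rewrite rmorph_sum; apply: eq_bigr => i _ /=.
  have E Z : (is_config L Z)%:R * lamn L p q r Y n Z =
      ((is_config L Z)%:R * iter n (jump_mean L p q) (at_conf Z) Y)%:C.
    by rewrite rmorphM /= rmorph_nat; case cZ: (is_config L Z); rewrite ?mul0r // IH.
  by rewrite !E IH // !(rmorphD, rmorphM) /= !rmorph_nat.
apply/eqP; rewrite -subr_eq0 -sumrB; apply/eqP.
have pqC : p%:C + q%:C = 1 :> R[i] by rewrite -rmorphD pq1.
transitivity (\sum_(i < N) ((~~ is_config L (X - unitm i))%:R *
    (p%:C * lamn L p q r Y n (X - unitm i) - q%:C * lamn L p q r Y n X)) +
  \sum_(i < N) ((~~ is_config L (X + unitm i))%:R *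
    (q%:C * lamn L p q r Y n (X + unitm i) - p%:C * lamn L p q r Y n X))).
  rewrite -big_split; apply: eq_bigr => i _ /=.
  by case: (is_config L (X - unitm i)); case: (is_config L (X + unitm i)); rewrite /=; ring.
have [N2|N2] := ltnP 1 N; last first.
  by rewrite !big1 ?addr0 // => i _; rewrite config1 ?mul0r //; lia.
rewrite (reindex_inj (@ordS_inj N)) -big_split big1 //= => j _.
rewrite config_left // config_right //; case: eqP => [g1|_]; last by rewrite !mul0r addr0.
rewrite !mul1r; pose X' := X - unitm (ordS j).
have g0 : gap L X' j = 0.
  by rewrite gap_add !ffunE eqxx eq_sym (negPf (ordS_neq N2 j)) g1.
have := lamn_wall N1 L1 p0 q0 adm Y N2 n g0.
rewrite /X' subrK [X - _ + _ + _]addrAC subrK => E.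
have -> : forall a c d : R[i], a - q%:C * d + (c - p%:C * d) = a + c - (p%:C + q%:C) * d.
  by move=> *; ring.
by rewrite pqC mul1r E subrr.
Qed.

End JumpChain.

(** * Exponential and double series *)

Section ExponentialSeries.
Context {R : realType}.

(** The partial sums of the exponential series, over R and over R[i]. *)
Definition psum {K : numFieldType} (n : nat) (z : K) : K := \sum_(k < n) z ^+ k / k`!%:R.

Lemma psum_mul {K : numFieldType} n (z w : K) : psum n z * psum n w - psum n (z + w) =
  \sum_(j < n) \sum_(l < n | (n <= j + l)%N) (z ^+ l / l`!%:R) * (w ^+ j / j`!%:R).
Proof.
pose F l j := (z ^+ l / l`!%:R) * (w ^+ j / j`!%:R) : K.
have -> : psum n (z + w) = \sum_(j < n) \sum_(l < n | (j + l < n)%N) F l j.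
  transitivity (\sum_(m < n) \sum_(j < n) \sum_(l < n) if (m == j + l :> nat)%N then F l j else 0).
    apply: eq_bigr => m _; rewrite exprDn mulr_suml (big_ord_widen n (fun j => z ^+ (m - j) * w ^+ j *+ 'C(m, j) / m`!%:R)) //.
    rewrite big_mkcond; apply: eq_bigr => j _; case: ltnP => jm.
      have lt : (m - j < n)%N by rewrite (leq_ltn_trans (leq_subr _ _)).
      rewrite -big_mkcond (big_pred1 (Ordinal lt)) => [|l]; last first.
        by rewrite /= -val_eqE /=; lia.
      rewrite /F /= -mulr_natr; have := bin_fact (jm : (j <= m)%N).
      have f0 k : (k`!%:R : K) != 0 by rewrite pnatr_eq0 -lt0n fact_gt0.
      move=> /(congr1 (fun k => k%:R : K)); rewrite !natrM => e.
      have -> : ('C(m, j)%:R : K) = m`!%:R / (j`!%:R * (m - j)`!%:R).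
        by rewrite -e mulfK // mulf_neq0.
      by field; rewrite !f0.
    rewrite big1 // => l _; case: eqP => // e; lia.
  rewrite exchange_big /=; apply: eq_bigr => j _; rewrite exchange_big /= [RHS]big_mkcond.
  apply: eq_bigr => l _; case: ltnP => jl.
    by rewrite -big_mkcond (big_pred1 (Ordinal jl)) // => m; rewrite -val_eqE.
  by rewrite big1 // => m _; case: eqP => // e; have := ltn_ord m; lia.
rewrite /psum big_distrlr /= exchange_big /= -sumrB; apply: eq_bigr => j _.
rewrite (bigID (fun l : 'I_n => (n <= j + l)%N)) /= -addrA -[RHS]addr0; congr (_ + _).
apply/eqP; rewrite subr_eq0; apply/eqP; apply: eq_bigl => l; by rewrite -ltnNge.
Qed.

(** Convergence stated with the real modulus. *)
Definition tends (u : nat -> R[i]) (v : R[i]) :=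
  forall e : R, 0 < e -> exists n0, forall n, (n0 <= n)%N -> nm (v - u n) <= e.

Lemma cvg_tends (u : nat -> R) (v : R) : u @ \oo --> v ->
  forall e : R, 0 < e -> exists n0, forall n, (n0 <= n)%N -> `|v - u n| <= e.
Proof.
move=> /cvgrPdist_le h e e0; have [n0 _ hn] := h e e0; exists n0 => n hn0; exact: hn.
Qed.

Lemma psum_series (x : R) n : psum n x = series (exp_coeff x) n.
Proof. by rewrite /psum /series /= big_mkord. Qed.

Lemma psum_cvg (x : R) : (fun n => psum n x) @ \oo --> expR x.
Proof.
rewrite (_ : (fun n => _) = series (exp_coeff x)); last by apply/funext => n; exact: psum_series.
exact: is_cvg_series_exp_coeff.
Qed.

Lemma psum_real (x : R) n : psum n (x%:C) = (psum n x)%:C :> R[i].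
Proof.
rewrite /psum rmorph_sum; apply: eq_bigr => k _ /=.
by rewrite rmorphM rmorphXn fmorphV rmorph_nat.
Qed.

Lemma psum_mon (x : R) n m : 0 <= x -> (n <= m)%N -> psum n x <= psum m x.
Proof.
move=> x0 h; rewrite !psum_series /series /= (big_cat_nat _ h) //= lerDl sumr_ge0 // => k _.
exact: exp_coeff_ge0.
Qed.

Lemma psum_le (x : R) n : 0 <= x -> psum n x <= expR x.
Proof.
move=> x0; apply/ler_addgt0Pr => e e0.
have [n0 h] := cvg_tends (@psum_cvg x) e0.
have := h _ (leq_maxl n0 n); have := psum_mon x0 (leq_maxr n0 n).
by move: (psum n x) (psum _ x) (expR x) => a c d h1; rewrite ler_norml => /andP[]; lra.
Qed.

Lemma cis_coeff (y : R) k : ('i * y%:C) ^+ k / k`!%:R = cos_coeff y k +i* sin_coeff y k.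
Proof.
have -> : (k`!%:R : R[i]) = (k`!%:R : R)%:C by rewrite rmorph_nat.
rewrite -fmorphV exprMn -rmorphXn -mulrA -rmorphM /=.
have i2 : ('i : R[i]) ^+ 2 = -1 by rewrite sqr_i.
rewrite -{1}(odd_double_half k) exprD -muln2 mulnC exprM i2 /cos_coeff /sin_coeff /=.
have -> : ((-1) ^+ k./2 : R[i]) = ((-1) ^+ k./2)%:C by rewrite rmorphXn rmorphN1.
have e : odd k -> k.-1./2 = k./2 by move=> ok; rewrite -[in LHS](odd_double_half k) ok /= doubleK.
rewrite -exprnP; case ok: (odd k); [rewrite e //|]; rewrite /= ?expr1 ?expr0 ?mul0r ?mul1r ?mulr1.
  by apply/eqP; rewrite eq_complex /=; apply/andP; split; apply/eqP; ring.
by apply/eqP; rewrite eq_complex /=; apply/andP; split; apply/eqP; ring.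
Qed.

Lemma psum_cis (y : R) n : psum n ('i * y%:C) = series (cos_coeff y) n +i* series (sin_coeff y) n.
Proof.
rewrite /psum /series /= !big_mkord; elim: n => [|n IH]; first by rewrite !big_ord0.
by rewrite !big_ord_recr /= IH cis_coeff.
Qed.

Lemma nm_term (z : R[i]) k : nm (z ^+ k / k`!%:R) = nm z ^+ k / k`!%:R.
Proof.
rewrite nmM nmX nmV; congr (_ / _).
by rewrite -(rmorph_nat (real_complex R)) nm_real normr_nat.
Qed.

(** Term by term, the error in the functional equation is bounded by the same error
    for the moduli, which is a real number and tends to zero. *)
Lemma psum_mul_close n (z w : R[i]) : nm (psum n z * psum n w - psum n (z + w)) <=
  psum n (nm z) * psum n (nm w) - psum n (nm z + nm w).
Proof.
rewrite !psum_mul; apply: le_trans (nm_sum _ _ _) _; apply: ler_sum => j _.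
apply: le_trans (nm_sum _ _ _) _; apply: ler_sum => l _.
by rewrite nmM !nm_term.
Qed.

Lemma psum_split {K : numFieldType} n m (z : K) : (n <= m)%N ->
  psum m z = psum n z + \sum_(k < m - n) z ^+ (n + k) / (n + k)`!%:R.
Proof.
move=> h; have [d ->] : exists d, m = (n + d)%N by exists (m - n)%N; rewrite subnKC.
by rewrite /psum addKn big_split_ord.
Qed.

Lemma nm_psum n (z : R[i]) : nm (psum n z) <= psum n (nm z).
Proof.
apply: le_trans (nm_sum _ _ _) _; apply: ler_sum => k _; by rewrite nm_term.
Qed.

Lemma cexpE (x y : R) : cexp (x +i* y) = (expR x)%:C * (cos y +i* sin y). Proof. by []. Qed.

(** Multiplicativity of the partial sums up to a vanishing error reduces the claim
    to the real and the imaginary axis. *)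
Lemma cexp_tends z : tends (fun n => psum n z) (cexp z).
Proof.
case: z => x y; pose w : R[i] := 'i * y%:C.
have zE : x +i* y = x%:C + w.
  by apply/eqP; rewrite eq_complex /=; apply/andP; split; apply/eqP; ring.
pose E n := `|expR x - psum n x| + expR `|x| *
  (`|cos y - series (cos_coeff y) n| + `|sin y - series (sin_coeff y) n|) +
  (psum n `|x| * psum n (nm w) - psum n (`|x| + nm w)).
have E0 : E @ \oo --> (`|expR x - expR x| + expR `|x| * (`|cos y - cos y| + `|sin y - sin y|) +
    (expR `|x| * expR (nm w) - expR (`|x| + nm w))).
  have ecv : psum ^~ x @ \oo --> expR x by exact: psum_cvg.
  apply: cvgD; last by apply: cvgB; [apply: cvgM; exact: psum_cvg|exact: psum_cvg].
  apply: cvgD; first by apply: cvg_norm; apply: cvgB => //; exact: cvg_cst.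
  apply: cvgMr; apply: cvgD; apply: cvg_norm; apply: cvgB; try exact: cvg_cst.
    by rewrite unlock; exact: is_cvg_series_cos_coeff.
  by rewrite unlock; exact: is_cvg_series_sin_coeff.
rewrite !subrr normr0 addr0 mulr0 addr0 expRD subrr addr0 in E0.
move=> e e0; have [n0 hn] := cvg_tends E0 e0; exists n0 => n /hn.
rewrite sub0r normrN => h; apply: le_trans (le_trans (ler_norm _) h); rewrite /E.
rewrite cexpE zE.
have -> : (expR x)%:C * (cos y +i* sin y) - psum n (x%:C + w) =
    ((expR x - psum n x)%:C * (cos y +i* sin y) +
     (psum n x)%:C * ((cos y +i* sin y) - psum n w)) + (psum n x%:C * psum n w - psum n (x%:C + w)).
  have -> : (expR x - psum n x)%:C = (expR x)%:C - (psum n x)%:C :> R[i] by rewrite rmorphB.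
  rewrite psum_real; move: ((expR x)%:C) ((psum n x)%:C) (psum n (x%:C + w)) (psum n w) (_ +i* _).
  by move=> *; ring.
apply: le_trans (nmD _ _) _; apply: lerD; last first.
  by have := psum_mul_close n (x%:C) w; rewrite nm_real.
apply: le_trans (nmD _ _) _; rewrite !nmM !nm_real -cisE nm_cis mulr1; apply: lerD => //.
apply: ler_pM; rewrite ?nm_ge0 //.
  rewrite -(nm_real (psum n x)) -psum_real; apply: le_trans (nm_psum _ _) _.
  by rewrite nm_real psum_le.
by rewrite cisE psum_cis; apply: le_trans (nm_leD _) _.
Qed.

Lemma cexp_unif (B e : R) : 0 <= B -> 0 < e ->
  exists n0, forall n, (n0 <= n)%N -> forall z : R[i], nm z <= B -> nm (cexp z - psum n z) <= e.
Proof.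
move=> B0 e0; have e2 : 0 < e / 2 by lra.
have [n0 h] := cvg_tends (@psum_cvg B) e2; exists n0 => n hn z zB.
have [m0 hm] := cexp_tends z e2.
have nm' := leq_maxr m0 n; have := hm _ (leq_maxl m0 n); set m := maxn m0 n in nm' *.
move=> h1; have -> : cexp z - psum n z = (cexp z - psum m z) + (psum m z - psum n z) by ring.
have h2 : nm (psum m z - psum n z) <= psum m B - psum n B.
  rewrite !(psum_split _ nm') !(addrC (psum n _)) !addrK.
  apply: le_trans (nm_sum _ _ _) _; apply: ler_sum => k _; rewrite nm_term.
  by rewrite ler_wpM2r ?invr_ge0 ?ler0n // lerXn2r ?nnegrE ?nm_ge0.
have h3 := psum_le m B0; have := h n hn; rewrite ler_norml => /andP[_ h4].
apply: le_trans (nmD _ _) _; lra.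
Qed.

Lemma cexpD (z w : R[i]) : cexp (z + w) = cexp z * cexp w.
Proof.
case: z => x y; case: w => x' y'; rewrite -[(_ +i* _) + _]/((x + x') +i* (y + y')) !cexpE.
rewrite expRD cosD sinD; apply/eqP; rewrite eq_complex /=; apply/andP; split; apply/eqP; ring.
Qed.

Lemma cexp_real (x : R) : cexp x%:C = (expR x)%:C.
Proof. by rewrite cexpE cos0 sin0 mulr1. Qed.

Lemma cexp_sum (I : Type) (s : seq I) (F : I -> R[i]) :
  \prod_(i <- s) cexp (F i) = cexp (\sum_(i <- s) F i).
Proof.
elim: s => [|i s IH]; last by rewrite !big_cons IH cexpD.
by rewrite !big_nil -[0]/(0%:C) cexp_real expR0.
Qed.

End ExponentialSeries.

Section DoubleSeries.
Context {R : realType} {I : choiceType}.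
Variables (D : set I) (u : I -> R[i]) (g : nat -> I -> R[i]) (S : nat -> seq I) (B : nat -> R).
(* u i is the sum of the series g k i over k; the k-th row has its support in S k
   and its absolute sum is at most B k. *)
Hypothesis S_uniq : forall k, uniq (S k).
Hypothesis S_in : forall k i, i \in S k -> D i.
Hypothesis S_supp : forall k i, D i -> g k i != 0 -> i \in S k.
Hypothesis S_bound : forall k, \sum_(i <- S k) nm (g k i) <= B k.
Hypothesis B_tail : forall e : R, 0 < e -> exists n0, forall n m, (n0 <= n)%N ->
  \sum_(n <= k < m) B k <= e.
Hypothesis B_sum : exists C, forall m, \sum_(0 <= k < m) B k <= C.
Hypothesis u_tends : forall i, D i -> tends (fun n => \sum_(k < n) g k i) (u i).

(** The sum over F of the tails is bounded by the tails of B, uniformly in F. *)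
Lemma row_close (F : seq I) n (C : R) : uniq F -> (forall i, i \in F -> D i) ->
  (forall m, \sum_(n <= k < m) B k <= C) ->
  \sum_(i <- F) nm (u i - \sum_(k < n) g k i) <= C.
Proof.
move=> uF FD hC; apply/ler_addgt0Pr => e e0.
pose e' := e / (size F).+1%:R; have e1 : 0 < e' by rewrite divr_gt0.
have [m nm' hm] : exists2 m, (n <= m)%N & forall i, i \in F ->
    nm (u i - \sum_(k < m) g k i) <= e'.
  have [m hm] : exists m, forall i, i \in F -> forall m', (m <= m')%N ->
      nm (u i - \sum_(k < m') g k i) <= e'.
    elim: (F) FD => [|i s IH] hD; first by exists 0%N.
    have [m1 h1] := IH (fun j js => hD j (mem_behead (s := i :: s) js)).
    have [m2 h2] := u_tends (hD i (mem_head _ _)) e1.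
    exists (maxn m1 m2) => j; rewrite inE => /orP[/eqP ->|js] m' hm'.
      by apply: h2; apply: leq_trans hm'; exact: leq_maxr.
    by apply: h1 => //; apply: leq_trans hm'; exact: leq_maxl.
  by exists (maxn n m); [exact: leq_maxl|move=> i iF; apply: hm => //; exact: leq_maxr].
apply: (le_trans (y := \sum_(i <- F) (e' + \sum_(n <= k < m) nm (g k i)))).
  rewrite big_seq [X in _ <= X]big_seq; apply: ler_sum => i iF.
  have -> : u i - \sum_(k < n) g k i = (u i - \sum_(k < m) g k i) + \sum_(n <= k < m) g k i.
    by rewrite -!(big_mkord predT (fun k => g k i)) (big_cat_nat _ nm') //= opprD addrA subrK.
  by apply: le_trans (nmD _ _) _; apply: lerD; [exact: hm|exact: nm_sum].
rewrite big_split /= addrC; apply: lerD.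
  rewrite exchange_big /=; apply: le_trans (hC m); apply: ler_sum => k _.
  apply: le_trans (S_bound k).
  rewrite (bigID (fun i => i \in S k)) /= [X in _ + X]big1_seq ?addr0; last first.
    move=> i /andP[iS iF]; have [->|h] := eqVneq (g k i) 0; first exact: nm0.
    by rewrite (S_supp (FD i iF) h) in iS.
  rewrite -big_filter (perm_big [seq i <- S k | i \in F]) /=.
    rewrite big_filter big_mkcond /=; apply: ler_sum => i _.
    by case: ifP => _; rewrite ?nm_ge0.
  apply: uniq_perm; rewrite ?filter_uniq // => i; by rewrite !mem_filter andbC.
rewrite big_const_seq count_predT iter_addr_0 -mulr_natr /e' -mulrA ler_piMr ?ltW //.
by rewrite mulrC ltr_pdivrMr // mul1r ltr_nat.
Qed.

Lemma fset_seq (A : set I) : fsets D A -> exists2 F, uniq F &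
  (forall i, i \in F -> D i) /\ A = [set` F].
Proof.
move=> [/finite_seqP[F AF] AD]; exists (undup F); first exact: undup_uniq.
split=> [i|]; last by rewrite AF; apply/seteqP; split => x /=; rewrite mem_undup.
by rewrite mem_undup => iF; apply: AD; rewrite AF.
Qed.

Lemma rows_summable : csummable D u.
Proof.
have [C hC] := B_sum.
rewrite /csummable /summable; apply: (@le_lt_trans _ _ C%:E); last exact: ltry.
apply: ub_ereal_sup => _ [A /fset_seq[F uF [FD ->]] <-].
rewrite -fsbig_seq // sumEFin lee_fin.
have := row_close (n := 0) uF FD hC; apply: le_trans.
by apply: ler_sum => i _; rewrite big_ord0 subr0 ger0_norm // nm_ge0.
Qed.

Lemma rsum_close (w : I -> R) : summable D (EFin \o w) -> forall e, 0 < e ->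
  exists2 F0 : seq I, uniq F0 /\ (forall i, i \in F0 -> D i) &
  forall F, uniq F -> (forall i, i \in F -> D i) -> {subset F0 <= F} ->
  `|rsum D w - \sum_(i <- F) w i| <= e.
Proof.
move=> sw e e0.
have part (v : I -> \bar R) (vr : I -> R) : (forall i, v i = (vr i)%:E) -> (forall i, 0 <= vr i) ->
    summable D v -> (\esum_(i in D) v i)%E \is a fin_num /\ exists2 F0 : seq I, uniq F0 /\ (forall i, i \in F0 -> D i) &
    forall F, uniq F -> (forall i, i \in F -> D i) -> {subset F0 <= F} ->
    fine (\esum_(i in D) v i) - e / 2 <= \sum_(i <- F) vr i <= fine (\esum_(i in D) v i).
  move=> vE v0 sv.
  have fin : (\esum_(i in D) v i)%E \is a fin_num.
    rewrite ge0_fin_numE; last by apply: esum_ge0 => i _; rewrite vE lee_fin.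
    move: sv; rewrite /summable; congr (_ < _)%E; apply: eq_esum => i _.
    by rewrite vE /= ger0_norm.
  have e2 : 0 < e / 2 by lra.
  have [_ [A /fset_seq[F0 uF0 [F0D ->]] <-]] := ub_ereal_sup_adherent e2 fin.
  rewrite -/(esum D v) -fsbig_seq // => h; split => //; exists F0 => // F uF FD sub.
  rewrite -!lee_fin EFinB fineK //; apply/andP; split.
    apply: le_trans (ltW h) _; under eq_bigr do rewrite vE.
    rewrite sumEFin lee_fin.
    rewrite [X in _ <= X](bigID (fun i => i \in F0)) /= -[X in X + _]big_filter.
    rewrite [X in _ <= X + _](perm_big F0) /=; first by rewrite lerDl sumr_ge0.
    apply: uniq_perm; rewrite ?filter_uniq // => i; rewrite mem_filter.
    by case i0: (i \in F0) => //=; rewrite sub.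
  apply: ereal_sup_ubound; exists [set` F]; first by split => //; exact: finite_seq.
  by rewrite -fsbig_seq // -sumEFin; apply: eq_bigr => i _; rewrite vE.
have pE i : ((EFin \o w)^\+ i)%E = (Num.max (w i) 0)%:E by rewrite funeposE /= EFin_max.
have nE i : ((EFin \o w)^\- i)%E = (Num.max (- w i) 0)%:E by rewrite funenegE /= EFin_max.
have ge0 (x : R) : 0 <= Num.max x 0 by rewrite le_max lexx orbT.
have [f1 [F1 [uF1 D1] h1]] := part _ _ pE (fun i => ge0 _) (summable_funepos sw).
have [f2 [F2 [uF2 D2] h2]] := part _ _ nE (fun i => ge0 _) (summable_funeneg sw).
exists (undup (F1 ++ F2)); first split; first exact: undup_uniq.
  by move=> i; rewrite mem_undup mem_cat => /orP[/D1|/D2].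
move=> F uF FD sub.
have s1 : {subset F1 <= F} by move=> i iF; apply: sub; rewrite mem_undup mem_cat iF.
have s2 : {subset F2 <= F} by move=> i iF; apply: sub; rewrite mem_undup mem_cat iF orbT.
have := h1 F uF FD s1; have := h2 F uF FD s2.
have -> : \sum_(i <- F) w i = \sum_(i <- F) Num.max (w i) 0 - \sum_(i <- F) Num.max (- w i) 0.
  by rewrite -sumrB; apply: eq_bigr => i _; rewrite /Num.max; case: ifP; case: ifP; lra.
rewrite /rsum fineB //.
move: (fine _) (fine _) (\sum_(i <- F) _) (\sum_(i <- F) _) => a c x y.
by rewrite ler_norml => /andP[a1 a2] /andP[c1 c2]; apply/andP; split; lra.
Qed.

Lemma rows_part (c : R[i] -> R) (V : R[i]) : (forall x y, c (x - y) = c x - c y) ->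
  (forall x, `|c x| <= nm x) ->
  tends (fun n => \sum_(k < n) \sum_(i <- S k) g k i) V -> rsum D (fun i => c (u i)) = c V.
Proof.
move=> cB cn hV.
have c0 : c 0 = 0 by have := cB 0 0; rewrite !subrr.
have cN x : c (- x) = - c x by rewrite -[in LHS](sub0r x) cB c0 sub0r.
have c_sum (F : seq I) : c (\sum_(i <- F) u i) = \sum_(i <- F) c (u i).
  elim: F => [|i F IH]; first by rewrite !big_nil.
  by rewrite !big_cons -[X in _ + X]opprK cB cN IH opprK.
have sw : summable D (EFin \o (fun i => c (u i))).
  apply: le_lt_trans rows_summable; apply: le_esum => i _ /=.
  by rewrite lee_fin; apply: le_trans (cn _) (ler_norm _).
apply/eqP; rewrite -subr_eq0 -normr_le0; apply/ler_addgt0Pr => e e0; rewrite add0r.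
have e3 : 0 < e / 3 by lra.
have [n1 hn1] := B_tail e3; have [n2 hn2] := hV _ e3.
pose n := maxn n1 n2; have nn1 : (n1 <= n)%N := leq_maxl _ _; have nn2 : (n2 <= n)%N := leq_maxr _ _.
have [F0 [uF0 F0D] hF0] := rsum_close sw e3.
pose F := undup (F0 ++ flatten [seq S k | k <- iota 0 n]).
have uF : uniq F by exact: undup_uniq.
have FD i : i \in F -> D i.
  rewrite mem_undup mem_cat => /orP[/F0D //|/flattenP[s /mapP[k _ ->]]]; exact: S_in.
have sub0 : {subset F0 <= F} by move=> i iF; rewrite mem_undup mem_cat iF.
have subS k : (k < n)%N -> {subset S k <= F}.
  move=> kn i iS; rewrite mem_undup mem_cat; apply/orP; right.
  by apply/flattenP; exists (S k) => //; apply/mapP; exists k; rewrite // mem_iota.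
have E : \sum_(i <- F) \sum_(k < n) g k i = \sum_(k < n) \sum_(i <- S k) g k i.
  rewrite exchange_big /=; apply: eq_bigr => k _.
  rewrite (bigID (fun i => i \in S k)) /= [X in _ + X]big1_seq ?addr0; last first.
    move=> i /andP[iS iF]; apply/eqP; apply: contraNT iS; exact: (S_supp (FD i iF)).
  rewrite -big_filter; apply: perm_big; apply: uniq_perm; rewrite ?filter_uniq // => i.
  by rewrite mem_filter; case iS: (i \in S k) => //=; rewrite (subS k).
have h1 := hF0 F uF FD sub0.
have h2 : nm (\sum_(i <- F) u i - V) <= e / 3 + e / 3.
  have -> : \sum_(i <- F) u i - V = \sum_(i <- F) (u i - \sum_(k < n) g k i) -
      (V - \sum_(k < n) \sum_(i <- S k) g k i) by rewrite sumrB E; ring.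
  apply: le_trans (nmB _ _) _; apply: lerD; last exact: hn2.
  apply: le_trans (nm_sum _ _ _) _; apply: row_close => // m; exact: hn1.
have h3 := le_trans (cn _) h2; rewrite cB c_sum in h3.
move: h1 h3; rewrite !ler_norml => /andP[a1 a2] /andP[b1 b2]; apply/andP; split; lra.
Qed.

(** The limit of the sums by rows is the sum of the family, as both are limits of
    sums over rectangles. *)
Lemma rows_sum (V : R[i]) : tends (fun n => \sum_(k < n) \sum_(i <- S k) g k i) V ->
  csum D u = V.
Proof.
move=> hV; rewrite /csum (@rows_part (@complex.Re R) V) //; first last.
- exact: nm_Re.
- by move=> [a b] [c d].
rewrite (@rows_part (@complex.Im R) V) //; first by case: V {hV}.
- by move=> [a b] [c d].
- exact: nm_Im.
Qed.

End DoubleSeries.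

(** * The contour integral formula as a Poisson mixture *)

Section PoissonExpansion.
Context {R : realType} {N : nat}.
Variables (L : nat) (p q r : R).
Hypotheses (N1 : (0 < N)%N) (L1 : (0 < L)%N).
Hypotheses (p0 : 0 < p) (q0 : 0 < q) (pq1 : p + q = 1) (adm : admissible_radius p q r).
Local Notation expo := {ffun 'I_N -> int}.
Local Notation b := (bethe p q).
Let r0 : 0 < r := adm_r0 adm.
Implicit Types (w : @affine N) (xi : 'I_N -> R[i]) (l : expo).
Variables (X Y : expo) (t : R).
Hypotheses (t0 : 0 <= t).

Lemma A_coefE (s : 'S_N) xi : onT r xi -> A_coef p q s xi =
  (-1) ^+ s * amp p q (fun i j => ((s^-1)%g i < (s^-1)%g j)%N%:Z - (i < j)%N%:Z) xi.
Proof.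
move=> h; rewrite /A_coef; congr (_ * _).
rewrite (ampD adm (fun i j => ((s^-1)%g i < (s^-1)%g j)%N%:Z) (fun i j => - (i < j)%N%:Z) h).
rewrite -(amp_perm p q (fun i j => (i < j)%N%:Z)) /amp -big_split; apply: eq_bigr => i _ /=.
rewrite big_mkcond -big_split; apply: eq_bigr => j _ /=.
by case: ltnP => _; rewrite ?expr1z ?expN1r //= mulr1.
Qed.

Lemma D_coefE l xi : onT r xi -> D_coef L p q l xi =
  mono (trans L (1%g, l)) xi * amp p q (fun i j => l j - l i) xi.
Proof.
move=> h; rewrite /D_coef /mono /amp.
have M (x y : R[i]) (z : int) : (x * y) ^ z = x ^ z * y ^ z by exact: expfzMl.
have E (I : finType) (f : I -> R[i]) (z : int) : (\prod_i f i) ^ z = \prod_i f i ^ z.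
  elim: (index_enum I) => [|i s IH]; first by rewrite !big_nil exp1rz.
  by rewrite !big_cons M IH.
transitivity (\prod_(j < N) (xi j ^ (L%:Z * l j) *
   (\prod_(k < N) b (xi k) (xi j) ^ l j * \prod_(k < N) b (xi j) (xi k) ^ (- l j)))).
  apply: eq_bigr => j _; rewrite M E exprnP exprz_exp; congr (_ * _).
  by rewrite -big_split; apply: eq_bigr => k _; rewrite M exprz_inv.
rewrite big_split /=; congr (_ * _); first by apply: eq_bigr => i _; rewrite ffunE.
rewrite big_split /= exchange_big /= -big_split; apply: eq_bigr => i _ /=.
rewrite -big_split; apply: eq_bigr => j _ /=.
by rewrite exprzDr // unitfE (bethe_neq0 adm).
Qed.

(** The factors of D and of A for the same pair of variables are gathered. *)
Lemma AD_coefE (s : 'S_N) l xi : onT r xi ->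
  A_coef p q s xi * D_coef L p q l xi = Acoef p q (s, l) xi * mono (trans L (s, l)) xi.
Proof.
move=> h; rewrite A_coefE // D_coefE // /Acoef -mulrA.
rewrite [amp _ _ _ _ * _]mulrCA -(ampD adm _ _ h) -[RHS]mulrA [RHS in _ = _ * RHS]mulrC.
congr (_ * (_ * _)); apply: amp_eq => i j; rewrite /nij /=.
have E (x y : 'I_N) : (x < y)%N%:Z + (y < x)%N%:Z = (x != y)%:Z.
  by rewrite -val_eqE /=; case: ltngtP.
have := E i j; have := E ((s^-1)%g i) ((s^-1)%g j); rewrite (inj_eq perm_inj).
move: (i < j)%N%:Z (j < i)%N%:Z (_ < _)%N%:Z (_ < _)%N%:Z (l i) (l j) (i != j)%:Z => *; lia.
Qed.

Lemma energy_prod xi : onT r xi ->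
  \prod_(j < N) cexp (energy p q (xi j) * t%:C) =
  (expR (- (N%:R * t)))%:C * cexp (t%:C * ham p q xi).
Proof.
move=> h; rewrite cexp_sum -cexp_real -cexpD; congr cexp.
rewrite /ham mulr_sumr -mulr_suml /energy sumrB mulrBl sumr_const card_ord.
rewrite addrC mulr_suml rmorphN rmorphM rmorph_nat.
by congr (_ + _); apply: eq_bigr => i _; exact: mulrC.
Qed.

Definition pois w xi : R[i] := cexp (t%:C * ham p q xi) * star L p q w (mono X) xi.

Lemma ham_bound : exists2 h : R, 0 <= h & forall xi, onT r xi -> nm (ham p q xi) <= h.
Proof.
have [h h0 hh] := appr_bnd r0 (@appr_ham R N p q r adm).
by exists h => //; exact: ltW.
Qed.

Definition psumH n w xi : R[i] :=
  \sum_(k < n) (t ^+ k / k`!%:R)%:C * (ham p q xi ^+ k * star L p q w (mono X) xi).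

Lemma psumHE n w xi : psumH n w xi = psum n (t%:C * ham p q xi) * star L p q w (mono X) xi.
Proof.
rewrite /psumH /psum mulr_suml; apply: eq_bigr => k _.
by rewrite exprMn rmorphM fmorphV rmorphXn rmorph_nat; ring.
Qed.

Lemma star_bnd w : exists2 M : R, 0 < M & forall xi, onT r xi -> nm (star L p q w (mono X) xi) <= M.
Proof. exact: (appr_bnd r0 (appr_star_mono L p0 q0 adm w X)). Qed.

Lemma pois_close w e : 0 < e -> exists n0, forall n, (n0 <= n)%N ->
  forall xi, onT r xi -> nm (pois w xi - psumH n w xi) <= e.
Proof.
move=> e0; have [h h0 hh] := ham_bound; have [M M0 hM] := star_bnd w.
have [n0 hn] := cexp_unif (mulr_ge0 t0 h0) (divr_gt0 e0 M0).
exists n0 => n n0n xi hxi; rewrite psumHE /pois -mulrBl nmM.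
rewrite -[X in _ <= X](divfK (lt0r_neq0 M0)); apply: ler_pM; rewrite ?nm_ge0 ?hM //.
apply: hn => //; rewrite nmM nm_real ger0_norm // ler_wpM2l // hh //.
Qed.

Lemma appr_psumH n w : appr r (@anyexp N) (psumH n w).
Proof.
apply: appr_sum => k _; apply: (apprZ r0).
exact: (appr_any (appr_hcoef N1 L1 p0 q0 adm k w X)).
Qed.

Lemma appr_pois w : appr r (@anyexp N) (pois w).
Proof.
apply: appr_lim => e e0; have [n0 hn] := pois_close w e0.
by exists (psumH n0 w); [exact: appr_psumH|exact: hn].
Qed.

(** The change of variables xi o s in the monomial is absorbed by [star], and the
    exponent - y - 1 of the integrand makes the integral a coefficient at Y. *)
Lemma LambdaE (s : 'S_N) l : Lambda L p q r Y l X t s =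
  (expR (- (N%:R * t)))%:C * coef r Y (pois (s, l)).
Proof.
have h1 xi : onT r xi -> (expR (- (N%:R * t)))%:C * pois (s, l) xi * mono (negm Y) xi =
    A_coef p q s xi * (\prod_(j < N) (xi (s j) ^ (X j - Y (s j) - 1) *
                    cexp (energy p q (xi j) * t%:C))) * D_coef L p q l xi.
  move=> h; rewrite big_split /= energy_prod // [RHS]mulrAC AD_coefE // /pois /star.
  have -> : \prod_(j < N) xi (s j) ^ (X j - Y (s j) - 1) =
      mono X (fun i => xi (s i)) * mono (negm Y) xi.
    rewrite [mono (negm Y) xi](reindex_inj (@perm_inj _ s)) /mono -big_split.
    apply: eq_bigr => j _ /=; rewrite ffunE -exprzDr; last by rewrite unitfE (onT_neq0 r0).
    by rewrite -addrA.
  move: (expR _)%:C (cexp _) (Acoef _ _ _ _) (mono _ _) (mono _ _) (mono _ _) => *; ring.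
have a1 : appr r (@anyexp N) (fun xi => (expR (- (N%:R * t)))%:C * pois (s, l) xi).
  exact/(apprZ r0)/appr_pois.
have a2 : appr r (@anyexp N) (fun xi =>
    (expR (- (N%:R * t)))%:C * pois (s, l) xi * mono (negm Y) xi).
  by apply: (apprM r0 _ a1 (appr_mono r (Q := @anyexp N) (m := negm Y) _)).
rewrite -(coefZ r0 _ _ (appr_pois _)); pose m1 : expo := [ffun=> -1].
have m10 : negm m1 = 0 by apply/ffunP => i; rewrite !ffunE opprK subrr.
have -> : coef r Y (fun xi => (expR (- (N%:R * t)))%:C * pois (s, l) xi) =
    coef r m1 (fun xi => (expR (- (N%:R * t)))%:C * pois (s, l) xi * mono (negm Y) xi).
  rewrite (coef_shift r0 _ _ a1); congr coef; apply/ffunP => i; rewrite !ffunE; ring.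
rewrite (coef_ext r0 _ a2 h1) /Lambda /coef m10; congr (_ * multi_circle_integral _ _).
by apply/funext => xi; rewrite mono0 mulr1.
Qed.

(** The exponential series converges uniformly on the torus, where [ham] is
    bounded. *)
Lemma pois_tends w : tends (fun n => \sum_(k < n) (t ^+ k / k`!%:R)%:C * hcoef L p q r Y k w X)
  (coef r Y (pois w)).
Proof.
move=> e e0; have K0 := kcoef_ge0 r0 Y.
have K1 : 0 < kcoef r Y + 1 by rewrite ltr_wpDl.
have [n0 hn] := pois_close w (divr_gt0 e0 K1); exists n0 => n n0n.
have <- : coef r Y (psumH n w) = \sum_(k < n) (t ^+ k / k`!%:R)%:C * hcoef L p q r Y k w X.
  rewrite (coef_sum r0 _ (Q := @anyexp N)).
    by apply: eq_bigr => k _; rewrite (coefZ r0 _ _ (appr_hcoef N1 L1 p0 q0 adm _ _ _)).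
  by move=> k _; apply: (apprZ r0); exact: (appr_any (appr_hcoef N1 L1 p0 q0 adm k w X)).
rewrite -(coefB adm _ (appr_pois w) (appr_psumH n w)).
apply: le_trans (coef_bnd r0 _ _ (hn n n0n)) _.
  apply: (appr_ext (g := fun xi => pois w xi + -1 * psumH n w xi)).
    by move=> xi _; rewrite mulN1r.
  by apply: apprD; [exact: appr_pois|apply: (apprZ r0); exact: appr_psumH].
rewrite mulrA ler_pdivrMr // mulrC ler_wpM2l ?(ltW e0) //.
by rewrite lerDl.
Qed.

End PoissonExpansion.

Section TendsTo.
Context {R : realType}.
Implicit Types (u v : nat -> R[i]) (a c : R[i]).

Lemma tendsD u v a c : tends u a -> tends v c -> tends (fun n => u n + v n) (a + c).
Proof.
move=> hu hv e e0; have e2 : 0 < e / 2 by lra.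
have [n1 h1] := hu _ e2; have [n2 h2] := hv _ e2; exists (maxn n1 n2) => n hn.
have -> : a + c - (u n + v n) = (a - u n) + (c - v n) by ring.
apply: le_trans (nmD _ _) _.
have := h1 n (leq_trans (leq_maxl _ _) hn); have := h2 n (leq_trans (leq_maxr _ _) hn); lra.
Qed.

Lemma tends_cst a : tends (fun=> a) a.
Proof. by move=> e e0; exists 0%N => n _; rewrite subrr nm0 ltW. Qed.

Lemma tendsZ c u a : tends u a -> tends (fun n => c * u n) (c * a).
Proof.
move=> hu e e0; have K0 : 0 < nm c + 1 by rewrite ltr_wpDl // nm_ge0.
have [n1 h1] := hu _ (divr_gt0 e0 K0); exists n1 => n hn.
rewrite -mulrBr nmM; apply: le_trans (ler_wpM2l (nm_ge0 _) (h1 n hn)) _.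
by rewrite mulrA ler_pdivrMr // mulrC ler_wpM2l ?(ltW e0) // lerDl.
Qed.

Lemma tends_sum (I : Type) (s : seq I) (u : I -> nat -> R[i]) (a : I -> R[i]) :
  (forall i, tends (u i) (a i)) -> tends (fun n => \sum_(i <- s) u i n) (\sum_(i <- s) a i).
Proof.
move=> h; elim: s => [|i s IH].
  rewrite big_nil (_ : (fun n => _) = fun=> 0); first exact: tends_cst.
  by apply/funext => n; rewrite big_nil.
rewrite big_cons (_ : (fun n => _) = fun n => u i n + \sum_(i <- s) u i n).
  exact: tendsD.
by apply/funext => n; rewrite big_cons.
Qed.

Lemma tends_ext u v a : (forall n, u n = v n) -> tends u a -> tends v a.
Proof. by move=> h; rewrite (_ : v = u) //; apply/funext => n; rewrite h. Qed.

End TendsTo.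

Lemma size_box {N : nat} (k : nat) (B : {ffun 'I_N -> int}) : size (box k B) = (k ^ N)%N.
Proof. by rewrite /box size_image card_ffun !card_ord. Qed.

Section Summation.
Context {R : realType} {N : nat}.
Variables (L : nat) (p q r : R).
Hypotheses (N1 : (0 < N)%N) (L1 : (0 < L)%N).
Hypotheses (p0 : 0 < p) (q0 : 0 < q) (pq1 : p + q = 1) (adm : admissible_radius p q r).
Local Notation expo := {ffun 'I_N -> int}.
Local Notation b := (bethe p q).
Let r0 : 0 < r := adm_r0 adm.
Implicit Types (w : @affine N) (xi : 'I_N -> R[i]) (l : expo).
Variables (X Y : expo) (t : R).
Hypotheses (t0 : 0 <= t) (cX : is_config L X) (cY : is_config L Y).

Lemma bethe_bounds : exists2 K : R, 1 <= K & forall xi, onT r xi ->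
  forall i j (z : int), nm (b (xi i) (xi j) ^ z) <= K ^+ `|z|%N.
Proof.
have d0 : 0 < p - r * (1 + q * r) by rewrite subr_gt0; exact: (adm_bound p0 q0 adm).
set d := p - _ in d0; pose K := 1 + (p + q * r * r + r) + d^-1.
have pr : 0 <= p + q * r * r + r.
  by rewrite !addr_ge0 // ?mulr_ge0 // ltW.
have di : 0 < d^-1 by rewrite invr_gt0.
exists K; first by rewrite /K; lra.
move=> xi h i j z; have nq : nm q%:C = q by rewrite nm_real gtr0_norm.
have np : nm p%:C = p by rewrite nm_real gtr0_norm.
have bK : nm (b (xi i) (xi j)) <= K.
  apply: le_trans (nmB _ _) _; apply: (le_trans (y := p + q * r * r + r)); last by rewrite /K; lra.
  by rewrite h lerD2r; apply: le_trans (nmD _ _) _; rewrite !nmM np nq !h.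
have bd : d <= nm (b (xi i) (xi j)).
  rewrite /d lerBlDr -{1}np.
  have -> : p%:C = b (xi i) (xi j) + xi i * (1 - q%:C * xi j) by rewrite /bethe; ring.
  apply: le_trans (nmD _ _) _; rewrite lerD2l nmM h; apply: ler_wpM2l; first exact: ltW.
  by apply: le_trans (nmB _ _) _; rewrite nmM nq h nm1.
have bV : nm (b (xi i) (xi j))^-1 <= K.
  rewrite nmV; apply: (le_trans (y := d^-1)); last by rewrite /K; lra.
  by rewrite lef_pV2 // posrE; apply: lt_le_trans bd.
case: z => n; first by rewrite -exprnP nmX lerXn2r ?nnegrE ?nm_ge0 // (le_trans _ bK) ?nm_ge0.
rewrite NegzE abszN absz_nat -exprnN -exprVn nmX.
by rewrite lerXn2r ?nnegrE ?nm_ge0 // (le_trans _ bV) ?nm_ge0.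
Qed.

Lemma nij_bound w (m : nat) i j : (forall i, `|w.2 i| <= m%:Z) -> (`|nij w i j| <= 2 * m + 2)%N.
Proof.
move=> h; rewrite /nij; have := h i; have := h j.
move: (w.2 i) (w.2 j) => x y.
by case: (_ < _)%N; case: (_ < _)%N; lia.
Qed.

Lemma star_bound : exists K : R, 1 <= K /\ forall m w, W0 w -> (forall i, `|w.2 i| <= m%:Z) ->
  forall xi, onT r xi -> nm (star L p q w (mono X) xi) <=
   r ^ tot X * (K ^+ (2 * m + 2)) ^+ (N * N).
Proof.
have [K K1 hK] := bethe_bounds; exists K; split => // m w w0 hw xi h.
rewrite (star_mono L adm) // nmM mulrC; apply: ler_pM; rewrite ?nm_ge0 //.
  by rewrite (nm_mono r0) // /msize -/(tot _) tot_act.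
rewrite /Acoef nmM nmX nmN nm1 expr1n mul1r /amp nm_prod.
have -> : (K ^+ (2 * m + 2)) ^+ (N * N) = \prod_(i < N) \prod_(j < N) K ^+ (2 * m + 2).
  under eq_bigr do rewrite prodr_const card_ord.
  by rewrite prodr_const card_ord exprM.
apply: ler_prod => i _; rewrite nm_ge0 andTb nm_prod; apply: ler_prod => j _.
rewrite nm_ge0 andTb; apply: le_trans (hK xi h i j _) _.
by rewrite ler_weXn2l // abszN nij_bound.
Qed.

(** A bound on l in the coefficient of t^k: each factor [ham] lowers exponents by
    at most one, and the sum of l is zero. *)
Definition width (k : nat) : nat := N.+1 * (absum X + absum Y + N * k).

Lemma hcoef_width k w : W0 w -> hcoef L p q r Y k w X != 0 -> forall i, `|w.2 i| <= (width k)%:Z.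
Proof.
move=> w0 /(hcoef_le N1 L1 p0 q0 adm) h.
have hb : (hbound Y k X <= absum X + absum Y + N * k)%N.
  rewrite /hbound -addnA leq_add2l /absum.
  have -> : (N * k)%N = (\sum_(i < N) k)%N by rewrite sum_nat_const card_ord.
  by rewrite -big_split; apply: leq_sum => i _; rewrite !ffunE /=; lia.
move=> i; have h1 := tot_bounded h (eqP w0) (isT : 0 <= (hbound Y k X)%:Z) i.
have h2 := h i; rewrite /width; move: hb h1 h2.
move: (hbound Y k X) (absum X + absum Y + N * k)%N (w.2 i) => a c x hac h1 h2.
rewrite ler_norml; apply/andP; split.
  apply: le_trans h1; rewrite lerN2 -PoszM lez_nat.
  by rewrite mulSn; apply: leq_trans (leq_addl _ _); rewrite leq_mul2l hac orbT.
by apply: le_trans h2 _; rewrite lez_nat mulSn (leq_trans hac) // leq_addr.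
Qed.

Definition row k : seq expo :=
  undup [seq l <- box (2 * width k).+1 [ffun=> - (width k)%:Z] | tot l == 0].

(** The contribution of l to the term of order k, all permutations together. *)
Definition rowterm k l : R[i] := (expR (- (N%:R * t)))%:C *
  \sum_(s : 'S_N) (t ^+ k / k`!%:R)%:C * hcoef L p q r Y k (s, l) X.

Lemma row_uniq k : uniq (row k). Proof. exact: undup_uniq. Qed.

Lemma row_in k l : l \in row k -> intvec_sum 0 l.
Proof. by rewrite mem_undup mem_filter => /andP[/eqP h _]. Qed.

Lemma rowP k l : intvec_sum 0 l -> (forall i, `|l i| <= (width k)%:Z) -> l \in row k.
Proof.
move=> h hl; rewrite mem_undup mem_filter; apply/andP; split; first exact/eqP.
by apply: boxP => i; rewrite ffunE; have := hl i; lia.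
Qed.

Lemma row_supp k l : intvec_sum 0 l -> rowterm k l != 0 -> l \in row k.
Proof.
move=> hl; rewrite mulf_eq0 negb_or => /andP[_ hs].
have [s hne] : exists s : 'S_N, hcoef L p q r Y k (s, l) X != 0.
  apply: contrapT => hn; move/eqP: hs; apply; apply: big1 => s _.
  suff -> : hcoef L p q r Y k (s, l) X = 0 by rewrite mulr0.
  by apply/eqP/negPn/negP => h; apply: hn; exists s.
by apply: rowP => //; apply: (hcoef_width _ hne); apply/eqP.
Qed.

(** Within distance [width k] the number of l and the size of the amplitude on the
    torus are both exponential in k, which the factorial compensates. *)
Lemma rows_bound : exists C D : R, 0 <= C /\ 0 <= D /\ forall k,
  \sum_(l <- row k) nm (rowterm k l) <= C * ((D * t) ^+ k / k`!%:R).
Proof.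
have [K [K1 hK]] := star_bound; have [h h0 hh] := @ham_bound R N p q r adm.
pose G := 3 ^+ N * K ^+ (2 * (N * N)) : R.
pose c0 := kcoef r Y * (r ^ tot X * K ^+ (2 * (N * N))).
pose P := \sum_(s : 'S_N) 1 : R.
have K0 : 0 <= K by apply: le_trans K1.
have G0 : 0 <= G by rewrite mulr_ge0 ?exprn_ge0.
have c00 : 0 <= c0.
  have rX : 0 <= r ^ tot X by apply/ltW/exprz_gt0.
  by apply: mulr_ge0; [exact: kcoef_ge0|rewrite mulr_ge0 ?exprn_ge0].
have P0 : 0 <= P by rewrite sumr_ge0.
exists (P * c0 * G ^+ (N.+1 * (absum X + absum Y))), (h * G ^+ (N.+1 * N)).
have Gx e : 0 <= G ^+ e by rewrite exprn_ge0.
split; first exact: (mulr_ge0 (mulr_ge0 P0 c00)).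
split; first exact: mulr_ge0.
move=> k; set m := width k; pose T := t ^+ k / k`!%:R.
have T0 : 0 <= T by rewrite divr_ge0 ?exprn_ge0 ?ler0n.
pose U := c0 * h ^+ k * K ^+ (2 * (N * N)) ^+ m.
have U0 : 0 <= U by rewrite (mulr_ge0 (mulr_ge0 c00 _)) ?exprn_ge0.
have hc s l : l \in row k -> nm (hcoef L p q r Y k (s, l) X) <= U.
  move=> lr; have w0 : W0 (s, l) by apply/eqP/(row_in lr).
  have [->|ne] := eqVneq (hcoef L p q r Y k (s, l) X) 0; first by rewrite nm0.
  have hw := hcoef_width w0 ne.
  apply: le_trans (coef_bnd r0 _ (appr_hcoef N1 L1 p0 q0 adm k (s, l) X)
     (e := h ^+ k * (r ^ tot X * (K ^+ (2 * m + 2)) ^+ (N * N))) _) _.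
    move=> xi hxi; rewrite nmM nmX; apply: ler_pM; rewrite ?exprn_ge0 ?nm_ge0 //.
      by rewrite lerXn2r ?nnegrE ?nm_ge0 // hh.
    exact: hK.
  rewrite /U /c0 le_eqVlt; apply/orP; left; apply/eqP.
  have -> : K ^+ (2 * m + 2) ^+ (N * N) = K ^+ (2 * (N * N)) * K ^+ (2 * (N * N)) ^+ m.
    by rewrite -!exprM -exprD mulnDl addnC mulnAC.
  by ring.
have h1 : \sum_(l <- row k) nm (rowterm k l) <= \sum_(l <- row k) (P * (T * U)).
  rewrite big_seq [X in _ <= X]big_seq; apply: ler_sum => l lr.
  rewrite /rowterm nmM nm_real ger0_norm ?expR_ge0 // -[X in _ <= X]mul1r.
  apply: ler_pM; rewrite ?expR_ge0 ?nm_ge0 //.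
    by rewrite expR_le1 oppr_le0 mulr_ge0.
  apply: le_trans (nm_sum _ _ _) _; rewrite /P mulr_suml; apply: ler_sum => s _.
  rewrite mul1r nmM nm_real ger0_norm //; apply: ler_wpM2l => //; exact: hc.
apply: le_trans h1 _; rewrite big_const_seq count_predT iter_addr_0 -[_ *+ size _]mulr_natr.
(* 2 m + 1 is at most 3^m. *)
have sz : (size (row k))%:R <= (3 ^+ N) ^+ m :> R.
  apply: (le_trans (y := ((2 * m).+1 ^ N)%N%:R)).
    rewrite ler_nat -(size_box _ ([ffun=> - m%:Z] : expo)).
    apply: leq_trans (size_undup _) _; rewrite size_filter; exact: count_size.
  rewrite natrX exprAC lerXn2r ?nnegrE ?exprn_ge0 ?ler0n //.
  rewrite -natrX ler_nat; clear; elim: m => // m IH.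
  by rewrite expnS; move: (3 ^ m)%N IH => a; lia.
apply: le_trans (ler_wpM2l _ sz) _; first exact: (mulr_ge0 P0 (mulr_ge0 T0 U0)).
rewrite le_eqVlt; apply/orP; left; apply/eqP.
have Gm : (3 ^+ N) ^+ m * K ^+ (2 * (N * N)) ^+ m =
    G ^+ (N.+1 * (absum X + absum Y)) * (G ^+ (N.+1 * N)) ^+ k.
  by rewrite -exprMn -/G -exprM -exprD /m /width mulnDr mulnA.
transitivity (P * T * c0 * h ^+ k * ((3 ^+ N) ^+ m * K ^+ (2 * (N * N)) ^+ m)).
  by rewrite /U; ring.
by rewrite Gm !exprMn /T; ring.
Qed.

Lemma row_sum k : \sum_(l <- row k) rowterm k l =
  (expR (- (N%:R * t)) * (t ^+ k / k`!%:R))%:C * lamn L p q r Y k X.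
Proof.
have -> a c : (a * c)%:C = a%:C * c%:C :> R[i] by rewrite rmorphM.
rewrite /rowterm -mulr_sumr -mulrA; congr (_ * _).
under eq_bigr do rewrite -mulr_sumr; rewrite -mulr_sumr; congr (_ * _).
rewrite /lamn (@fsum_undup _ _ [seq (s, l) | s <- enum 'S_N, l <- row k]); last first.
  move=> [s l] /mulb_neq0[w0 ne]; apply/allpairsP; exists (s, l); split => //=.
    by rewrite mem_enum.
  by apply: rowP; [exact/eqP|exact: (hcoef_width w0 ne)].
rewrite undup_id; last first.
  by apply: allpairs_uniq; rewrite ?enum_uniq ?row_uniq // => -[s l] [s' l'].
rewrite big_allpairs big_enum_cond /= exchange_big /=; apply: eq_bigr => s _.
rewrite big_seq [RHS]big_seq; apply: eq_bigr => l lr.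
have -> : W0 (s, l) by apply/eqP/(row_in lr).
by rewrite mul1r.
Qed.

Lemma u_tends l : intvec_sum 0 l -> tends (fun n => \sum_(k < n) rowterm k l) (u_term L p q r Y X t l).
Proof.
move=> _; rewrite /u_term; under eq_bigr do rewrite (LambdaE N1 L1 p0 q0 adm X Y t0).
apply: (tends_ext (u := fun n => \sum_(s : 'S_N) (expR (- (N%:R * t)))%:C *
    \sum_(k < n) (t ^+ k / k`!%:R)%:C * hcoef L p q r Y k (s, l) X)).
  move=> n; rewrite -mulr_sumr /rowterm -mulr_sumr; congr (_ * _); exact: exchange_big.
by apply: tends_sum => s; apply: tendsZ; exact: (pois_tends N1 L1 p0 q0 adm X Y t0).
Qed.

(** The double series over l and k is summed by rows, and [lamn_jump] identifies
    each row with an iterate of the jump chain. *)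
Theorem u_sum_expansion : csummable (intvec_sum 0) (u_term L p q r Y X t) /\
  forall v : R,
   (fun n => \sum_(k < n) expR (- (N%:R * t)) * (t ^+ k / k`!%:R) *
      iter k (jump_mean L p q) (at_conf X) Y) @ \oo --> v ->
   u_sum L p q r Y X t = v%:C.
Proof.
have [C [D [C0 [D0 hB]]]] := rows_bound.
pose B k := C * ((D * t) ^+ k / k`!%:R).
have Dt : 0 <= D * t by rewrite mulr_ge0.
have Bsum n m : (n <= m)%N -> \sum_(n <= k < m) B k = C * (psum m (D * t) - psum n (D * t)).
  move=> nm'; rewrite -mulr_sumr; congr (_ * _); rewrite !psum_series sub_series_geq //.
have B_tail (e : R) : 0 < e -> exists n0, forall n m, (n0 <= n)%N -> \sum_(n <= k < m) B k <= e.
  move=> e0; have C1 : 0 < C + 1 by lra.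
  have [n0 h] := cvg_tends (@psum_cvg R (D * t)) (divr_gt0 e0 C1).
  exists n0 => n m hn; have [nm'|mn] := leqP n m; last by rewrite big_geq ?ltW // ltnW.
  rewrite Bsum //; have := h n hn; rewrite ler_norml => /andP[_ h1].
  have h2 := psum_le m Dt.
  apply: (le_trans (y := (C + 1) * (e / (C + 1)))); last by rewrite mulrCA mulfV ?mulr1 // gt_eqF.
  apply: ler_pM => //; [by rewrite subr_ge0 psum_mon|by rewrite lerDl|].
  by apply: le_trans h1; rewrite lerD2r.
have B_sum : exists M, forall m, \sum_(0 <= k < m) B k <= M.
  exists (C * expR (D * t)) => m; rewrite Bsum // ler_wpM2l // lerBlDr.
  by rewrite (le_trans (psum_le m Dt)) // lerDl /psum big_ord0.
split; first exact: (rows_summable row_uniq row_supp hB B_sum u_tends).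
move=> v hv; apply: (rows_sum row_uniq row_in row_supp hB B_tail B_sum u_tends).
move=> e e0; have [n0 h] := cvg_tends hv e0; exists n0 => n hn; have := h n hn.
suff -> : \sum_(k < n) \sum_(i <- row k) rowterm k i =
  (\sum_(k < n) expR (- (N%:R * t)) * (t ^+ k / k`!%:R) *
      iter k (jump_mean L p q) (at_conf X) Y)%:C by rewrite -rmorphB nm_real.
rewrite rmorph_sum; apply: eq_bigr => k _ /=.
by rewrite row_sum (lamn_jump N1 L1 p0 q0 pq1 adm cY k cX) -rmorphM.
Qed.

End Summation.

(** * Integrating out one of several independent variables *)

Section Independence.
Context {d} {T : measurableType d} {R : realType} (P : probability T R).
Context {I : eqType} (F : I -> set (set T)).
Hypothesis Fm : forall i, F i `<=` measurable.
Hypothesis FT : forall i, F i setT.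
Hypothesis FI : forall i, setI_closed (F i).
Hypothesis ind : mutually_independent P F.
Variable a : I.

(** A pi-system that generates the sigma-algebra of all the variables but a. *)
Definition others : set (set T) := [set C | exists (s : seq I) (A : I -> set T),
  [/\ uniq s, a \notin s, forall j, j \in s -> F j (A j) & C = \big[setI/setT]_(j <- s) A j]].

Lemma big_setIE (s : seq I) (A : I -> set T) w :
  (\big[setI/setT]_(j <- s) A j) w <-> forall j, j \in s -> A j w.
Proof.
elim: s => [|i s IH]; first by rewrite big_nil; split.
rewrite big_cons; split=> [[hi /IH h] j|h].
  by rewrite inE => /orP[/eqP ->|/h].
by split; [apply: h; rewrite inE eqxx|apply/IH => j js; apply: h; rewrite inE js orbT].
Qed.

Lemma othersI : setI_closed others.
Proof.
move=> _ _ [s [A [us as_ FA ->]]] [s' [A' [us' as' FA' ->]]].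
exists (undup (s ++ s')), (fun j => (if j \in s then A j else setT) `&`
   (if j \in s' then A' j else setT)); split.
- exact: undup_uniq.
- by rewrite mem_undup mem_cat negb_or as_.
- move=> j _; apply: FI; case: ifP => h; [exact: FA|exact: FT|exact: FA'|exact: FT].
- apply/seteqP; split=> w.
    move=> [/big_setIE h /big_setIE h']; apply/big_setIE => j _; split; case: ifP => // hj.
      exact: h.
    exact: h'.
  move=> /big_setIE h; split; apply/big_setIE => j hj.
    by have := h j; rewrite /= mem_undup mem_cat hj => /(_ isT)[].
  by have := h j; rewrite /= mem_undup mem_cat hj orbT => /(_ isT)[].
Qed.

Lemma others_mem i A : i != a -> F i A -> others A.
Proof.
move=> ia FA; exists [:: i], (fun=> A); split => //.
- by rewrite inE eq_sym.
- by move=> j; rewrite inE => /eqP ->.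
- by rewrite big_cons big_nil setIT.
Qed.

Lemma othersT : others setT.
Proof. by exists [::], (fun=> setT); split => //; rewrite big_nil. Qed.

Lemma others_meas : others `<=` measurable.
Proof.
move=> _ [s [A [_ _ FA ->]]]; rewrite big_seq.
by apply: bigsetI_measurable => j js; exact/Fm/FA.
Qed.

Lemma others_sigma C : <<s others >> C -> measurable C.
Proof. by apply: smallest_sub; [exact: sigma_algebra_measurable|exact: others_meas]. Qed.

(** Both sides are finite measures of C that agree on the pi-system [others]. *)
Lemma others_ind A C : F a A -> <<s others >> C -> P (A `&` C) = (P A * P C)%E.
Proof.
move=> FA sC; have mA : measurable A by exact: Fm FA.
have fA : P A \is a fin_num by exact: fin_num_measure.
have x0 : 0 <= fine (P A) by exact: fine_ge0.
pose m1 : {measure set T -> \bar R} := mrestr P mA.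
pose m2 : {measure set T -> \bar R} := mscale (NngNum x0) P.
have /(_ C sC) : forall E, <<s others >> E -> m1 E = m2 E; last first.
  by rewrite /= /mrestr /mscale /= fineK// setIC.
apply: (g_sigma_algebra_measure_unique others others_meas (fun=> setT)).
- by move=> _; exact: othersT.
- by rewrite bigcup_const.
- exact: othersI.
- move=> _ [s [B [us as_ FB ->]]].
  rewrite /m1 /m2 /= /mrestr /mscale /= fineK// setIC.
  have := ind (s := a :: s) (A := fun j => if j == a then A else B j).
  rewrite /= as_ us => /(_ isT); rewrite !big_cons eqxx.
  have e (V : Type) (op : V -> V -> V) x (f : set T -> V) :
      \big[op/x]_(j <- s) f (if j == a then A else B j) = \big[op/x]_(j <- s) f (B j).
    by apply: eq_big_seq => j js; case: eqP => // ja; rewrite -ja js in as_.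
  rewrite (e _ setI setT id) => ->.
    rewrite (e _ _ _ P) -(ind us) //.
  move=> j; rewrite inE; case: eqP => [->|] //= _; exact: FB.
- by move=> k; rewrite /m1 /= /mrestr setTI -ge0_fin_numE.
Qed.

End Independence.

Section IntegrateOut.
Context {d} {T : measurableType d} {R : realType} (P : probability T R).
Context {I : eqType} (F : I -> set (set T)).
Hypothesis Fm : forall i, F i `<=` measurable.
Hypothesis FT : forall i, F i setT.
Hypothesis FI : forall i, setI_closed (F i).
Hypothesis ind : mutually_independent P F.
Variable a : I.
Context {d'} {T' : measurableType d'} (U : {RV P >-> T'}).
Hypothesis FU : forall V, measurable V -> F a (U @^-1` V).
Definition others_space : measurableType _ := g_sigma_algebraType (others F a).
Local Notation O := others_space.

Lemma measurable_id_others : measurable_fun setT (fun w : T => w : O).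
Proof. by move=> _ C sC; rewrite setTI; exact: (others_sigma Fm sC). Qed.

Definition to_others : T -> O := id.
HB.instance Definition _ := isMeasurableFun.Build _ _ T O to_others measurable_id_others.

(** The law of the pair formed by U and the point of the space, the latter with the
    sigma-algebra of the other variables, is a product by independence; the claim is
    Fubini for this product. *)
Lemma integrate_out (f : (T' * O)%type -> \bar R) :
  measurable_fun setT f -> (forall x, (0 <= f x)%E) ->
  (\int[P]_w f (U w, w) = \int[P]_w \int[distribution P U]_e f (e, w))%E.
Proof.
move=> mf f0.
pose Q := distribution P to_others.
have mJ : measurable_fun setT (fun w : T => (U w, w : O)).
  by apply/measurable_fun_pairP; split; [exact: measurable_funPT|exact: measurable_id_others].
pose J : {mfun T >-> (T' * O)%type} := HB.pack (fun w : T => (U w, w : O)) (isMeasurableFun.Build _ _ _ _ _ mJ).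
have e X : measurable X -> (distribution P U \x Q)%E X = distribution P J X.
  apply: product_measure_unique => A C mA mC.
  exact: (others_ind Fm FT FI ind (FU mA) mC).
have -> : (\int[P]_w f (U w, w) = \int[distribution P J]_z f z)%E.
  by rewrite ge0_integral_distribution.
have -> : (\int[distribution P J]_z f z = \int[distribution P U \x Q]_z f z)%E.
  by apply/esym; apply: eq_measure_integral => X mX _; exact: e.
rewrite fubini_tonelli2 //.
rewrite /Q ge0_integral_distribution //.
- exact: measurable_fun_fubini_tonelli_G.
- by move=> y; exact: integral_ge0.
Qed.

End IntegrateOut.

(** * Measurability and the exponential law *)

Section Measurability.
Context {d} {T : measurableType d} {R : realType}.

Lemma measurable_natb (f : T -> bool) :
  measurable_fun setT f -> measurable_fun setT (fun x => (f x)%:R : R).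
Proof.
move=> mf; rewrite (_ : (fun _ => _) = fun x => if f x then 1 else 0).
  exact: measurable_fun_if.
by apply/funext => x; case: (f x).
Qed.

Lemma measurable_bigprod (J : Type) (s : seq J) (f : J -> T -> R) :
  (forall j, measurable_fun setT (f j)) -> measurable_fun setT (fun x => \prod_(j <- s) f j x).
Proof.
move=> mf; elim: s => [|j s IH].
  by rewrite (_ : (fun _ => _) = cst 1) //; apply/funext => x; rewrite big_nil.
rewrite (_ : (fun _ => _) = fun x => f j x * \prod_(i <- s) f i x).
  exact: measurable_funM.
by apply/funext => x; rewrite big_cons.
Qed.

Lemma measurable_bigsum (J : Type) (s : seq J) (f : J -> T -> R) :
  (forall j, measurable_fun setT (f j)) -> measurable_fun setT (fun x => \sum_(j <- s) f j x).
Proof.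
move=> mf; elim: s => [|j s IH].
  by rewrite (_ : (fun _ => _) = cst 0) //; apply/funext => x; rewrite big_nil.
rewrite (_ : (fun _ => _) = fun x => f j x + \sum_(i <- s) f i x).
  exact: measurable_funD.
by apply/funext => x; rewrite big_cons.
Qed.

End Measurability.

Lemma is_derive_pow {R : realType} (b x c : R) n :
  is_derive x 1 (fun x : R => (b - x) ^+ n * c) (- (n%:R * (b - x) ^+ n.-1) * c).
Proof.
have h : is_derive x 1 (fun x : R => b - x) (-1).
  by apply: is_derive_eq; rewrite add0r mul1r.
have h3 : is_derive x 1 (fun x : R => (b - x) ^+ n) (- (n%:R * (b - x) ^+ n.-1)).
  rewrite (_ : (fun x : R => (b - x) ^+ n) = (fun x => b - x) ^+ n); last first.
    by apply/funext => y; rewrite exprfctE.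
  by apply: is_derive_eq; rewrite /GRing.scale /=; ring.
rewrite (_ : (fun x0 : R => (b - x0) ^+ n * c) = c *: (fun x : R => (b - x) ^+ n)).
  by apply: is_derive_eq; rewrite /GRing.scale /=; ring.
by apply/funext => y; exact: mulrC.
Qed.

Section ExponentialLaw.
Context {R : realType} (nu : probability (measurableTypeR R) R).
Hypothesis nuE : forall A : set R, measurable A -> nu A = exponential_prob 1 A.
Local Notation mu := (@lebesgue_measure R).
Local Notation pdf := (fun x : R => (exponential_pdf 1 x)%:E).

Lemma measurable_pdf D : measurable_fun D pdf.
Proof.
by apply/measurable_funTS; apply/measurable_EFinP; apply: measurable_exponential_pdf.
Qed.

Lemma law_dominated : nu `<< mu.
Proof.
apply/null_content_dominatesP => A mA A0.
by rewrite nuE // /exponential_prob null_set_integral //; exact: measurable_pdf.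
Qed.

(** The density agrees almost everywhere with the Radon-Nikodym derivative, for which
    the change of variables is classical. *)
Lemma integral_law (f : R -> \bar R) : measurable_fun setT f -> (forall x, (0 <= f x)%E) ->
  (\int[nu]_x f x = \int[mu]_x (f x * pdf x))%E.
Proof.
move=> mf f0; rewrite -(Radon_Nikodym_SigmaFinite.change_of_variables law_dominated) //.
have mg : mu.-integrable setT (Radon_Nikodym_SigmaFinite.f nu mu).
  by apply: Radon_Nikodym_SigmaFinite.f_integrable; exact: law_dominated.
have mg' := measurable_int _ mg.
apply: ge0_ae_eq_integral => //.
- exact: emeasurable_funM.
- by apply: emeasurable_funM => //; exact: measurable_pdf.
- by move=> x _; apply: mule_ge0 => //; apply: Radon_Nikodym_SigmaFinite.f_ge0; exact: law_dominated.
- by move=> x _; apply: mule_ge0 => //; rewrite lee_fin exponential_pdf_ge0.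
- apply: ae_eqe_mul2l; apply: integral_ae_eq => //; first exact: measurable_pdf.
  move=> E _ mE; rewrite -(Radon_Nikodym_SigmaFinite.f_integral law_dominated) //.
  exact: nuE.
Qed.

Lemma law_neg : nu `]-oo, 0[%classic = 0%E.
Proof.
rewrite nuE // /exponential_prob integral0_eq // => x /=.
by rewrite in_itv /= => x0; rewrite lt0_exponential_pdf.
Qed.

Lemma law_tail (b : R) : 0 <= b -> nu `]b, +oo[%classic = (expR (- b))%:E.
Proof.
move=> b0.
have e1 : nu `[0, b]%classic = (1 - (expR (- b))%:E)%E.
  rewrite nuE //; move: b0; rewrite le_eqVlt => /orP[/eqP <-|b0].
    by rewrite set_itv1 /exponential_prob integral_set1 oppr0 expR0 subee.
  by rewrite exponential_prob_itv0c // mulN1r.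
have e2 : nu `]-oo, b]%classic = (1 - (expR (- b))%:E)%E.
  have -> : `]-oo, b]%classic = `]-oo, 0[%classic `|` `[0, b]%classic :> set R.
    by rewrite -itv_bndbnd_setU ?bnd_simp.
  rewrite measureU //.
    by have := law_neg; rewrite /= => ->; rewrite add0e.
  by apply/seteqP; split=> x //=; rewrite !in_itv /= => -[h /andP[]]; rewrite leNgt h.
rewrite -setCitvl probability_setC // e2 oppeB; last by [].
by rewrite addeA subee // add0e.
Qed.

Definition late (s : bool) (a x : R) := if s then a < x else a <= x.

Definition window s k (a b x : R) := (late s a x && (x <= b))%:R *
  ((b - x) ^+ k / k`!%:R * expR (- (b - x))).

Lemma window_ge0 s k a b x : 0 <= window s k a b x.
Proof.
rewrite /window; case: andP => [[_ xb]|_]; last by rewrite mul0r.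
by rewrite mul1r mulr_ge0 ?expR_ge0 // divr_ge0 // exprn_ge0 // subr_ge0.
Qed.

Lemma measurable_window s k a b : measurable_fun setT (window s k a b).
Proof.
apply: measurable_funM.
  apply: measurable_natb; apply: measurable_and => //; last exact: measurable_fun_ler.
  by rewrite /late; case: (s); [exact: measurable_fun_ltr|exact: measurable_fun_ler].
apply: measurable_funM.
  by apply: measurable_funM => //; apply: measurable_funX; exact: measurable_funB.
by apply: measurableT_comp => //; apply: measurableT_comp => //; exact: measurable_funB.
Qed.

(** The density cancels the factor exp x, and a power of b - x is left to
    integrate. *)
Lemma law_window s k (a b : R) : 0 <= a -> a <= b ->
  (\int[nu]_x (window s k a b x)%:E =
   ((b - a) ^+ k.+1 / (k.+1)`!%:R * expR (- b))%:E)%E.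
Proof.
move=> a0 ab.
rewrite integral_law; last first.
- by move=> x; rewrite lee_fin; exact: window_ge0.
- by apply/measurable_EFinP; exact: measurable_window.
pose g x := (b - x) ^+ k / k`!%:R * expR (- b).
transitivity (\int[mu]_(x in `[a, b]) (g x)%:E)%E.
  transitivity (\int[mu]_(x in [set` Interval (if s then BRight a else BLeft a) (BRight b)]) (g x)%:E)%E.
    rewrite [RHS]integral_mkcond; apply: eq_integral => x _; rewrite patchE /window.
    have -> : (x \in [set` Interval (if s then BRight a else BLeft a) (BRight b)]) = late s a x && (x <= b).
      by rewrite mem_setE; case: (s); rewrite in_itv.
    case: andP => [[ax xb]|_]; last by rewrite mul0r mul0e.
    have x0 : 0 <= x by move: ax; rewrite /late; case: (s) => [/ltW|]; apply: le_trans.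
    rewrite exponential_pdfE // -EFinM; congr (_%:E).
    have -> : expR (- (b - x)) = expR (- b) * expR x by rewrite -expRD; congr expR; lra.
    rewrite !mul1r mulN1r /g -[in RHS](mulr1 (expR (- b))) -(expRxMexpNx_1 x); ring.
  case: (s) => //; rewrite integral_itv_obnd_cbnd //.
  apply: measurable_funTS; apply/measurable_EFinP; apply: measurable_funM => //.
  by apply: measurable_funM => //; apply: measurable_funX; exact: measurable_funB.
move: ab; rewrite le_eqVlt => /orP[/eqP <-|ab].
  by rewrite set_itv1 integral_set1 subrr expr0n /= mul0r mul0r.
pose G x := (b - x) ^+ k.+1 * (- (expR (- b) / (k.+1)`!%:R)).
have dG x : is_derive (x : R) 1 G (g x).
  apply: (is_derive_eq (is_derive_pow b x _ k.+1)); rewrite /g factS natrM /=.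
  by field; rewrite (addrC 1) natr1 !pnatr_eq0 -lt0n fact_gt0.
have cont (f : R -> R) : (forall x, derivable f x 1) -> continuous f.
  by move=> df x; apply: differentiable_continuous; apply/derivable1_diffP.
have cg : continuous g.
  by apply: cont => x; rewrite (_ : g = fun x => (b - x) ^+ k * (expR (- b) / k`!%:R));
    [apply: ex_derive; exact: is_derive_pow|apply/funext => y; rewrite /g; ring].
have cG : continuous G.
  by apply: cont => x; exact: ex_derive.
have Gb : G b = 0 by rewrite /G subrr expr0n mul0r.
rewrite (@continuous_FTC2 _ _ G) //.
- by rewrite Gb /G -EFinB sub0r mulrN opprK mulrCA mulrA; congr (_%:E); ring.
- exact: continuous_subspaceT.
- split.
  + by move=> z _; exact: ex_derive.
  + by apply: cvg_at_right_filter; exact: cG.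
  + by apply: cvg_at_left_filter; exact: cG.
- by move=> z _; rewrite derive1E; exact: derive_val.
Qed.

End ExponentialLaw.

Section ExponentialVariable.
Context {R : realType} (nu : probability R R).
Hypothesis nuE : forall A : set R, measurable A -> nu A = exponential_prob 1 A.

(** Two measurable structures on the real line occur, with the same measurable
    sets: the one of random variables and the one of Lebesgue measure. *)
Definition to_borel : R -> measurableTypeR R := id.

Lemma measurable_to_borel : measurable_fun setT to_borel.
Proof. by move=> _ A mA; rewrite setTI. Qed.

HB.instance Definition _ := isMeasurableFun.Build _ _ R (measurableTypeR R) to_borel measurable_to_borel.

Local Notation nu' := (distribution nu to_borel).

Lemma exp_neg : nu `]-oo, 0[%classic = 0%E.
Proof. exact: (law_neg (nu := nu') nuE). Qed.

Lemma exp_tail (b : R) : 0 <= b -> nu `]b, +oo[%classic = (expR (- b))%:E.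
Proof. exact: (law_tail (nu := nu') nuE). Qed.

Lemma exp_window s k (a b : R) : 0 <= a -> a <= b ->
  (\int[nu]_x (window s k a b x)%:E = ((b - a) ^+ k.+1 / (k.+1)`!%:R * expR (- b))%:E)%E.
Proof.
move=> a0 ab; rewrite -(law_window (nu := nu') nuE s k a0 ab).
rewrite ge0_integral_distribution //; last by move=> x; rewrite lee_fin; exact: window_ge0.
by apply/measurable_EFinP; exact: measurable_window.
Qed.

End ExponentialVariable.

(** * Probability of a succession of rings *)

Section Clocks.
Context {d} {T : measurableType d} {R : realType} (P : probability T R) {N : nat} (p : R).
Variables (E : 'I_N -> nat -> {RV P >-> R}) (B : 'I_N -> nat -> {RV P >-> bool}).
Hypothesis clocks : asep_clocks p E B.
Hypothesis p01 : 0 <= p <= 1.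
Local Notation clk := ('I_N -> nat -> R).
Local Notation coin := ('I_N -> nat -> bool).
Implicit Types (x : clk) (b : coin) (Phi Psi : clk -> coin -> R).

Definition clk_of (w : T) : clk := fun i k => E i k w.
Definition coin_of (w : T) : coin := fun i k => B i k w.

Definition set_at {V : Type} (x : 'I_N -> nat -> V) i k e : 'I_N -> nat -> V :=
  fun j m => if (j, m) == (i, k) then e else x j m.

(** Measurability in whatever space the waiting times and directions are defined:
    it is used in the probability space and in its product with the range of the
    variable that is integrated out. *)
Definition functional Phi := forall d' (T' : measurableType d')
  (X : 'I_N -> nat -> T' -> R) (b : 'I_N -> nat -> T' -> bool),
  (forall i k, measurable_fun setT (X i k)) -> (forall i k, measurable_fun setT (b i k)) ->
  measurable_fun setT (fun w => Phi (fun i k => X i k w) (fun i k => b i k w)).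

Definition family (a : ('I_N * nat) + ('I_N * nat)) : set (set T) :=
  match a with
  | inl (i, k) => preimage_set_system setT (E i k) measurable
  | inr (i, k) => preimage_set_system setT (B i k) measurable
  end.

Lemma family_meas a : family a `<=` measurable.
Proof. by case: a => -[i k] _ [V mV <-]; rewrite setTI; exact: measurable_funPTI. Qed.

Lemma familyT a : family a setT.
Proof. by case: a => -[i k]; exists setT; rewrite ?setTI. Qed.

Lemma familyI a : setI_closed (family a).
Proof.
by case: a => -[i k] _ _ [V mV <-] [W mW <-]; exists (V `&` W);
  rewrite ?setTI ?preimage_setI //; exact: measurableI.
Qed.

Lemma family_ind : mutually_independent P family.
Proof. by have [_ _] := clocks. Qed.

Lemma measurable_clock_others a i k : inl (i, k) != a ->
  measurable_fun setT (fun w : others_space family a => E i k w).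
Proof.
move=> ne _ V mV; rewrite setTI; apply: sub_sigma_algebra.
by apply: (others_mem ne); exists V; rewrite ?setTI.
Qed.

Lemma measurable_coin_others a i k : inr (i, k) != a ->
  measurable_fun setT (fun w : others_space family a => B i k w).
Proof.
move=> ne _ V mV; rewrite setTI; apply: sub_sigma_algebra.
by apply: (others_mem ne); exists V; rewrite ?setTI.
Qed.

(** The integrand is a function of the waiting time and of the remaining variables,
    which are independent of it. *)
Lemma integrate_clock Phi Psi i k : (forall x b, 0 <= Phi x b) -> functional Phi ->
  (forall x b, (\int[distribution P (E i k)]_e (Phi (set_at x i k e) b)%:E = (Psi x b)%:E)%E) ->
  (\int[P]_w (Phi (clk_of w) (coin_of w))%:E = \int[P]_w (Psi (clk_of w) (coin_of w))%:E)%E.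
Proof.
move=> Phi0 mPhi h; pose O := others_space family (inl (i, k)).
pose f (z : R * O) := (Phi (set_at (clk_of z.2) i k z.1) (coin_of z.2))%:E.
transitivity (\int[P]_w f (E i k w, w))%E.
  apply: eq_integral => w _; rewrite /f /=; congr ((Phi _ _)%:E).
  by apply/funext => j; apply/funext => m; rewrite /set_at; case: eqP => // -[-> ->].
rewrite (integrate_out family_meas familyT familyI family_ind (a := inl (i, k))) //.
- by apply: eq_integral => w _; rewrite -h.
- by move=> V mV; exists V; rewrite ?setTI.
- apply/measurable_EFinP.
  apply: (mPhi _ _ (fun j m (z : R * O) => if (j, m) == (i, k) then z.1 else E j m z.2)
     (fun j m (z : R * O) => B j m z.2)) => j m.
    case: eqP => [_|/eqP ne]; first exact: measurable_fst.
    apply: (measurableT_comp (f := fun w : O => E j m w)); last exact: measurable_snd.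
    by apply: measurable_clock_others.
  apply: (measurableT_comp (f := fun w : O => B j m w)); last exact: measurable_snd.
  exact: measurable_coin_others.
- by move=> z; rewrite lee_fin.
Qed.

Lemma integrate_coin Phi Psi i k : (forall x b, 0 <= Phi x b) -> functional Phi ->
  (forall x b, p * Phi x (set_at b i k true) + (1 - p) * Phi x (set_at b i k false) = Psi x b) ->
  (\int[P]_w (Phi (clk_of w) (coin_of w))%:E = \int[P]_w (Psi (clk_of w) (coin_of w))%:E)%E.
Proof.
move=> Phi0 mPhi h; pose O := others_space family (inr (i, k)).
pose f (z : bool * O) := (Phi (clk_of z.2) (set_at (coin_of z.2) i k z.1))%:E.
transitivity (\int[P]_w f (B i k w, w))%E.
  apply: eq_integral => w _; rewrite /f /=; congr ((Phi _ _)%:E).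
  by apply/funext => j; apply/funext => m; rewrite /set_at; case: eqP => // -[-> ->].
rewrite (integrate_out family_meas familyT familyI family_ind (a := inr (i, k))) //.
- apply: eq_integral => w _; rewrite -h.
  rewrite (eq_measure_integral (bernoulli_prob p)); last first.
    by move=> A mA _; have [_ + _] := clocks; apply.
  by rewrite integral_bernoulli_prob // => e; rewrite lee_fin.
- by move=> V mV; exists V; rewrite ?setTI.
- apply/measurable_EFinP.
  apply: (mPhi _ _ (fun j m (z : bool * O) => E j m z.2)
     (fun j m (z : bool * O) => if (j, m) == (i, k) then z.1 else B j m z.2)) => j m.
    apply: (measurableT_comp (f := fun w : O => E j m w)); last exact: measurable_snd.
    exact: measurable_clock_others.
  case: eqP => [_|/eqP ne]; first exact: measurable_fst.
  apply: (measurableT_comp (f := fun w : O => B j m w)); last exact: measurable_snd.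
  by apply: measurable_coin_others.
- by move=> z; rewrite lee_fin.
Qed.

Lemma clock_law i k (A : set R) : measurable A -> distribution P (E i k) A = exponential_prob 1 A.
Proof. by have [h _ _] := clocks; exact: h. Qed.

Section Chains.
Variable t : R.
Local Notation word := (seq ('I_N * bool)).
Implicit Types (v : word) (s : bool) (r : seq 'I_N).

(** Words list the rings from the last one to the first one; the letter (i, d) is a
    ring of clock i with direction d. *)
Definition ring_count v i : nat := count (fun a : 'I_N * bool => a.1 == i) v.

Definition last_ring x v i : R := \sum_(m < ring_count v i) x i m.

Definition next_ring x v i : R := \sum_(m < (ring_count v i).+1) x i m.

(** The time of the last ring. *)
Definition now x v : R := if v is a :: v' then next_ring x v' a.1 else 0.

(** The rings of the word occur in its order. The strict and the weak version have
    the same probability; they bound the event of the process from inside and from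
    outside. *)
Fixpoint chain s x b v : bool :=
  if v is a :: v' then
    [&& chain s x b v', late s (now x v') (next_ring x v' a.1) & b a.1 (ring_count v' a.1) == a.2]
  else true.

Definition wt v : R := \prod_(a <- v) (if a.2 then p else 1 - p).

(** On the event of the chain, the exponential factors are the conditional
    probabilities that the clocks outside r do not ring again before t, while the
    clocks in r are required not to. The power of t - now comes from rings that have
    been integrated out. *)
Definition aged s v k r x b : R :=
  ([&& chain s x b v, now x v <= t & all (fun i => t < next_ring x v i) r])%:R *
  ((t - now x v) ^+ k / k`!%:R * \prod_(i | i \notin r) expR (- (t - last_ring x v i))).

Lemma ring_count_cons i e v j : ring_count ((i, e) :: v) j = ((i == j) + ring_count v j)%N.
Proof. by []. Qed.

Lemma next_ringE x v i : next_ring x v i = last_ring x v i + x i (ring_count v i).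
Proof. by rewrite /next_ring big_ord_recr. Qed.

Lemma last_ring_ext x x' v i : (forall m, (m < ring_count v i)%N -> x i m = x' i m) ->
  last_ring x v i = last_ring x' v i.
Proof. by move=> h; apply: eq_bigr => m _; exact: h. Qed.

Lemma next_ring_ext x x' v i : (forall m, (m <= ring_count v i)%N -> x i m = x' i m) ->
  next_ring x v i = next_ring x' v i.
Proof. by move=> h; apply: eq_bigr => m _; apply: h; rewrite -ltnS. Qed.

Lemma now_ext x x' v : (forall j m, (m < ring_count v j)%N -> x j m = x' j m) -> now x v = now x' v.
Proof.
case: v => // -[i e] v h; apply: next_ring_ext => m hm; apply: h.
by rewrite ring_count_cons eqxx.
Qed.

Lemma chain_ext s x x' b b' v : (forall j m, (m < ring_count v j)%N -> x j m = x' j m) ->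
  (forall j m, (m < ring_count v j)%N -> b j m = b' j m) -> chain s x b v = chain s x' b' v.
Proof.
elim: v => // -[i e] v IH hx hb /=.
have sub j m : (m < ring_count v j)%N -> (m < ring_count ((i, e) :: v) j)%N.
  by move=> h; rewrite ring_count_cons (leq_trans h) // leq_addl.
rewrite (IH _ (fun j m h => hb j m (sub j m h))); last by move=> j m h; apply: hx; exact: sub.
rewrite (@now_ext x x'); last by move=> j m h; apply: hx; exact: sub.
rewrite (@next_ring_ext x x'); last by move=> m h; apply: hx; rewrite ring_count_cons eqxx.
by rewrite hb // ring_count_cons eqxx.
Qed.

Lemma late_le s (a c : R) : late s a c -> a <= c.
Proof. by rewrite /late; case: s => // /ltW. Qed.

(** The times of the rings increase along the chain, weakly at least. *)
Lemma chain_last s x b v i : chain s x b v -> last_ring x v i <= now x v.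
Proof.
elim: v => [_|[j e] v IH /= /and3P[/IH h /late_le le _]].
  by rewrite /last_ring big_ord0.
rewrite /last_ring ring_count_cons; case: eqP => [<-|_] //=.
by rewrite add0n; exact: le_trans le.
Qed.

Lemma aged_ge0 s v k r x b : 0 <= aged s v k r x b.
Proof.
rewrite /aged; case: and3P => [[_ h _]|_]; last by rewrite mul0r.
rewrite mul1r; apply: mulr_ge0; last by apply: prodr_ge0 => i _; exact: expR_ge0.
by rewrite divr_ge0 // exprn_ge0 // subr_ge0.
Qed.

Lemma measurable_eqb d' (T' : measurableType d') (f : T' -> bool) o :
  measurable_fun setT f -> measurable_fun setT (fun w => f w == o).
Proof.
move=> mf; rewrite (_ : (fun _ => _) = fun w => if o then f w else ~~ f w); last first.
  by apply/funext => w; case: o; case: (f w).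
by case: o => //; exact: measurable_neg.
Qed.

Section Functionals.
Context d' (T' : measurableType d').
Variables (X : 'I_N -> nat -> T' -> R) (b : 'I_N -> nat -> T' -> bool).
Hypotheses (mX : forall i k, measurable_fun setT (X i k))
  (mb : forall i k, measurable_fun setT (b i k)).
Local Notation xw := (fun w => (fun i k => X i k w)).
Local Notation bw := (fun w => (fun i k => b i k w)).

Lemma measurable_last v i : measurable_fun setT (fun w => last_ring (xw w) v i).
Proof. exact: measurable_bigsum. Qed.

Lemma measurable_next v i : measurable_fun setT (fun w => next_ring (xw w) v i).
Proof. exact: measurable_bigsum. Qed.

Lemma measurable_now v : measurable_fun setT (fun w => now (xw w) v).
Proof. by case: v => [|a v] //; exact: measurable_next. Qed.

Lemma measurable_chain s v : measurable_fun setT (fun w => chain s (xw w) (bw w) v).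
Proof.
elim: v => [|[i e] v IH] //=; apply: measurable_and => //; apply: measurable_and.
  have m1 := measurable_now v; have m2 := measurable_next v i.
  by rewrite /late; case: s {IH}; [exact: measurable_fun_ltr|exact: measurable_fun_ler].
exact: measurable_eqb.
Qed.

Lemma measurable_survive v r :
  measurable_fun setT (fun w => all (fun i => t < next_ring (xw w) v i) r).
Proof.
elim: r => [|i r IH] //=; apply: measurable_and => //; apply: measurable_fun_ltr => //.
exact: measurable_next.
Qed.

Lemma measurable_aged s v k r : measurable_fun setT (fun w => aged s v k r (xw w) (bw w)).
Proof.
have mn := measurable_now v.
apply: measurable_funM.
  apply: measurable_natb; apply: measurable_and; first exact: measurable_chain.
  apply: measurable_and; last exact: measurable_survive.
  exact: measurable_fun_ler.
apply: measurable_funM.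
  by apply: measurable_funM => //; apply: measurable_funX; exact: measurable_funB.
rewrite (_ : (fun _ => _) = fun w => \prod_(i <- enum 'I_N)
   (if i \notin r then expR (- (t - last_ring (xw w) v i)) else 1)); last first.
  by apply/funext => w; rewrite big_enum big_mkcond.
apply: measurable_bigprod => i; case: (i \notin r) => //; apply: measurableT_comp => //.
by apply: measurableT_comp => //; apply: measurable_funB => //; exact: measurable_last.
Qed.

End Functionals.

Lemma functional_aged s v k r : functional (aged s v k r).
Proof. by move=> d' T' X b mX mb; exact: measurable_aged. Qed.

(** The waiting time of the next ring does not affect the past rings. *)
Lemma set_at_old V (x : 'I_N -> nat -> V) v i e j m :
  (m < ring_count v j)%N -> set_at x i (ring_count v i) e j m = x j m.
Proof. by rewrite /set_at; case: eqP => // -[-> ->]; rewrite ltnn. Qed.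

Lemma set_at_new V (x : 'I_N -> nat -> V) i m e : set_at x i m e i m = e.
Proof. by rewrite /set_at eqxx. Qed.

Section SetClock.
Variables (v : word) (i : 'I_N) (x : clk) (e : R).
Local Notation x' := (set_at x i (ring_count v i) e).

Lemma last_set j : last_ring x' v j = last_ring x v j.
Proof. by apply: last_ring_ext => m h; exact: set_at_old. Qed.

Lemma next_set j : next_ring x' v j = if j == i then last_ring x v i + e else next_ring x v j.
Proof.
rewrite !next_ringE last_set; case: eqP => [->|ne]; first by rewrite set_at_new.
by rewrite /set_at; case: eqP => // -[].
Qed.

Lemma now_set : now x' v = now x v.
Proof. by apply: now_ext => j m h; exact: set_at_old. Qed.

Lemma chain_set s b : chain s x' b v = chain s x b v.
Proof. by apply: chain_ext => // j m h; exact: set_at_old. Qed.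

Lemma last_cons_set o j :
  last_ring x' ((i, o) :: v) j = last_ring x v j + (j == i)%:R * e.
Proof.
rewrite /last_ring ring_count_cons eq_sym; case: eqP => [->|ne].
  by have := next_set i; rewrite eqxx /next_ring /= mul1r => ->.
by rewrite add0n mul0r addr0; exact: last_set.
Qed.

End SetClock.

Definition coin_pending s i o v k x b : R := (b i (ring_count v i) == o)%:R * aged s v k [::] x b.

Lemma functional_pending s i o v k : functional (coin_pending s i o v k).
Proof.
move=> d' T' X b mX mb; apply: measurable_funM; last exact: measurable_aged.
apply: measurable_natb.
exact: measurable_eqb.
Qed.

Lemma late_shift s (a c e : R) : late s a (c + e) = late s (a - c) e.
Proof. by rewrite /late ltrBlDl lerBlDl. Qed.

(** The waiting time of the last ring ranges over the window from the previous ring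
    to t. Its density completes the survival factor of its clock, and integrating
    the power of t - now raises the exponent by one. *)
Lemma integral_last_clock s i o v k :
  (\int[P]_w (aged s ((i, o) :: v) k [::] (clk_of w) (coin_of w))%:E =
   \int[P]_w (coin_pending s i o v k.+1 (clk_of w) (coin_of w))%:E)%E.
Proof.
apply: (@integrate_clock _ _ i (ring_count v i)).
- exact: aged_ge0.
- exact: functional_aged.
move=> x b; pose l := last_ring x v i.
pose c := (chain s x b v && (b i (ring_count v i) == o))%:R * \prod_(j < N | j != i) expR (- (t - last_ring x v j)).
have c0 : 0 <= c by apply: mulr_ge0 => //; apply: prodr_ge0 => j _; exact: expR_ge0.
have e1 e : aged s ((i, o) :: v) k [::] (set_at x i (ring_count v i) e) b =
    c * window s k (now x v - l) (t - l) e.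
  rewrite /aged /window /= chain_set now_set next_set eqxx -/l andbT late_shift lerBrDl.
  rewrite (bigD1 i) //= last_cons_set eqxx mul1r -/l.
  under eq_bigr => j ji do rewrite last_cons_set (negPf ji) mul0r addr0.
  rewrite -(addrA t) -opprD /c -!mulnb !natrM; ring.
under eq_integral => e _ do rewrite e1 EFinM.
rewrite ge0_integralZl //; last first.
- by move=> e _; rewrite lee_fin; exact: window_ge0.
- by apply/measurable_EFinP; exact: measurable_window.
have [ch|ch] := boolP (chain s x b v); last first.
  by rewrite /c /coin_pending /aged (negPf ch) /= !(mul0r, mulr0) mul0e.
have lu : l <= now x v by exact: chain_last ch.
have [ut|ut] := leP (now x v) t; last first.
  rewrite /coin_pending /aged leNgt ut ch /= mul0r mulr0 integral0_eq ?mule0 //.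
  move=> e _; rewrite /window; case: andP => [[/late_le h1 h2]|_]; last by rewrite mul0r.
  by move: ut; rewrite ltNge; move: (le_trans h1 h2); rewrite lerD2r => ->.
have := @exp_window _ (distribution P (E i (ring_count v i)) : probability R R) (@clock_law i (ring_count v i)) s k.
move=> /(_ (now x v - l) (t - l)); rewrite subr_ge0 lerD2r => /(_ lu ut) /= ->.
rewrite -EFinM; congr (_%:E).
have -> : t - l - (now x v - l) = t - now x v by ring.
rewrite /coin_pending /aged /c ch ut /= [in RHS](bigD1 i) //= -/l; ring.
Qed.

Lemma integral_last_coin s i o v k :
  (\int[P]_w (coin_pending s i o v k (clk_of w) (coin_of w))%:E =
   (if o then p else 1 - p)%:E * \int[P]_w (aged s v k [::] (clk_of w) (coin_of w))%:E)%E.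
Proof.
pose q := if o then p else 1 - p.
have q0 : 0 <= q by rewrite /q; case: (o); have /andP[] := p01; rewrite ?subr_ge0.
rewrite -ge0_integralZl //; last first.
- by move=> w _; rewrite lee_fin aged_ge0.
- by apply/measurable_EFinP; apply: measurable_aged => j m; exact: measurable_funPT.
apply: (@integrate_coin _ (fun x b => q * aged s v k [::] x b) i (ring_count v i)).
- by move=> x b; rewrite mulr_ge0 ?aged_ge0.
- exact: functional_pending.
move=> x b; rewrite /coin_pending !set_at_new.
have e1 c : aged s v k [::] x (set_at b i (ring_count v i) c) = aged s v k [::] x b.
  by rewrite /aged (chain_ext (b' := b) _ (x' := x)) // => j m h; exact: set_at_old.
by rewrite !e1 /q; case: o {q q0} => /=; ring.
Qed.

Lemma integral_aged_cons s i o v k :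
  (\int[P]_w (aged s ((i, o) :: v) k [::] (clk_of w) (coin_of w))%:E =
   (if o then p else 1 - p)%:E * \int[P]_w (aged s v k.+1 [::] (clk_of w) (coin_of w))%:E)%E.
Proof. by rewrite integral_last_clock integral_last_coin. Qed.

Hypothesis t0 : 0 <= t.

(** All rings being integrated out in turn, only powers of t and the survival
    factors of the N clocks remain. *)
Lemma integral_aged s v k :
  (\int[P]_w (aged s v k [::] (clk_of w) (coin_of w))%:E =
   (wt v * (expR (- (N%:R * t)) * (t ^+ (k + size v) / (k + size v)`!%:R)))%:E)%E.
Proof.
elim: v k => [|[i o] v IH] k; last first.
  rewrite integral_aged_cons IH -EFinM; congr (_%:E).
  rewrite [in RHS]/wt big_cons -/(wt v) addSnnS /=; ring.
rewrite /wt big_nil mul1r addn0.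
have e x b : aged s [::] k [::] x b = expR (- (N%:R * t)) * (t ^+ k / k`!%:R).
  rewrite /aged /= t0 mul1r subr0 mulrC; congr (_ * _).
  under eq_bigr => i _ do rewrite /last_ring /= big_ord0 subr0.
  by rewrite prodr_const card_ord -expRM_natl mulrN.
under eq_integral => w _ do rewrite e.
by rewrite integral_cst //= probability_setT mule1.
Qed.

(** The survival factor of clock i is the probability that its next ring comes
    after t. *)
Lemma integral_survive s v i r : i \notin r ->
  (\int[P]_w (aged s v 0 (i :: r) (clk_of w) (coin_of w))%:E =
   \int[P]_w (aged s v 0 r (clk_of w) (coin_of w))%:E)%E.
Proof.
move=> ir; apply: (@integrate_clock _ _ i (ring_count v i)).
- exact: aged_ge0.
- exact: functional_aged.
move=> x b; pose l := last_ring x v i.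
pose c := ([&& chain s x b v, now x v <= t & all (fun j => t < next_ring x v j) r])%:R *
  \prod_(j < N | j \notin i :: r) expR (- (t - last_ring x v j)).
have c0 : 0 <= c by apply: mulr_ge0 => //; apply: prodr_ge0 => j _; exact: expR_ge0.
have e1 e : aged s v 0 (i :: r) (set_at x i (ring_count v i) e) b = c * ((t - l < e)%R : bool)%:R.
  rewrite /aged /= chain_set now_set next_set eqxx -/l ltrBlDl.
  have -> : all (fun j => t < next_ring (set_at x i (ring_count v i) e) v j) r = all (fun j => t < next_ring x v j) r.
    by apply: eq_in_all => j jr; rewrite next_set; case: eqP => // ji; rewrite -ji jr in ir.
  under eq_bigr => j _ do rewrite last_set.
  rewrite /c -!mulnb !natrM expr0 fact0 divr1 mul1r.
  by rewrite -!mulrA; congr (_ * (_ * _)); rewrite mulrC -mulrA.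
have ind : (\int[distribution P (E i (ring_count v i))]_e ((t - l < e)%R%:R)%:E =
    distribution P (E i (ring_count v i)) (`](t - l), +oo[%classic)%R)%E.
  rewrite -[X in _ = distribution _ _ X]setIT -integral_indic //; apply: eq_integral => e _.
  by rewrite indicE mem_setE in_itv /= andbT.
under eq_integral => e _ do rewrite e1 EFinM.
rewrite ge0_integralZl //; last first.
  by apply/measurable_EFinP; apply: measurable_natb; exact: measurable_fun_ltr.
rewrite ind; rewrite /aged.
have [ch|ch] := boolP (chain s x b v && (now x v <= t)); last first.
  by rewrite /c !andbA (negPf ch) !mul0r mul0e.
have /andP[ch1 ut] := ch.
have lt : l <= t by apply: le_trans (chain_last i ch1) ut.
have := @exp_tail _ (distribution P (E i (ring_count v i)) : probability R R) (@clock_law i (ring_count v i)) (t - l).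
rewrite subr_ge0 => /(_ lt) /= ->.
rewrite -EFinM; congr (_%:E); rewrite /c expr0 fact0 [in RHS](bigD1 i) //=.
rewrite (eq_bigl (fun j => (j \notin r) && (j != i))); last first.
  by move=> j; rewrite inE negb_or andbC.
by rewrite divr1 mul1r -!mulrA; congr (_ * _); rewrite mulrC.
Qed.

(** The rings in [0, t] are exactly those of the word, in its order. *)
Definition survivor s v : set T := [set w |
  [&& chain s (clk_of w) (coin_of w) v, now (clk_of w) v <= t &
      all (fun i => t < next_ring (clk_of w) v i) (enum 'I_N)]].

Lemma measurable_survivor s v : measurable (survivor s v).
Proof.
rewrite /survivor.
have m : measurable_fun setT (fun w => [&& chain s (clk_of w) (coin_of w) v, now (clk_of w) v <= t &
      all (fun i => t < next_ring (clk_of w) v i) (enum 'I_N)]).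
  have mE j k : measurable_fun setT (E j k) by exact: measurable_funPT.
  have mB j k : measurable_fun setT (B j k) by exact: measurable_funPT.
  apply: measurable_and; first exact: measurable_chain.
  apply: measurable_and; last exact: measurable_survive.
  by apply: measurable_fun_ler => //; exact: measurable_now.
have := m measurableT [set true]; rewrite setTI; apply.
by [].
Qed.

(** The value does not depend on s: simultaneous rings have probability zero. *)
Lemma prob_survivor s v : P (survivor s v) =
  (wt v * (expR (- (N%:R * t)) * (t ^+ size v / (size v)`!%:R)))%:E.
Proof.
rewrite -(integral_aged s v 0).
have <- : (\int[P]_w (aged s v 0 (enum 'I_N) (clk_of w) (coin_of w))%:E =
   \int[P]_w (aged s v 0 [::] (clk_of w) (coin_of w))%:E)%E.
  elim: (enum 'I_N) (enum_uniq 'I_N) => //= i r IH /andP[ir ur].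
  by rewrite integral_survive // IH.
rewrite -[survivor s v in LHS]setIT -integral_indic //; last exact: measurable_survivor.
apply: eq_integral => w _; congr (_%:E).
rewrite /aged expr0 fact0 divr1 mul1r big1 ?mulr1; last first.
  by move=> j; rewrite mem_enum.
rewrite indicE; congr (_%:R); rewrite /survivor.
by apply: (congr1 nat_of_bool); apply/idP/idP => [|h]; rewrite inE.
Qed.

End Chains.

End Clocks.

(** * From successions of rings to the process *)

Section Pathwise.
Context {R : realType} {N : nat} {T : Type}.
Variables (E : 'I_N -> nat -> T -> R) (B : 'I_N -> nat -> T -> bool).
Variables (L : nat) (Y : {ffun 'I_N -> int}) (t : R) (w : T).
Local Notation word := (seq ('I_N * bool)).
Local Notation x := (fun i k => E i k w).
Local Notation b := (fun i k => B i k w).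
Implicit Types (v : word) (i j : 'I_N).

Definition end_conf v : {ffun 'I_N -> int} := foldr (fun a Z => attempt_jump L Z a.1 a.2) Y v.

Definition ring_counts v : {ffun 'I_N -> nat} := [ffun i => ring_count v i].

Definition follows v := asep_run E B L Y (size v) w = (end_conf v, ring_counts v).

Lemma ring_timeE v i : ring_time E i (ring_counts v i) w = next_ring x v i.
Proof. by rewrite ffunE. Qed.

Lemma follows_nil : follows [::].
Proof. by congr (_, _); apply/ffunP => j; rewrite !ffunE. Qed.

Lemma follows_cons i v : follows v -> next_clock E (ring_counts v) w = Some i ->
  follows ((i, b i (ring_count v i)) :: v).
Proof.
rewrite /follows /asep_run /= => -> h; rewrite /asep_step h /=; congr (_, _).
  by rewrite ffunE.
by apply/ffunP => j; rewrite !ffunE ring_count_cons eq_sym; case: eqP.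
Qed.

Lemma next_cons i o v j : j != i -> next_ring x ((i, o) :: v) j = next_ring x v j.
Proof. by move=> ji; rewrite /next_ring ring_count_cons eq_sym (negPf ji). Qed.

(** The next ring of every clock comes strictly after all the past ones. *)
Definition apart v := chain true x b v /\ forall j, now x v < next_ring x v j.

(** The clock that rings last was strictly ahead of the other ones. *)
Lemma apart_cons i o v : apart ((i, o) :: v) ->
  [/\ apart v, forall j, j != i -> next_ring x v i < next_ring x v j & o = b i (ring_count v i)].
Proof.
move=> [/= /and3P[c lt /eqP o1] h]; split => //.
  split => // j; have [-> //|ji] := eqVneq j i.
  by apply: lt_trans lt _; rewrite -(next_cons o v ji).
by move=> j ji; rewrite -(next_cons o v ji).
Qed.

Lemma apart_next i v : (forall j, j != i -> next_ring x v i < next_ring x v j) ->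
  next_clock E (ring_counts v) w = Some i.
Proof.
move=> h; rewrite /next_clock; case: pickP => [j /forallP /(_ i)|/(_ i)/forallP []].
  rewrite !ring_timeE; have [-> //|ji] := eqVneq j i.
  by rewrite leNgt h.
move=> j; rewrite !ring_timeE; have [-> //|ji] := eqVneq j i.
by apply/ltW/h.
Qed.

Lemma apart_follows v : apart v -> follows v.
Proof.
elim: v => [|[i o] v IH] h.
  exact: follows_nil.
by have [/IH f m ->] := apart_cons h; apply: follows_cons => //; exact: apart_next.
Qed.

(** Run backwards, the strict order determines each letter. *)
Lemma apart_inj v v' : size v = size v' -> apart v -> apart v' -> v = v'.
Proof.
elim: v v' => [|[i o] v IH] [|[i' o'] v'] //= [sz] h h'.
have [a m ->] := apart_cons h; have [a' m' ->] := apart_cons h'.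
rewrite -(IH v' sz a a') in m' *.
have := apart_next m; rewrite (apart_next m') => -[->] //.
Qed.

Hypothesis x0 : forall i k, 0 <= x i k.

Lemma ring_time_mono i k k' : (k <= k')%N -> ring_time E i k w <= ring_time E i k' w.
Proof.
move=> /subnK <-; elim: (k' - k)%N => // n IH; apply: le_trans IH _.
by rewrite addSn [leRHS]/ring_time big_ord_recr lerDl.
Qed.

(** Ring times increase in k, so the rings before t are counted by the word. *)
Lemma counts_at s v : chain s x b v -> now x v <= t -> (forall j, t < next_ring x v j) ->
  forall i k, (ring_time E i k w <= t) = (k < ring_count v i)%N.
Proof.
move=> c ut h i k; apply/idP/idP => [le|lt].
  rewrite ltnNge; apply/negP => ck; have := h i; rewrite ltNge => /negP; apply.
  by apply: le_trans le; exact: ring_time_mono.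
apply: le_trans ut; apply: le_trans (chain_last i c).
case e : (ring_count v i) lt => [//|m] km; rewrite /last_ring e.
exact: ring_time_mono.
Qed.

Lemma size_ring_count v : size v = (\sum_i ring_count v i)%N.
Proof.
elim: v => [|[i o] v IH]; first by rewrite big1.
rewrite [size _]/= IH; under [RHS]eq_bigr => j _ do rewrite ring_count_cons.
have one : (\sum_j (i == j) = 1)%N.
  by rewrite (bigD1 i) //= eqxx big1 // => j ji; rewrite eq_sym (negPf ji).
by rewrite big_split /= one add1n.
Qed.

Lemma next_clock_exists v : (0 < N)%N -> exists2 i, next_clock E (ring_counts v) w = Some i &
  forall j, next_ring x v i <= next_ring x v j.
Proof.
move=> N1; rewrite /next_clock; case: pickP => [i /forallP h|h].
  by exists i => // j; have := h j; rewrite !ring_timeE.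
case: (arg_minP (fun i => next_ring x v i) (i0 := Ordinal N1) (P := predT) isT) => i _ m.
by have /forallP[] := h i; move=> j; rewrite !ring_timeE m.
Qed.

(** The word is built along the run, each letter being the next clock to ring with
    the direction drawn. Only weak order is obtained, because of possible ties. *)
Lemma run_word n : (0 < N)%N -> exists v, [/\ size v = n, follows v, chain false x b v &
  forall j, now x v <= next_ring x v j].
Proof.
move=> N1; elim: n => [|n [v [sz f c h]]].
  exists [::]; split; [by []|exact: follows_nil|by []|move=> j].
  by apply: sumr_ge0.
have [i ni mi] := next_clock_exists v N1.
exists ((i, b i (ring_count v i)) :: v); split.
- by rewrite /= sz.
- exact: follows_cons.
- by rewrite /= c eqxx /late h.
move=> j; rewrite [now _ _]/=; have [->|ji] := eqVneq j i; last by rewrite next_cons.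
rewrite /next_ring ring_count_cons eqxx [leRHS]big_ord_recr lerDl.
exact: x0.
Qed.

Lemma asep_at_word X : (0 < N)%N -> 0 <= t -> asep_at E B L Y t X w ->
  exists2 v, end_conf v = X & [/\ chain false x b v, now x v <= t & forall j, t < next_ring x v j].
Proof.
move=> N1 t0 [n [h eX]]; have [v [sz f c u]] := run_word n N1.
rewrite -sz f /= in h eX; exists v => //; split => //.
  case: v sz f c u h eX => [|[i o] v] //= _ _ _ _ h _.
  by have := h i (ring_count v i); rewrite ffunE ring_count_cons eqxx ltnSn.
by move=> j; have := h j (ring_count v j); rewrite ffunE ltnn ltNge => ->.
Qed.

Lemma word_asep_at v : chain true x b v -> now x v <= t -> (forall j, t < next_ring x v j) ->
  asep_at E B L Y t (end_conf v) w.
Proof.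
move=> c ut h; have f : follows v.
  by apply: apart_follows; split => // j; exact: le_lt_trans (h j).
exists (size v); rewrite f; split => // i k.
by rewrite ffunE (counts_at c).
Qed.

(** The numbers of rings before t determine the length of the word. *)
Lemma strict_word_inj v v' : chain true x b v -> chain true x b v' ->
  now x v <= t -> now x v' <= t -> (forall j, t < next_ring x v j) ->
  (forall j, t < next_ring x v' j) -> v = v'.
Proof.
move=> c c' u u' h h'; apply: apart_inj; last 2 first.
- by split => // j; exact: le_lt_trans (h j).
- by split => // j; exact: le_lt_trans (h' j).
rewrite !size_ring_count; apply: eq_bigr => i _; apply/eqP; rewrite eqn_leq.
apply/andP; split; rewrite leqNgt; apply/negP.
  by rewrite -(counts_at c) // (counts_at c') // ltnn.
by rewrite -(counts_at c') // (counts_at c) // ltnn.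
Qed.

End Pathwise.

Section Words.
Context {R : realType} {N : nat}.
Local Notation word := (seq ('I_N * bool)).

Fixpoint words n : seq word :=
  if n is m.+1 then [seq a :: v | v <- words m, a <- enum {: 'I_N * bool}] else [:: [::]].

Lemma mem_words n v : (v \in words n) = (size v == n).
Proof.
elim: n v => [|n IH] [|a v] //=; first by apply/negP => /allpairsPdep[? [? []]].
apply/allpairsPdep/idP => [[v' [a' [hv _ [_ ->]]]]|h]; first by rewrite eqSS -IH.
by exists v, a; split; rewrite ?IH ?mem_enum.
Qed.

Lemma words_uniq n : uniq (words n).
Proof.
elim: n => //= n IH; apply: allpairs_uniq => //; first exact: enum_uniq.
by move=> [v a] [v' a'] _ _ /= [-> ->].
Qed.

Fixpoint short_words n : seq word := if n is m.+1 then words m ++ short_words m else [::].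

Lemma mem_short n v : (v \in short_words n) = (size v < n)%N.
Proof.
elim: n => [|n IH] /=; first by rewrite in_nil.
by rewrite mem_cat mem_words IH [in RHS]ltnS [in RHS]leq_eqVlt.
Qed.

Lemma short_uniq n : uniq (short_words n).
Proof.
elim: n => //= n IH; rewrite cat_uniq words_uniq IH andbT /=.
by apply/hasPn => v; rewrite mem_short mem_words; case: ltngtP.
Qed.

Variables (L : nat) (p q : R).
Hypothesis pq1 : p + q = 1.

Lemma wt_cons a (v : word) : wt p (a :: v) = (if a.2 then p else q) * wt p v.
Proof.
have -> : q = 1 - p by rewrite -pq1; ring.
by rewrite /wt big_cons.
Qed.

(** The head of a word is its last jump, so that the iterate is peeled from the
    inside. *)
Lemma sum_words n (g : {ffun 'I_N -> int} -> R) Y :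
  \sum_(v <- words n) wt p v * g (end_conf L Y v) = iter n (jump_mean L p q) g Y.
Proof.
elim: n g => [|n IH] g.
  by rewrite /= big_seq1 /wt big_nil mul1r.
rewrite iterSr -IH /= big_allpairs_dep; apply: eq_bigr => v _.
rewrite /jump_mean mulr_sumr big_enum /=.
rewrite (eq_bigr (fun a : 'I_N * bool => wt p v * ((if a.2 then p else q) *
   g (attempt_jump L (end_conf L Y v) a.1 a.2)))); last by move=> a _; rewrite wt_cons; ring.
rewrite -(pair_bigA _ (fun i d => wt p v * ((if d then p else q) * g (attempt_jump L (end_conf L Y v) i d)))) /=.
by apply: eq_bigr => i _; rewrite big_bool mulrDr.
Qed.

End Words.

Section MeasureSums.
Context {d} {T : measurableType d} {R : realType} (P : probability T R) {K : eqType}.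

(** By induction, the events being removed from A one after the other. *)
Lemma sum_disjoint_le (V : seq K) (F : K -> set T) A : uniq V -> measurable A ->
  (forall v, v \in V -> measurable (F v)) -> (forall v, v \in V -> F v `<=` A) ->
  (forall v v', v \in V -> v' \in V -> v != v' -> F v `&` F v' = set0) ->
  (\sum_(v <- V) P (F v) <= P A)%E.
Proof.
elim: V A => [|v V IH] A /=; first by rewrite big_nil.
move=> /andP[vV uV] mA mF sF dF.
have mv : measurable (F v) by apply: mF; rewrite mem_head.
rewrite big_cons (measureDI P mA mv) addeC; apply: leeD.
  apply: IH => // [|u uV'|u uV'|u u' uV' uV'' ne].
  - exact: measurableD.
  - by apply: mF; rewrite inE uV' orbT.
  - move=> w Fw; split; first by apply: (sF u) => //; rewrite inE uV' orbT.
    move=> Fv; have : (F u `&` F v) w by [].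
    by rewrite dF // ?inE ?uV' ?eqxx ?orbT //; apply: contra vV => /eqP <-.
  - by apply: dF; rewrite ?inE ?uV' ?uV'' ?orbT.
by rewrite setIidr //; apply: sF; rewrite mem_head.
Qed.

Lemma measure_bigU_le (V : seq K) (Q : pred K) (F : K -> set T) : (forall v, measurable (F v)) ->
  (P (\big[setU/set0]_(v <- V | Q v) F v) <= \sum_(v <- V | Q v) P (F v))%E.
Proof.
move=> mF; elim: V => [|v V IH]; first by rewrite !big_nil measure0.
rewrite !big_cons; case: ifP => // _; apply: le_trans (measureU2 _ _ _) _ => //.
  exact: bigsetU_measurable.
exact: leeD.
Qed.

Lemma big_setUE (V : seq K) (Q : pred K) (F : K -> set T) w v :
  v \in V -> Q v -> F v w -> (\big[setU/set0]_(v <- V | Q v) F v) w.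
Proof.
elim: V => // u V IH; rewrite inE big_cons => /orP[/eqP <- -> h|vV Qv h]; first by left.
by case: ifP => _; [right|]; exact: IH.
Qed.

End MeasureSums.

(** * The law of the process *)

Section EventMeasurable.
Context {d} {T : measurableType d} {R : realType} {N : nat}.
Variables (E : 'I_N -> nat -> T -> R) (B : 'I_N -> nat -> T -> bool).
Hypotheses (mE : forall i k, measurable_fun setT (E i k)) (mB : forall i k, measurable_fun setT (B i k)).
Variables (L : nat) (Y : {ffun 'I_N -> int}).

Lemma measurable_pre (f : T -> bool) c : measurable_fun setT f -> measurable [set w | f w = c].
Proof. by move=> mf; have := mf measurableT [set c]; rewrite setTI; apply. Qed.

Lemma measurable_bigcup_count (J : countType) (F : J -> set T) :
  (forall j, measurable (F j)) -> measurable [set w | exists j, F j w].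
Proof.
move=> mF; rewrite (_ : [set w | _] = \bigcup_j F j).
  by apply: countable_bigcupT_measurable.
by apply/seteqP; split=> w [j]; exists j.
Qed.

Lemma measurable_bigcap_fin (J : finType) (F : J -> set T) :
  (forall j, measurable (F j)) -> measurable [set w | forall j, F j w].
Proof.
move=> mF; rewrite (_ : [set w | _] = \bigcap_j F j).
  by apply: fin_bigcap_measurable => //; exact: finite_finset.
by apply/seteqP; split=> w h j; [move=> _|]; apply: h.
Qed.

Lemma measurable_prop (Q : Prop) : measurable [set w : T | Q].
Proof.
have [q|q] := pselect Q.
  by rewrite (_ : [set w | _] = setT) //; apply/seteqP; split=> w.
by rewrite (_ : [set w | _] = set0) //; apply/seteqP; split=> w.
Qed.

Lemma measurable_coin i k (Q : bool -> Prop) : measurable [set w | Q (B i k w)].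
Proof.
rewrite (_ : [set w | _] = [set w | exists c, B i k w = c /\ Q c]); last first.
  by apply/seteqP; split=> w /=; [exists (B i k w)|move=> [c [->]]].
apply: measurable_bigcup_count => c; apply: measurableI; last exact: measurable_prop.
exact: measurable_pre.
Qed.

Lemma measurable_ring_time i k : measurable_fun setT (ring_time E i k).
Proof. exact: measurable_bigsum. Qed.

(** Only finitely many comparisons decide which clock rings next. *)
Lemma measurable_next_clock (c : {ffun 'I_N -> nat}) o : measurable [set w | next_clock E c w = o].
Proof.
pose h i w := [forall j, ring_time E i (c i) w <= ring_time E j (c j) w].
have mh i e : measurable [set w | h i w = e].
  apply: measurable_pre; apply: (measurable_fun_bool true); rewrite setTI.
  have := measurable_bigcap_fin (F := fun j => [set w | (ring_time E i (c i) w <= ring_time E j (c j) w) = true]).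
  rewrite (_ : [set w | _] = h i @^-1` [set true]); last first.
    by apply/seteqP; split=> w /= /forallP.
  apply=> j; apply: measurable_pre; apply: measurable_fun_ler; exact: measurable_ring_time.
rewrite (_ : [set w | _] = [set w | exists g : {ffun 'I_N -> bool},
    ([pick i | g i] = o) /\ (forall i, h i w = g i)]); last first.
  apply/seteqP; split=> w /=.
    move=> <-; exists [ffun i => h i w]; split; last by move=> i; rewrite ffunE.
    by apply: eq_pick => i; rewrite ffunE.
  move=> [g [<- hg]]; rewrite /next_clock; apply: eq_pick => i; exact: hg.
apply: (measurable_bigcup_count (F := fun g : {ffun 'I_N -> bool} =>
  [set w | [pick i | g i] = o /\ forall i, h i w = g i])) => g.
apply: measurableI; first exact: measurable_prop.
exact: (measurable_bigcap_fin (F := fun i => [set w | h i w = g i])).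
Qed.

Lemma measurable_step s s' : measurable [set w | asep_step E B L w s = s'].
Proof.
rewrite (_ : [set w | _] = [set w | exists o : option 'I_N, next_clock E s.2 w = o /\
  (if o is Some i then
    (attempt_jump L s.1 i (B i (s.2 i) w), [ffun j => if j == i then (s.2 j).+1 else s.2 j])
  else s) = s']); last first.
  apply/seteqP; split=> w; rewrite /asep_step /=.
    by exists (next_clock E s.2 w).
  by move=> [j [e1 e2]]; rewrite e1.
apply: measurable_bigcup_count => o; apply: measurableI; first exact: measurable_next_clock.
case: o => [i|].
  exact: (measurable_coin i (s.2 i) (fun c => (attempt_jump L s.1 i c,
    [ffun j => if j == i then (s.2 j).+1 else s.2 j]) = s')).
exact: measurable_prop.
Qed.

Lemma measurable_run n s : measurable [set w | asep_run E B L Y n w = s].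
Proof.
elim: n s => [|n IH] s; first exact: (measurable_prop ((Y, [ffun=> 0%N]) = s)).
rewrite (_ : [set w | _] = [set w | exists s', asep_run E B L Y n w = s' /\ asep_step E B L w s' = s]).
  by apply: measurable_bigcup_count => s'; apply: measurableI; [exact: IH|exact: measurable_step].
by apply/seteqP; split=> w /=; [exists (asep_run E B L Y n w)|move=> [s' [<-]]].
Qed.

(** A countable union over the number of rings and the states they lead to. *)
Lemma measurable_asep_at t X : measurable (asep_at E B L Y t X).
Proof.
rewrite (_ : asep_at _ _ _ _ _ _ = [set w | exists a : nat * ({ffun 'I_N -> int} * {ffun 'I_N -> nat}),
  asep_run E B L Y a.1 w = a.2 /\ ((forall i k, (ring_time E i k w <= t) = (k < a.2.2 i)%N) /\ a.2.1 = X)]); last first.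
  apply/seteqP; split=> w /=.
    by move=> [n [h e]]; exists (n, asep_run E B L Y n w).
  by move=> [[n s] /= [<- [h e]]]; exists n.
apply: measurable_bigcup_count => a; apply: measurableI; first exact: measurable_run.
apply: measurableI; last exact: measurable_prop.
apply: measurable_bigcap_fin => i.
rewrite (_ : (fun _ => _) = \bigcap_k [set w | (ring_time E i k w <= t) = (k < a.2.2 i)%N]); last first.
  by apply/seteqP; split=> w h k; [move=> _|]; apply: h.
apply: bigcapT_measurable => k; apply: measurable_pre; apply: measurable_fun_ler => //.
exact: measurable_ring_time.
Qed.

End EventMeasurable.

(** A bounded sum of nonnegative terms is the supremum of its partial sums. *)
Lemma sup_of_partial_sums {R : realType} (a : nat -> R) (v : R) :
  (forall n, 0 <= a n) -> (forall n, \sum_(k < n) a k <= v) ->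
  (v%:E <= \sum_(0 <= k <oo) (a k)%:E)%E -> (fun n => \sum_(k < n) a k) @ \oo --> v.
Proof.
move=> a0 up low; set S := fun n => _.
have mS : {homo S : n m / (n <= m)%N >-> n <= m}.
  apply: homo_leq => //; first exact: le_trans.
  by move=> n; rewrite /S big_ord_recr lerDl.
have bS : has_ubound (range S) by exists v => _ [n _ <-]; exact: up.
have cS := nondecreasing_cvgn mS bS.
suff -> : v = sup (range S) by [].
apply/eqP; rewrite eq_le; apply/andP; split; last first.
  by apply: ge_sup; [exists (S 0%N); exists 0%N|move=> _ [n _ <-]; exact: up].
rewrite -lee_fin; apply: le_trans low _.
rewrite (_ : (\sum_(0 <= k <oo) (a k)%:E)%E = (sup (range S))%:E) //.
apply/cvg_lim => //; apply: cvg_EFin; first by near=> n; rewrite sumEFin.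
by apply: cvg_trans cS; apply: near_eq_cvg; near=> n; rewrite /= sumEFin /= big_mkord.
Unshelve. all: end_near. Qed.

Section AsepLaw.
Context {d} {T : measurableType d} {R : realType} (P : probability T R) {N : nat} (L : nat) (p q : R).
Variables (E : 'I_N -> nat -> {RV P >-> R}) (B : 'I_N -> nat -> {RV P >-> bool}).
Hypothesis clocks : asep_clocks p E B.
Hypotheses (N1 : (0 < N)%N) (p0 : 0 < p) (q0 : 0 < q) (pq1 : p + q = 1).
Variables (X Y : {ffun 'I_N -> int}) (t : R).
Hypothesis t0 : 0 <= t.
Local Notation E' := (fun i k => E i k : T -> R).
Local Notation B' := (fun i k => B i k : T -> bool).
Local Notation word := (seq ('I_N * bool)).

Let p01 : 0 <= p <= 1.
Proof. by rewrite (ltW p0) -pq1 lerDl ltW. Qed.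

Definition negative k : set T := \big[setU/set0]_(i <- enum 'I_N) (E i k @^-1` `]-oo, 0[%classic).

Lemma measurable_neg_clock i k : measurable (E i k @^-1` `]-oo, 0[%classic).
Proof. by rewrite -[_ @^-1` _]setTI; apply: measurable_funPT. Qed.

Lemma measurable_negative k : measurable (negative k).
Proof. by apply: bigsetU_measurable => i _; exact: measurable_neg_clock. Qed.

Lemma prob_negative k : P (negative k) = 0%E.
Proof.
apply/eqP; rewrite -measure_le0.
apply: le_trans (measure_bigU_le P _ _ (fun i => measurable_neg_clock i k)) _.
rewrite big1 // => i _; exact: (exp_neg (nu := distribution P (E i k)) (@clock_law _ _ _ _ _ _ _ _ clocks i k)).
Qed.

(** The waiting times are nonnegative off an event of probability zero. *)
Definition regular : set T := ~` \bigcup_k negative k.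

Lemma measurable_regular : measurable regular.
Proof. by apply: measurableC; apply: bigcupT_measurable => k; exact: measurable_negative. Qed.

Lemma regular_ge0 w : regular w -> forall i k, 0 <= E i k w.
Proof.
move=> h i k; rewrite leNgt; apply/negP => lt; apply: h; exists k => //.
apply: (big_setUE (v := i)) => //; first by rewrite mem_enum.
Qed.

Lemma prob_irregular : P (\bigcup_k negative k) = 0%E.
Proof.
apply: measure_negligible; first by apply: bigcupT_measurable => k; exact: measurable_negative.
apply: negligible_bigcup => k; exists (negative k); split => //.
  exact: measurable_negative.
exact: prob_negative.
Qed.

Lemma prob_regularI A : measurable A -> P (A `&` regular) = P A.
Proof.
move=> mA; have mN : measurable (\bigcup_k negative k).
  by apply: bigcupT_measurable => k; exact: measurable_negative.
rewrite [RHS](measureDI P mA mN) /regular -setDE.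
rewrite [X in (_ + X)%E](_ : _ = 0%E) ?adde0 //.
apply/eqP; rewrite -measure_le0 -prob_irregular; apply: le_measure; rewrite ?inE //.
exact: measurableI.
Qed.

Definition path_prob n : R := expR (- (N%:R * t)) * (t ^+ n / n`!%:R) *
  iter n (jump_mean L p q) (at_conf X) Y.

Lemma sum_survivor s n :
  (\sum_(v <- words n | end_conf L Y v == X) P (survivor E B t s v) = (path_prob n)%:E)%E.
Proof.
rewrite /path_prob -(sum_words L pq1) mulr_sumr -sumEFin big_mkcond big_seq [RHS]big_seq.
apply: eq_bigr => v; rewrite mem_words => /eqP sz.
rewrite /at_conf; case: eqP => _; last by rewrite !mulr0.
rewrite (prob_survivor clocks p01 t0) sz; congr (_%:E); rewrite mulr1 mulrC //.
Qed.

Lemma path_prob_ge0 n : 0 <= path_prob n.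
Proof.
by rewrite -lee_fin -(sum_survivor true); apply: sume_ge0 => v _; exact: measure_ge0.
Qed.

Lemma survivorP s v w : survivor E B t s v w ->
  [/\ chain s (fun i k => E i k w) (fun i k => B i k w) v,
      now (fun i k => E i k w) v <= t &
      forall i, t < next_ring (fun i k => E i k w) v i].
Proof.
by move=> /and3P[c u /allP h]; split => // i; apply: h; rewrite mem_enum.
Qed.

Let event := asep_at E' B' L Y t X.

Lemma measurable_event : measurable event.
Proof. by apply: measurable_asep_at => i k; exact: measurable_funPT. Qed.

(** The strict events of the words that lead to X are disjoint and contained in the
    event of the process. *)
Lemma event_lower n : ((\sum_(k < n) path_prob k)%:E <= P event)%E.
Proof.
have -> : (\sum_(k < n) path_prob k)%:E =
    (\sum_(v <- [seq v <- short_words n | end_conf L Y v == X]) P (survivor E B t true v `&` regular))%E.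
  rewrite -sumEFin big_filter.
  elim: n => [|n IH]; first by rewrite big_ord0 big_nil.
  rewrite big_ord_recr IH big_cat /= addeC -(sum_survivor true); congr (_ + _)%E.
  by apply: eq_bigr => v _; rewrite prob_regularI //; exact: measurable_survivor.
apply: sum_disjoint_le.
- by rewrite filter_uniq // short_uniq.
- exact: measurable_event.
- by move=> v _; apply: measurableI; [exact: measurable_survivor|exact: measurable_regular].
- move=> v; rewrite mem_filter => /andP[/eqP eX _] w [/survivorP[c u h] r]; rewrite /event -eX.
  exact: (word_asep_at (E := E') (B := B') L Y (regular_ge0 r) c u h).
- move=> v v' _ _ /eqP ne; apply/seteqP; split=> w // [[/survivorP[c u h] r] [/survivorP[c' u' h'] _]].
  by case: ne; exact: (strict_word_inj (E := E') (B := B') (regular_ge0 r) c c' u u' h h').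
Qed.

(** The weak events of the words that lead to X cover the event of the process. *)
Lemma event_upper : (P event <= \sum_(0 <= k <oo) (path_prob k)%:E)%E.
Proof.
(* The event of a negative waiting time is distributed over the terms, at no cost. *)
pose F k := \big[setU/set0]_(v <- words k | end_conf L Y v == X) survivor E B t false v `|` negative k.
have mS k : measurable (\big[setU/set0]_(v <- words k | end_conf L Y v == X) survivor E B t false v).
  by apply: bigsetU_measurable => v _; exact: measurable_survivor.
have mF k : measurable (F k) by apply: measurableU => //; exact: measurable_negative.
apply: le_trans (measure_sigma_subadditive P mF measurable_event _) _.
  move=> w aw; have [[k _ nk]|rw] := pselect ((\bigcup_k negative k) w).
    by exists k => //; right.
  have [v eX [c u h]] := asep_at_word (regular_ge0 rw) N1 t0 aw.
  exists (size v) => //; left; apply: (big_setUE (v := v)); rewrite ?mem_words ?eX //.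
  by apply/and3P; split => //; apply/allP => i _; exact: h.
apply: lee_nneseries => k _ //.
apply: le_trans (measureU2 _ (mS k) (measurable_negative k)) _.
rewrite [X in (_ + X)%E](_ : _ = 0%E); last exact: prob_negative.
rewrite adde0 -(sum_survivor false).
by apply: measure_bigU_le => v; exact: measurable_survivor.
Qed.

Theorem asep_at_limit :
  (fun n => \sum_(k < n) path_prob k) @ \oo --> fine (P event).
Proof.
have f : (fine (P event))%:E = P event by rewrite fineK // fin_num_measure //; exact: measurable_event.
apply: sup_of_partial_sums; first exact: path_prob_ge0.
- by move=> n; rewrite -lee_fin f; exact: event_lower.
- by rewrite f; exact: event_upper.
Qed.

End AsepLaw.

(** * The transition probability *)

Theorem theorem1 (R : realType) (N L : nat) (p q : R)
    (N_ge1 : (1 <= N)%N) (L_ge1 : (1 <= L)%N)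
    (p01 : 0 < p < 1) (q01 : 0 < q < 1) (pq1 : p + q = 1)
    (X Y : {ffun 'I_N -> int})
    (X_config : is_config L X) (Y_config : is_config L Y)
    (t : R) (t_ge0 : 0 <= t)
    (r : R) (r_small : admissible_radius p q r) :
  csummable (intvec_sum 0) (u_term L p q r Y X t) /\
  forall (d : measure_display) (Omega : measurableType d)
    (P : probability Omega R)
    (E : 'I_N -> nat -> {RV P >-> R}) (B : 'I_N -> nat -> {RV P >-> bool}),
    asep_clocks p E B ->
    (fine (P (asep_at (fun i k => E i k) (fun i k => B i k) L Y t X)))%:C =
      u_sum L p q r Y X t.
Proof.
have /andP[p0 _] := p01; have /andP[q0 _] := q01.
have [summable limit] := u_sum_expansion N_ge1 L_ge1 p0 q0 pq1 r_small t_ge0 X_config Y_config.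
split=> // d Omega P E B clocks; apply/esym/limit.
exact: (asep_at_limit clocks N_ge1 (L := L) (X := X) (Y := Y) p0 q0 pq1 t_ge0).
Qed.
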